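(* Let $\mathbb{B}^d$ be the closed Euclidean unit ball of $\mathbb{R}^d$, and let $D$ be any distribution over $\mathbb{B}^d\times\{\pm1\}$ with class-probability function $\eta\in\mathrm{SIM}(L,W)$. Suppose $\bar D=\mathrm{SIN}(D,f_{-1},f_1)$, where $f_{-1},f_1$ are Lipschitz (and $\mathrm{BCN}^+$-admissible together with the score and $\eta$). Then one can construct, from a corrupted sample $\bar S\sim\bar D^m$ using the SLIsotron algorithm, a function $\hat{\bar\eta}_{\bar S}\colon\mathbb{B}^d\to[0,1]$ (an iterate of SLIsotron, at an appropriately selected iteration) such that, as $m\to\infty$, $$\mathrm{reg}_{\mathrm{rank}}(\hat{\bar\eta}_{\bar S};D)\to0\quad\text{in probability}.$$ Further, if $f_{-1}=f_1$, then one can construct a classifier of the form $c_{\bar S}\colon x\mapsto\mathrm{sign}(2\hat{\bar\eta}_{\bar S}(x)-1)$ such that, as $m\to\infty$, $$\mathrm{reg}(c_{\bar S};D,\ell^{01})\to0\quad\text{in probability}.$$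
   Context: All functions are taken to be measurable. A distribution $D$ over $\mathcal{X}\times\{\pm1\}$ (here $\mathcal{X}=\mathbb{B}^d$) of a pair $(X,Y)$ has marginal $M=\mathbb{P}(X)$, class-probability function $\eta(x)=\mathbb{P}(Y=1\mid X=x)$, base rate $\pi=\mathbb{P}(Y=1)\in(0,1)$, and class-conditionals $P=\mathbb{P}(X\mid Y=1)$, $Q=\mathbb{P}(X\mid Y=-1)$. A scorer is any $s\colon\mathcal{X}\to\mathbb{R}$. Zero-one loss: $\ell^{01}(y,v)=\mathbf{1}[yv<0]+\tfrac12\mathbf{1}[v=0]$. Zero-one regret: $\mathrm{reg}(s;D,\ell^{01})=R(s;D,\ell^{01})-\inf_t R(t;D,\ell^{01})$ with $R(s;D,\ell^{01})=\mathbb{E}_{(X,Y)\sim D}[\ell^{01}(Y,s(X))]$. Ranking risk: $R_{\mathrm{rank}}(s;D)=\mathbb{E}_{X\sim P,X'\sim Q}[\ell^{01}(1,s(X)-s(X'))]$ with $X,X'$ independent; ranking regret: $\mathrm{reg}_{\mathrm{rank}}(s;D)=R_{\mathrm{rank}}(s;D)-\inf_tR_{\mathrm{rank}}(t;D)$. Infima are over all scorers. SIM family: for $L,W\in\mathbb{R}_+$, $\mathrm{SIM}(L,W)$ is the set of functions $x\mapsto u(\langle w^*,x\rangle)$ with $u\colon\mathbb{R}\to[0,1]$ non-decreasing and $L$-Lipschitz and $w^*\in\mathbb{R}^d$, $\|w^*\|\le W$. Noise: for $\rho_{\pm1}\colon\mathcal{X}\to[0,1]$, $\mathrm{ILN}(D,\rho_{-1},\rho_1)$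 is the distribution of $(X,\bar Y)$ obtained by drawing $(X,Y)\sim D$ and flipping the label with probability $\rho_Y(X)$. Standing assumption (bounded total noise): $\rho_1(x)+\rho_{-1}(x)<1$ for all $x\in\mathcal{X}$. Given $f_{\pm1}\colon\mathbb{R}\to[0,1]$ and $s\colon\mathcal{X}\to\mathbb{R}$, $\mathrm{BCN}^+(D,f_{-1},f_1,s)=\mathrm{ILN}(D,f_{-1}\circ s,f_1\circ s)$, where $(f_{-1},f_1,s,\eta)$ is required to be $\mathrm{BCN}^+$-admissible: (a) $\eta(x)<\eta(x')\implies s(x)<s(x')$ for all $x,x'$; (b) for $y\in\{\pm1\}$ and all $x,x'$ with $s(x)\le s(x')$: if $\eta(x),\eta(x')\le\frac12$ then $f_y(s(x))\le f_y(s(x'))$, and if $\eta(x),\eta(x')\ge\frac12$ then $f_y(s(x))\ge f_y(s(x'))$; (c) $f_1-f_{-1}$ is non-increasing. If $\eta(x)=u(\langle w^*,x\rangle)$, then $\mathrm{SIN}(D,f_{-1},f_1)=\mathrm{BCN}^+(D,f_{-1},f_1,s^* )$ with $s^*(x)=\langle w^*,x\rangle$. SLIsotron: given data $(x_i,y_i)_{i=1}^m$ with labels recoded as $y_i\in\{0,1\}$ (i.e. $(\bar y_i+1)/2$), start from $w_1=0$ and for $t=1,2,\dots$: (i) let $u_t$ be the LPAV fit to the points $(\langle w_t,x_i\rangle,y_i)$, i.e. the least-squares fit of the $y_i$ by values $u_t(\langle w_t,x_i\rangle)$ that are non-decreasing and 1-Lipschitz in $\langle w_t,x_i\rangle$,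 extended by linear interpolation between the points and constantly outside them; (ii) set $w_{t+1}=w_t+\frac1m\sum_{i=1}^m\big(y_i-u_t(\langle w_t,x_i\rangle)\big)x_i$. The estimate at iteration $t$ is $x\mapsto u_t(\langle w_t,x\rangle)$. The procedure takes only the sample as input; $u$, $w^*$ and $f_{\pm1}$ are unknown to it. It is known (Kakade et al., 2011) that for any $D$ over $\mathbb{B}^d\times\{\pm1\}$ with $\eta\in\mathrm{SIM}(1,W)$, with probability at least $1-\delta$ over a sample of size $m$ from $D$, some iterate $\hat\eta_t$ of SLIsotron satisfies $\mathbb{E}_{X\sim M}[(\hat\eta_t(X)-\eta(X))^2]\le\big(\frac{dW^2}{m}\big)^{1/3}\big(\log\frac{Wm}{\delta}\big)^{1/3}$. *)

(* Defs.v *)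
(* Mathematical Components with MathComp-Analysis. *)
From HB Require Import structures.
From mathcomp Require Import all_boot all_order all_algebra.
From mathcomp Require Import all_classical all_reals all_analysis.

Set Implicit Arguments.
Unset Strict Implicit.
Unset Printing Implicit Defensive.

Import Order.TTheory GRing.Theory Num.Theory.
Import numFieldNormedType.Exports.

Local Open Scope classical_set_scope.
Local Open Scope ring_scope.

(* Points of R^d are tuples, so that they carry the product (hence Borel)
   sigma-algebra of the library. *)
Notation vec R d := (d.-tuple (measurableTypeR R)).

Section euclidean.
Context {R : realType} {d : nat}.
Implicit Types x y : vec R d.

Definition inner x y : R := \sum_(i < d) tnth x i * tnth y i.
Definition enorm x : R := Num.sqrt (inner x x).
Definition eball : set (vec R d) := [set x | enorm x <= 1].

End euclidean.

(* A label is a boolean: true stands for +1, false for -1. *)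
Definition label (R : realType) (y : bool) : R := if y then 1 else -1.
Notation labeled R d := (vec R d * bool)%type.

Section distributions.
Context {R : realType} {d : nat}.
Implicit Types D Dbar : probability (labeled R d) R.

Definition feature (z : labeled R d) : vec R d := z.1.

HB.instance Definition _ :=
  isMeasurableFun.Build _ _ _ _ feature measurable_fst.

Definition marginal D : probability (vec R d) R := distribution D feature.

Definition has_label (y : bool) : set (labeled R d) := [set z | z.2 = y].

Lemma measurable_has_label y : measurable (has_label y).
Proof.
rewrite (_ : has_label y = setT `*` [set y]); first exact: measurableX.
by apply/seteqP; split=> [[a b]|[a b] []].
Qed.

Definition base_rate D : R := fine (D (has_label true)).

(* The law of X given Y = y; the second argument of mnormalize is a dummy
   value, used only if Y = y has probability 0. *)
Definition class_conditional D y : probability (vec R d) R :=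
  distribution (mnormalize (mrestr D (measurable_has_label y)) D) feature.

(* eta is only meaningful on the ball, to which D is confined. *)
Definition is_class_probability D (eta : vec R d -> R) :=
  [/\ measurable_fun setT eta,
      forall x, eball x -> 0 <= eta x <= 1 &
      forall A : set (vec R d), measurable A ->
        D (A `*` [set true]) = (\int[marginal D]_(x in A) (eta x)%:E)%E].

End distributions.

Section risks.
Context {R : realType} {d : nat}.
Implicit Types (D : probability (labeled R d) R) (s t : vec R d -> R).

Definition loss01 (y v : R) : R :=
  (y * v < 0)%R%:R + 2^-1 * (v == 0)%R%:R.

Definition risk01 D s : R :=
  \int[D]_z loss01 (label R z.2) (s z.1).

Definition regret01 D s : R :=
  risk01 D s - inf [set risk01 D t | t in [set t | measurable_fun setT t]].

Definition rank_risk D s : R :=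
  \int[class_conditional D true]_x
    \int[class_conditional D false]_x' loss01 1 (s x - s x').

Definition rank_regret D s : R :=
  rank_risk D s - inf [set rank_risk D t | t in [set t | measurable_fun setT t]].

End risks.

Section noise.
Context {R : realType} {d : nat}.
Implicit Types (D Dbar : probability (labeled R d) R).
Implicit Types (eta s : vec R d -> R) (u fm fp : R -> R) (w : vec R d).

(* The link u and the weight w represent eta as an element of SIM(L, W). *)
Definition SIM_representation (L W : R) u w eta :=
  [/\ forall z, 0 <= u z <= 1,
      {homo u : z z' / z <= z'},
      L.-lipschitz u,
      enorm w <= W &
      forall x, eball x -> eta x = u (inner w x)].

(* Dbar is the law of the pair obtained by drawing (x, y) from D and flipping
   y with probability rm x if y = -1 and rp x if y = +1. *)
Definition is_ILN D (rm rp : vec R d -> R) Dbar :=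
  forall B : set (labeled R d), measurable B ->
    Dbar B = (\int[D]_z
      (let rho := (if z.2 then rp else rm) z.1 in
       (1 - rho) * \1_B z + rho * \1_B (z.1, ~~ z.2))%:E)%E.

Definition BCN_admissible fm fp s eta :=
  [/\ forall x x', eball x -> eball x' -> eta x < eta x' -> s x < s x',
      forall f, f = fm \/ f = fp ->
        forall x x', eball x -> eball x' -> s x <= s x' ->
          (eta x <= 2^-1 -> eta x' <= 2^-1 -> f (s x) <= f (s x')) /\
          (2^-1 <= eta x -> 2^-1 <= eta x' -> f (s x') <= f (s x)) &
      forall z z', z <= z' -> fp z' - fm z' <= fp z - fm z].

(* The noise rates are probabilities and the total noise is bounded. *)
Definition is_BCN D eta fm fp s Dbar :=
  [/\ forall z, 0 <= fm z <= 1,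
      forall z, 0 <= fp z <= 1,
      forall x, eball x -> fp (s x) + fm (s x) < 1,
      BCN_admissible fm fp s eta &
      is_ILN D (fm \o s) (fp \o s) Dbar].

Definition is_SIN D eta w fm fp Dbar :=
  is_BCN D eta fm fp (inner w) Dbar.

End noise.

Section slisotron.
Context {R : realType} {d : nat}.

Definition LPAV_feasible (m : nat) (z : 'I_m -> R) (v : 'I_m -> R) :=
  forall i j, z i <= z j -> 0 <= v j - v i <= z j - z i.

(* The last three clauses: linear between consecutive points, constant outside
   their range.  For m > 0 exactly one function u satisfies this. *)
Definition is_LPAV (m : nat) (z y : 'I_m -> R) (u : R -> R) :=
  [/\ LPAV_feasible z (u \o z),
      forall v, LPAV_feasible z v ->
        \sum_(i < m) (y i - u (z i)) ^+ 2 <= \sum_(i < m) (y i - v i) ^+ 2,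
      forall i j, z i < z j -> (forall k, ~~ (z i < z k < z j)) ->
        forall a, z i <= a <= z j ->
          u a = u (z i) + (u (z j) - u (z i)) / (z j - z i) * (a - z i),
      forall i, (forall k, z i <= z k) -> forall a, a <= z i -> u a = u (z i) &
      forall i, (forall k, z k <= z i) -> forall a, z i <= a -> u a = u (z i)].

Definition LPAV (m : nat) (z y : 'I_m -> R) : R -> R :=
  xget (fun=> 0) [set u | is_LPAV z y u].

Variables (m : nat) (S : m.-tuple (labeled R d)).

Definition LPAV_along (w : vec R d) : R -> R :=
  LPAV (fun i => inner w (tnth S i).1) (fun i => (tnth S i).2%:R).

(* Counted from 0: slisotron_weight t is the weight w_(t+1). *)
Fixpoint slisotron_weight (t : nat) : vec R d :=
  if t is t'.+1 then
    let w := slisotron_weight t' in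
    [tuple tnth w k + m%:R^-1 * \sum_(i < m)
       ((tnth S i).2%:R - LPAV_along w (inner w (tnth S i).1)) *
         tnth (tnth S i).1 k | k < d]
  else [tuple 0 | k < d].

Definition slisotron (t : nat) (x : vec R d) : R :=
  LPAV_along (slisotron_weight t) (inner (slisotron_weight t) x).

End slisotron.

Section iid.
Context {dT : measure_display} {T : measurableType dT} {R : realType}.

Definition tcons (m : nat) (p : T * m.-tuple T) : m.+1.-tuple T :=
  [the m.+1.-tuple T of p.1 :: p.2].

Lemma measurable_tcons m : measurable_fun setT (@tcons m).
Proof. exact: measurable_cons. Qed.

HB.instance Definition _ m :=
  isMeasurableFun.Build _ _ _ _ (@tcons m) (@measurable_tcons m).

(* The m-fold product of P: the law of an i.i.d. sample of size m. *)
Fixpoint iid (P : probability T R) (m : nat) : probability (m.-tuple T) R :=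
  match m with
  | 0 => \d_([tuple] : 0.-tuple T)
  | m'.+1 => distribution (P \x iid P m')%E (@tcons m')
  end.

(* V m is a statistic of a sample of size m.  Probabilities of exceedance are
   outer ones, so that nothing is presupposed about the measurability of V m;
   on measurable events the outer measure is the measure itself. *)
Definition cvg0_in_probability (P : probability T R)
    (V : forall m, m.-tuple T -> R) :=
  forall eps : R, 0 < eps ->
    (fun m => ((iid P m)^*)%mu [set S | eps < `|V m S|]) @ \oo --> 0%E.

End iid.

(* Main.v *)
(* The corrupted class-probability function etabar is again of single-index
   form: admissibility makes u (1 - f_1) + (1 - u) f_{-1} nondecreasing on the
   range of the score, with slope at least c times that of u, where c > 0 is the
   minimum of 1 - f_1 - f_{-1} on this compact range.  So
   |eta x - eta x'| <= |etabar x - etabar x'| / c with the same sign, and both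
   regrets of an estimate h of etabar are at most a constant times
   E|h - etabar|.  It remains to make E|h - etabar| small.

   SLIsotron is analysed as a perceptron-like descent: compare the fit uh to the
   noisy labels with the fit ut to the conditional means yb.  The variational
   inequality of the projection gives sum (yb - ut) (<w* - w, x>) >=
   sum (yb - ut)^2, and sum (uh - ut)^2 <= sum (y - yb) (uh - ut), which is small
   by a uniform law of large numbers.  Hence |w_t - w*|^2 decreases by the
   empirical error of w_t up to a small term, and some iterate is good.

   The selected iterate minimises the empirical squared error among the first
   k_m, where k_m grows so slowly that the law of large numbers holds uniformly
   over functions with Lipschitz constant k_m: partition the ball into a fine
   grid and bound the empirical frequencies of the cells by Chebyshev's
   inequality.  No rate is needed.  The selection is measurable because the fit
   is a Hoelder continuous function of the abscissae. *)
Require Import Defs.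
From HB Require Import structures.
From mathcomp Require Import all_boot all_order all_algebra.
From mathcomp Require Import all_classical all_reals all_analysis.
From mathcomp Require Import measurable_realfun.
From mathcomp Require Import ring lra.
Import Order.TTheory GRing.Theory Num.Theory.
Import numFieldNormedType.Exports.
Local Open Scope classical_set_scope.
Local Open Scope ring_scope.

Set Implicit Arguments.
Unset Strict Implicit.
Unset Printing Implicit Defensive.

(** * The Lipschitz isotonic fit *)

(** The fits depend on the whole sample, so no concentration bound for a fixed function covers them.
    All that is known beforehand is that a coordinate of the weight moves by at most 1 per
    iteration, so uniformity is required over all functions nearly constant on grid cells; a cell
    records the label too, so that residuals qualify. A single index k fixes all scales. With
    [K = k + 1] there are K iterations and cells of side [K^-8]; weights of size K turn this into
    deviations of order [K^-7]. Passing from the squared to the absolute distance of the two fits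
    costs a square root, whence [K^-3], and the weights cost another factor K. What is left, [K^-2],
    still tends to 0. Selection by noisy error is legitimate because [E(y - h)^2] and
    [E(etabar - h)^2] differ by a constant independent of h. The link of etabar has an unknown
    Lipschitz constant Lam, whereas the fit has slope at most 1. The factor Lam is moved into the
    target weight, which occurs in the analysis only. *)

Lemma clip_spec {R : realType} (a b x : R) : a <= b ->
  let c := Num.min b (Num.max a x) in
  [\/ x <= a /\ c = a, a <= x <= b /\ c = x | b <= x /\ c = b].
Proof.
move=> ab; case: (leP x a) => xa; first by constructor 1; rewrite (min_idPr _).
case: (leP b x) => bx; first by constructor 3.
by constructor 2; rewrite !ltW.
Qed.

Definition slope01 {R : realType} (u : R -> R) :=
  forall a b, a <= b -> 0 <= u b - u a <= b - a.

Lemma slope01_lip {R : realType} (u : R -> R) : slope01 u ->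
  forall a b, `|u a - u b| <= `|a - b|.
Proof.
move=> mu a b; have [ab|/ltW ab] := leP a b; have := mu _ _ ab.
  by rewrite distrC (distrC a) => /andP[v0 v1]; rewrite !ger0_norm// subr_ge0.
by move=> /andP[v0 v1]; rewrite !ger0_norm// subr_ge0.
Qed.

Lemma slope01_continuous {R : realType} (u : R -> R) : slope01 u -> continuous u.
Proof.
move=> mu a; apply/cvgrPdist_le => /= e e0; near=> b.
apply: le_trans (slope01_lip mu _ _) _; near: b.
exact: cvgr_dist_le.
Unshelve. all: by end_near.
Qed.

Section lpav_fit.
Context {R : realType} {m : nat}.
Implicit Types z y p v : 'I_m -> R.

Definition LPAV_fit z y p :=
  LPAV_feasible z p /\
  forall v, LPAV_feasible z v ->
    \sum_i (y i - p i) ^+ 2 <= \sum_i (y i - v i) ^+ 2.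

(** First-order optimality: the segment from [p] to [v] stays feasible, and along it the squared
    error changes by [th (th q - 2 c)], which minimality keeps nonnegative for every [th] in ]0,
    1]. *)
Lemma LPAV_fit_variational z y p v : LPAV_fit z y p -> LPAV_feasible z v ->
  \sum_i (y i - p i) * (v i - p i) <= 0.
Proof.
move=> [fp minp] fv; set c := \sum_i _.
pose q := \sum_i (v i - p i) ^+ 2.
have q0 : 0 <= q by apply: sumr_ge0 => i _; exact: sqr_ge0.
have key (th : R) : 0 < th <= 1 -> 2 * c <= th * q.
  move=> /andP[th0 th1].
  have /minp : LPAV_feasible z (fun i => p i + th * (v i - p i)).
    move=> i j zij; have /andP[p0 p1] := fp i j zij.
    have /andP[v0 v1] := fv i j zij; apply/andP; split.
      have -> : p j + th * (v j - p j) - (p i + th * (v i - p i)) =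
        (1 - th) * (p j - p i) + th * (v j - v i) by ring.
      by rewrite addr_ge0 ?mulr_ge0//; lra.
    have -> : p j + th * (v j - p j) - (p i + th * (v i - p i)) =
      (1 - th) * (p j - p i) + th * (v j - v i) by ring.
    have -> : z j - z i = (1 - th) * (z j - z i) + th * (z j - z i) by ring.
    by apply: lerD; apply: ler_wpM2l => //; lra.
  have -> : \sum_i (y i - (p i + th * (v i - p i))) ^+ 2 =
      \sum_i (y i - p i) ^+ 2 - th * (2 * c - th * q).
    rewrite /c /q !mulr_sumr -sumrB mulr_sumr -sumrB.
    by apply: eq_bigr => i _; ring.
  by rewrite lerBrDl gerDr pmulr_rle0// subr_le0.
rewrite leNgt; apply/negP => c0.
(* If [c > 0], this [th] gives [th q <= c < 2 c]; the [+ 1] covers [q = 0]. *)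
have := key (Num.min 1 (c / (q + 1))).
have q1 : 0 < q + 1 by rewrite ltr_wpDl.
rewrite lt_min ltr01 divr_gt0//= ge_min lexx => /(_ isT).
have : Num.min 1 (c / (q + 1)) * q <= c / (q + 1) * q.
  by rewrite ler_wpM2r// ge_min lexx orbT.
have : c / (q + 1) * q <= c.
  by rewrite mulrAC ler_pdivrMr// ler_wpM2l ?(ltW c0)// lerDl.
lra.
Qed.

Lemma LPAV_feasible_clip z v (a b : R) : a <= b -> LPAV_feasible z v ->
  LPAV_feasible z (fun i => Num.min b (Num.max a (v i))).
Proof.
move=> ab fv i j zij; have /andP[v0 v1] := fv i j zij.
case: (clip_spec (v i) ab) => -[? ->]; case: (clip_spec (v j) ab) => -[? ->];
  by apply/andP; split; lra.
Qed.

(** Optimality is tested against the fit clipped to [a, b]. Where clipping moves [p j], the response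
    [y j] lies at or beyond the clipped value, so each term dominates the squared displacement; a
    sum that is at most 0 then leaves no displacement. *)
Lemma LPAV_fit_bounds z y p (a b : R) : LPAV_fit z y p ->
  (forall i, a <= y i <= b) -> forall i, a <= p i <= b.
Proof.
move=> fp yab i.
have ab : a <= b by have /andP[] := yab i; exact: le_trans.
have := LPAV_fit_variational fp (LPAV_feasible_clip ab fp.1).
set F := fun j => (y j - p j) * (Num.min b (Num.max a (p j)) - p j).
rewrite -/(\sum_i F i) => F0.
have Fsq j : (Num.min b (Num.max a (p j)) - p j) ^+ 2 <= F j.
  rewrite /F; have /andP[y0 y1] := yab j.
  case: (clip_spec (p j) ab) => -[? ->]; last 2 first.
  - by rewrite subrr mulr0 expr0n.
  - nra.
  - nra.
have : (Num.min b (Num.max a (p i)) - p i) ^+ 2 <= 0.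
  apply: le_trans F0; rewrite (bigD1 i)//= -[leLHS]addr0 lerD//.
  by apply: sumr_ge0 => j _; apply: le_trans (Fsq j); exact: sqr_ge0.
rewrite real_exprn_even_le0 ?num_real//= subr_eq0 => /eqP <-.
by case: (clip_spec (p i) ab) => -[? ->]; lra.
Qed.

(** Each fit is a competitor for the other; adding the two variational inequalities gives the firm
    nonexpansiveness of the projection. The product form is kept, without Cauchy-Schwarz, because
    the law of large numbers makes it small when [y - y'] is noise. *)
Lemma LPAV_fit_noise z y y' p p' : LPAV_fit z y p -> LPAV_fit z y' p' ->
  \sum_i (p i - p' i) ^+ 2 <= \sum_i (y i - y' i) * (p i - p' i).
Proof.
move=> fp fp'.
have := LPAV_fit_variational fp fp'.1; have := LPAV_fit_variational fp' fp.1.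
move=> h1 h2; have := lerD h1 h2; rewrite addr0 -big_split/= => h.
rewrite -subr_le0 -sumrB; apply: le_trans h.
by apply: ler_sum => i _; rewrite le_eqVlt; apply/orP; left; apply/eqP; ring.
Qed.

(* Monotone 1-Lipschitz functions through the two fits, evaluated at the
   abscissae of the other one, are competitors for both. *)
Lemma LPAV_fit_holder z z' y p p' (f f' : R -> R) :
  slope01 f ->
  slope01 f' ->
  LPAV_fit z y p -> LPAV_fit z' y p' ->
  (forall i, f (z i) = p i) -> (forall i, f' (z' i) = p' i) ->
  (forall i, 0 <= y i <= 1) ->
  \sum_i (p i - p' i) ^+ 2 <= 2 * \sum_i `|z i - z' i|.
Proof.
move=> mf mf' fp fp' fE f'E y01.
have h1 : \sum_i (y i - p i) * (f' (z i) - p i) <= 0.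
  by apply: LPAV_fit_variational fp _ => i j; exact: mf'.
have h2 : \sum_i (y i - p' i) * (f (z' i) - p' i) <= 0.
  by apply: LPAV_fit_variational fp' _ => i j; exact: mf.
have := lerD h1 h2; rewrite addr0 -big_split/= => h.
rewrite -subr_le0; apply: le_trans h; rewrite mulr_sumr -sumrB.
apply: ler_sum => i _.
have /andP[y0 y1] := y01 i.
have /andP[p0 p1] := LPAV_fit_bounds fp y01 i.
have /andP[p'0 p'1] := LPAV_fit_bounds fp' y01 i.
have := slope01_lip mf' (z i) (z' i); have := slope01_lip mf (z i) (z' i).
rewrite fE f'E !ler_norml; set e := `|_| => /andP[a1 a2] /andP[b1 b2].
have e0 : 0 <= e by exact: normr_ge0.
have -> : (y i - p i) * (f' (z i) - p i) + (y i - p' i) * (f (z' i) - p' i) =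
  (p i - p' i) ^+ 2 - ((y i - p i) * (p' i - f' (z i)) + (y i - p' i) * (p i - f (z' i))).
  by ring.
rewrite lerD2l lerN2.
(* Each remaining cross term pairs a residual in [-1, 1] with an error [e] of evaluating one curve
   at the other abscissa. *)
have b (s t : R) : -1 <= s <= 1 -> -e <= t <= e -> s * t <= e.
  move=> s1 t1; apply: le_trans (ler_norm _) _; rewrite normrM -[e]mul1r.
  by apply: ler_pM => //; rewrite ler_norml.
by have -> : 2 * e = e + e by [ring]; apply: lerD; apply: b; lra.
Qed.

(** Were [u] invertible, moving [p] slightly in the direction [z - u^-1 p] would be feasible, so
    [u s - p] would have nonpositive product with [z - u^-1 p]; and
    [(u s - p) (s - u^-1 p) >= (u s - p)^2] because [u] is nondecreasing with slope at most 1. A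
    right inverse [sg] on the finitely many values of [p] is enough. *)
Lemma LPAV_fit_noiseless z s p (u : R -> R) :
  slope01 u ->
  LPAV_fit z (u \o s) p ->
  \sum_i (u (s i) - p i) ^+ 2 <= \sum_i (u (s i) - p i) * (s i - z i).
Proof.
move=> mu fp.
have [sg sgE] : exists sg : R -> R, forall i, u (sg (p i)) = p i.
  suff /choice[sg sgE] : forall q : R, exists c, (exists i, p i = q) -> u c = q.
    by exists sg => i; apply: sgE; exists i.
  move=> q; have [[i piq]|] := pselect (exists i, p i = q); last by exists 0.
  (* Fitted values stay between the extreme responses [u a] and [u b], so the intermediate value
     theorem attains them. *)
  pose a := s [arg min_(j < i) s j]%O; pose b := s [arg max_(j > i) s j]%O.
  have ab j : a <= s j <= b.
    apply/andP; split.
      by rewrite /a; case: Order.TotalTheory.arg_minP => // k _ ->.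
    by rewrite /b; case: Order.TotalTheory.arg_maxP => // k _; apply.
  have leab : a <= b by have /andP[] := ab i; exact: le_trans.
  have uab : u a <= u b by have := mu _ _ leab; lra.
  have := LPAV_fit_bounds (a := u a) (b := u b) fp.
  have h j : u a <= (u \o s) j <= u b.
    have /andP[aj jb] := ab j; have := mu _ _ aj; have := mu _ _ jb; rewrite /=; lra.
  move=> /(_ h i); rewrite piq => qab.
  have [||c _ uc] := @IVT R u a b q leab.
  - exact/continuous_subspaceT/slope01_continuous.
  - by rewrite /Num.min /Num.max; case: ltP => // ba; lra.
  - by exists c.
pose f i := sg (p i).
(* A Lipschitz constant of [f] as a function of [p]: the sum of all difference quotients dominates
   each of them, and quotients with denominator 0 count as 0. *)
pose K := \sum_i \sum_j `|f j - f i| / `|p j - p i|.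
have term0 i j : 0 <= `|f j - f i| / `|p j - p i| by rewrite divr_ge0.
have K0 : 0 <= K by apply: sumr_ge0 => i _; apply: sumr_ge0.
have fK i j : `|f j - f i| <= K * `|p j - p i|.
  have [pij|pij] := eqVneq (p j) (p i); first by rewrite /f pij !subrr normr0 mulr0.
  rewrite -ler_pdivrMr ?normr_gt0 ?subr_eq0//.
  rewrite /K (bigD1 i)//= (bigD1 j)//= -addrA lerDl.
  by rewrite addr_ge0// sumr_ge0// => k _; apply: sumr_ge0.
have fge i j : `|p j - p i| <= `|f j - f i|.
  by rewrite -[p j]sgE -[p i]sgE; exact: slope01_lip.
have fmono i j : p i <= p j -> f i <= f j.
  move=> pij; rewrite leNgt; apply/negP => fji.
  have := mu _ _ (ltW fji); rewrite !sgE => hm.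
  have e : p j = p i by lra.
  by move: fji; rewrite /f e ltxx.
have dfE i j : p i <= p j -> p j - p i <= f j - f i <= K * (p j - p i).
  move=> pij; have := fge i j; have := fK i j.
  by rewrite !ger0_norm ?subr_ge0 ?fmono// => -> ->.
(* Then [th K <= 1 - th], so the drop [th (f j - f i)] is at most [(1 - th) (p j - p i)] and the
   perturbed fit stays monotone; its slope bound comes from [f j - f i >= p j - p i]. *)
pose th := (1 + K)^-1.
have th0 : 0 < th by rewrite invr_gt0; lra.
have thK : th * K <= 1 - th.
  by rewrite /th; have : (1 + K)^-1 * (1 + K) = 1 by [rewrite mulVf//; lra]; lra.
have th1 : th <= 1 by nra.
have fz : LPAV_feasible z (fun i => p i + th * (z i - f i)).
  move=> i j zij; have /andP[p0 p1] := fp.1 _ _ zij.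
  have /andP[f0 f1] : p j - p i <= f j - f i <= K * (p j - p i).
    by apply: dfE; rewrite -subr_ge0.
  have zij0 : 0 <= z j - z i by rewrite subr_ge0.
  have h1 : th * (f j - f i) <= (1 - th) * (p j - p i).
    have : th * (f j - f i) <= th * (K * (p j - p i)) by rewrite ler_wpM2l// ltW.
    by rewrite mulrA; move/le_trans; apply; rewrite ler_wpM2r.
  have h2 : 0 <= th * (z j - z i) by rewrite mulr_ge0// ltW.
  have h3 : th * (p j - p i) <= th * (f j - f i) by rewrite ler_wpM2l// ltW.
  have h4 : (1 - th) * (p j - p i) <= (1 - th) * (z j - z i).
    by rewrite ler_wpM2l// subr_ge0.
  have h5 : 0 <= th * (p j - p i) by rewrite mulr_ge0// ltW.
  by apply/andP; split; lra.
have := LPAV_fit_variational fp fz.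
have -> : \sum_i ((u \o s) i - p i) * (p i + th * (z i - f i) - p i) =
    th * \sum_i (u (s i) - p i) * (z i - f i).
  by rewrite mulr_sumr; apply: eq_bigr => i _ /=; ring.
rewrite pmulr_rle0// => h.
rewrite -subr_ge0 -sumrB; apply: le_trans (_ : 0 <= - \sum_i (u (s i) - p i) * (z i - f i)) _; first by rewrite oppr_ge0.
rewrite -sumrN; apply: ler_sum => i _.
rewrite -subr_ge0.
have -> : (u (s i) - p i) * (s i - z i) - (u (s i) - p i) ^+ 2 - - ((u (s i) - p i) * (z i - f i)) = (u (s i) - p i) * ((s i - f i) - (u (s i) - p i)) by ring.
rewrite -[p i]sgE -/(f i).
have [sf|/ltW sf] := leP (s i) (f i); have /andP[g1 g2] := mu _ _ sf.
  by rewrite mulr_le0//; lra.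
by rewrite mulr_ge0//; lra.
Qed.

(** The feasible set is unbounded, since constants may be added, so the minimum is taken over its
    compact part in the unit cube. Clipping a competitor to [0, 1] does not raise its error because
    the responses lie there. *)
Lemma LPAV_fit_exists z y : (forall i, 0 <= y i <= 1) ->
  exists p, LPAV_fit z y p.
Proof.
move=> y01.
pose A := [set v : 'rV[R]_m | (forall i, v ord0 i \in `[0, 1]%R) /\
  LPAV_feasible z (v ord0)].
have cc i : continuous (fun v : 'rV[R]_m => v ord0 i) by exact: coord_continuous.
have cA : compact A.
  have -> : A = [set v : 'rV[R]_m | forall i, v ord0 i \in `[0, 1]] `&`
      \bigcap_(ij in [set ij : 'I_m * 'I_m | z ij.1 <= z ij.2])
        [set v : 'rV[R]_m | 0 <= v ord0 ij.2 - v ord0 ij.1 <= z ij.2 - z ij.1].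
    apply/seteqP; split=> [v [v01 fv]|v [v01 fv]].
      split=> [i|[i j] /= zij]; last exact: fv.
      exact: v01.
    split=> [i|i j zij]; [exact: v01|exact: (fv (i, j))].
  apply: compact_closedI.
    apply: (@rV_compact _  _ (fun=> `[0 : R, 1]%classic)) => _.
    exact: segment_compact.
  apply: closed_bigI => -[i j] /= zij.
  have cd : continuous (fun v : 'rV[R]_m => v ord0 j - v ord0 i).
    by move=> v; exact: (cvgB (cc j v) (cc i v)).
  rewrite (_ : mkset _ = (fun v : 'rV[R]_m => v ord0 j - v ord0 i) @^-1` `[0, z j - z i]%classic).
    by apply: closed_comp => [v _|]; [exact: cd|exact: itv_closed].
  by apply/seteqP; split=> v /=; rewrite in_itv.
have A0 : A !=set0.
  exists 0; split=> [i|i j zij]; rewrite !mxE ?in_itv/= ?lexx ?ler01//.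
  by rewrite subrr lexx subr_ge0.
have [|p /set_mem[p01 fp] pmin] := compact_EVT_min (f := fun v : 'rV[R]_m => \sum_i (y i - v ord0 i) ^+ 2) A0 cA.
  apply: continuous_subspaceT.
  apply: (@continuous_big _ _ _ _ _ _ _ _ (fun i (v : 'rV[R]_m) => (y i - v ord0 i) ^+ 2)).
    exact: add_continuous.
  move=> i _ v.
  apply: (cvg_comp (fun v : 'rV[R]_m => y i - v ord0 i) (fun a : R => a ^+ 2)); last exact: exprn_continuous.
  exact: (cvgB (cvg_cst (y i)) (cc i v)).
exists (p ord0); split=> // v fv.
pose v' : 'rV[R]_m := \row_i Num.min 1 (Num.max 0 (v i)).
have Av' : v' \in A.
  apply/mem_set; split=> [i|i j zij].
    rewrite /v' mxE in_itv/=.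
    by case: (clip_spec (v i) (@ler01 R)) => -[? ->]; lra.
  by have := LPAV_feasible_clip (@ler01 R) fv zij; rewrite !mxE.
apply: le_trans (pmin _ Av') _; apply: ler_sum => i _; rewrite mxE.
have /andP[y0 y1] := y01 i.
by case: (clip_spec (v i) (@ler01 R)) => -[? ->] //; nra.
Qed.

End lpav_fit.

(** * Piecewise linear extension of the fit *)

Section lpav_interpolation.
Context {R : realType} {m : nat}.
Implicit Types (z y p : 'I_m -> R) (u : R -> R).

Let last_below z a i := (z i <= a) && [forall k, (z k <= a) ==> (z k <= z i)].
Let first_above z a j := (a <= z j) && [forall k, (a <= z k) ==> (z j <= z k)].

Lemma LPAV_interpolation_exists z p : LPAV_feasible z p ->
  exists u, [/\ forall i, u (z i) = p i,
    forall i j, z i < z j -> (forall k, ~~ (z i < z k < z j)) ->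
      forall a, z i <= a <= z j ->
        u a = u (z i) + (u (z j) - u (z i)) / (z j - z i) * (a - z i),
    forall i, (forall k, z i <= z k) -> forall a, a <= z i -> u a = u (z i) &
    forall i, (forall k, z k <= z i) -> forall a, z i <= a -> u a = u (z i)].
Proof.
move=> fp.
have pz i j : z i = z j -> p i = p j.
  move=> zij; have /andP[+ +] : 0 <= p j - p i <= z j - z i by apply: fp; rewrite zij.
  by rewrite zij; lra.
(* Interpolation between the nearest abscissae on either side of [a]; the final value 0 is reached
   only for an empty sample. *)
pose u a := if [pick i | last_below z a i] is Some i then
    if [pick j | first_above z a j] is Some j then
      p i + (p j - p i) / (z j - z i) * (a - z i)
    else p i
  else if [pick j | first_above z a j] is Some j then p j else 0.
have lb_eq a i j : last_below z a i -> last_below z a j -> z i = z j.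
  move=> /andP[ia /forallP hi] /andP[ja /forallP hj]; apply/eqP.
  by rewrite eq_le (implyP (hi j))// (implyP (hj i)).
have fa_eq a i j : first_above z a i -> first_above z a j -> z i = z j.
  move=> /andP[ia /forallP hi] /andP[ja /forallP hj]; apply/eqP.
  by rewrite eq_le (implyP (hi j))// (implyP (hj i)).
have uM a i j : last_below z a i -> first_above z a j ->
    u a = p i + (p j - p i) / (z j - z i) * (a - z i).
  move=> ia ja; rewrite /u; case: pickP => [i' i'a|/(_ i)]; last by rewrite ia.
  case: pickP => [j' j'a|/(_ j)]; last by rewrite ja.
  by rewrite !(lb_eq _ _ _ ia i'a) !(fa_eq _ _ _ ja j'a)
     (pz _ _ (lb_eq _ _ _ ia i'a)) (pz _ _ (fa_eq _ _ _ ja j'a)).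
have uz i : u (z i) = p i.
  rewrite (uM _ i i) ?subrr ?mulr0 ?addr0// /last_below /first_above lexx/=;
  by apply/forallP => k; apply/implyP.
exists u; split=> //.
- move=> i j zij cons a /andP[ia aj]; rewrite !uz.
  have [->|nai] := eqVneq a (z i); first by rewrite uz subrr mulr0 addr0.
  have [->|naj] := eqVneq a (z j).
    by rewrite uz divfK ?subr_eq0 ?gt_eqF// addrC subrK.
  have {nai}ia : z i < a by rewrite lt_neqAle eq_sym nai.
  have {naj}aj : a < z j by rewrite lt_neqAle naj.
  apply: uM; apply/andP; split; rewrite ?ltW//; apply/forallP => k; apply/implyP => ka.
    have := cons k; rewrite (le_lt_trans ka aj) andbT -leNgt; exact.
  have := cons k; rewrite (lt_le_trans ia ka)/= -leNgt; exact.
- move=> i mini a ai; rewrite uz.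
  have fi : first_above z a i.
    by rewrite /first_above ai; apply/forallP => k; apply/implyP.
  have [aiE|nai] := eqVneq a (z i); first by rewrite aiE uz.
  rewrite /u; case: pickP => [k /andP[ka _]|_].
    by move: nai; rewrite eq_le ai (le_trans (mini k)).
  case: pickP => [j ja|/(_ i)]; last by rewrite fi.
  by apply: pz; exact: fa_eq ja fi.
- move=> i maxi a ai; rewrite uz.
  have li : last_below z a i.
    by rewrite /last_below ai; apply/forallP => k; apply/implyP.
  have [aiE|nai] := eqVneq a (z i); first by rewrite aiE uz.
  rewrite /u; case: pickP => [k ka|/(_ i)]; last by rewrite li.
  case: pickP => [j /andP[ja _]|_]; last by apply: pz; exact: lb_eq ka li.
  by move: nai; rewrite eq_le ai andbT (le_trans ja).
Qed.

Lemma LPAV_exists z y : (forall i, 0 <= y i <= 1) -> exists u, is_LPAV z y u.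
Proof.
move=> /(LPAV_fit_exists z)[p [fp minp]].
have [u [uz h1 h2 h3]] := LPAV_interpolation_exists fp.
have e : u \o z = p by apply/funext.
exists u; split=> //; rewrite ?e// => v /minp.
by under [in X in _ -> X]eq_bigr do rewrite uz.
Qed.

Lemma is_LPAV_LPAV z y : (forall i, 0 <= y i <= 1) -> is_LPAV z y (LPAV z y).
Proof. by move=> /(LPAV_exists z)[u hu]; apply: xgetPex; exists u. Qed.

Lemma is_LPAV_fit z y u : is_LPAV z y u -> LPAV_fit z y (u \o z).
Proof. by case. Qed.

(** The defining clauses concern neighbouring abscissae only. A point is compared with every sample
    abscissa on its left and on its right; two arbitrary points are then joined through a sample
    abscissa between them, or else lie in one affine piece. An empty sample puts no constraint on
    [u], hence [0 < m]. *)
Lemma is_LPAV_slope01 z y u : (0 < m)%N -> is_LPAV z y u -> slope01 u.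
Proof.
case: m z y => [//|n] z y _ [fu _ hM hL hR].
have slope i j : z i < z j -> 0 <= (u (z j) - u (z i)) / (z j - z i) <= 1.
  move=> zij; have /andP[u0 u1] := fu _ _ (ltW zij).
  by rewrite divr_ge0//= ?ler_pdivrMr ?subr_gt0// ?mul1r// subr_ge0 ltW.
have cases a : [\/ exists2 i, (forall k, z i <= z k) & a <= z i,
    exists2 i, (forall k, z k <= z i) & z i <= a |
    exists i j, [/\ z i < z j, forall k, ~~ (z i < z k < z j) & z i <= a <= z j]].
  have [i0 mini] : exists i, forall k, z i <= z k.
    exists [arg min_(i < ord0) z i]%O.
    by case: Order.TotalTheory.arg_minP => // k _ h j; exact: h.
  have [j0 maxj] : exists i, forall k, z k <= z i.
    exists [arg max_(i > ord0) z i]%O.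
    by case: Order.TotalTheory.arg_maxP => // k _ h j; exact: h.
  have [ai|ia] := leP a (z i0); first by constructor 1; exists i0.
  have [ja|aj] := leP (z j0) a; first by constructor 2; exists j0.
  constructor 3.
  exists [arg max_(i > i0 | z i <= a) z i]%O, [arg min_(i < j0 | a < z i) z i]%O.
  case: Order.TotalTheory.arg_maxP => [|i ia' maxi]; first exact: ltW.
  case: Order.TotalTheory.arg_minP => // j aj' minj.
  split; rewrite ?ia' ?(ltW aj')//; first exact: le_lt_trans aj'.
  move=> k; apply/negP => /andP[ik kj].
  have [ka|ak] := leP (z k) a.
    by have /(lt_le_trans ik) := maxi _ ka; rewrite ltxx.
  by have /le_lt_trans/(_ kj) := minj _ ak; rewrite ltxx.
have sampleR k a : z k <= a -> 0 <= u a - u (z k) <= a - z k.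
  move=> ka; case: (cases a) => [[i mini ai]|[i maxi ia]|[i [j [zij cons /andP[ia aj]]]]].
  - have -> : a = z k by apply/eqP; rewrite eq_le ka (le_trans ai).
    by rewrite !subrr lexx.
  - rewrite (hR _ maxi _ ia); have /andP[h0 h1] := fu _ _ (maxi k).
    by move: h0 h1 => /= h0 h1; apply/andP; split; lra.
  - have /andP[s0 s1] := slope _ _ zij.
    have [kz|zk] := leP (z k) (z i).
      rewrite (hM _ _ zij cons a) ?ia//.
      have /andP[/= h0 h1] := fu _ _ kz; set s := _ / _ in s0 s1 *.
      have ia0 : 0 <= a - z i by rewrite subr_ge0.
      have : 0 <= s * (a - z i) <= a - z i.
        by rewrite mulr_ge0//= ler_piMl.
      by move=> /andP[? ?]; apply/andP; split; lra.
    have jk : z j <= z k by have := cons k; rewrite zk/= -leNgt.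
    have -> : a = z k by apply/eqP; rewrite eq_le ka (le_trans aj).
    by rewrite !subrr lexx.
have sampleL k a : a <= z k -> 0 <= u (z k) - u a <= z k - a.
  move=> ka; case: (cases a) => [[i mini ai]|[i maxi ia]|[i [j [zij cons /andP[ia aj]]]]].
  - rewrite (hL _ mini _ ai); have /andP[h0 h1] := fu _ _ (mini k).
    by move: h0 h1 => /= h0 h1; apply/andP; split; lra.
  - have -> : a = z k by apply/eqP; rewrite eq_le ka (le_trans (maxi k)).
    by rewrite !subrr lexx.
  - have /andP[s0 s1] := slope _ _ zij.
    have [kz|zk] := leP (z j) (z k).
      rewrite (hM _ _ zij cons a) ?ia//.
      have /andP[/= h0 h1] := fu _ _ kz.
      have : (u (z j) - u (z i)) = (u (z j) - u (z i)) / (z j - z i) * (z j - a) + (u (z j) - u (z i)) / (z j - z i) * (a - z i).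
        by rewrite -mulrDr subrKA divfK// subr_eq0 gt_eqF.
      set s := _ / _ in s0 s1 *.
      have ja0 : 0 <= z j - a by rewrite subr_ge0.
      have : 0 <= s * (z j - a) <= z j - a.
        by rewrite mulr_ge0//= ler_piMl.
      by move=> /andP[? ?] ?; apply/andP; split; lra.
    have jk : z k <= z i by have := cons k; rewrite zk andbT -leNgt.
    have -> : a = z k by apply/eqP; rewrite eq_le ka (le_trans jk).
    by rewrite !subrr lexx.
move=> a b ab.
have [[k /andP[ak kb]]|nk] := pselect (exists k, a <= z k <= b).
  have /andP[? ?] := sampleL _ _ ak; have /andP[? ?] := sampleR _ _ kb.
  by apply/andP; split; lra.
have {}nk k : a <= z k -> b < z k.
  by move=> ak; rewrite ltNge; apply/negP => kb; apply: nk; exists k; rewrite ak.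
case: (cases a) => [[i mini ai]|[i maxi ia]|[i [j [zij cons /andP[ia aj]]]]].
- by rewrite (hL _ mini _ ai) (hL _ mini b) ?(ltW (nk _ ai))// subrr lexx subr_ge0.
- by rewrite (hR _ maxi _ ia) (hR _ maxi b) ?(le_trans ia)// subrr lexx subr_ge0.
- rewrite (hM _ _ zij cons a) ?ia// (hM _ _ zij cons b) ?(le_trans ia) ?(ltW (nk _ aj))//.
  have /andP[s0 s1] := slope _ _ zij; set s := _ / _ in s0 s1 *.
  have -> : u (z i) + s * (b - z i) - (u (z i) + s * (a - z i)) = s * (b - a) by ring.
  by rewrite mulr_ge0 ?subr_ge0//= ler_piMl ?subr_ge0.
Qed.

Lemma is_LPAV_bounds z y u (a b : R) : (0 < m)%N -> is_LPAV z y u ->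
  (forall i, a <= y i <= b) -> forall x, a <= u x <= b.
Proof.
move=> m0 hu yab x; have su := is_LPAV_slope01 m0 hu.
have pab := LPAV_fit_bounds (is_LPAV_fit hu) yab.
case: m z y hu yab pab m0 => [//|n] z y [fu _ _ hL hR] yab pab _.
have [i0 mini] : exists i, forall k, z i <= z k.
  exists [arg min_(i < ord0) z i]%O.
  by case: Order.TotalTheory.arg_minP => // k _ h j; exact: h.
have [j0 maxj] : exists i, forall k, z k <= z i.
  exists [arg max_(i > ord0) z i]%O.
  by case: Order.TotalTheory.arg_maxP => // k _ h j; exact: h.
have [xi|/ltW ix] := leP x (z i0); first by rewrite (hL _ mini _ xi); exact: (pab i0).
have [jx|/ltW xj] := leP (z j0) x; first by rewrite (hR _ maxj _ jx); exact: (pab j0).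
have /andP[? _] := su _ _ ix; have /andP[? _] := su _ _ xj.
have /andP[/= ? _] := pab i0; have /andP[/= _ ?] := pab j0.
by apply/andP; split; lra.
Qed.

End lpav_interpolation.

(** * Descent of SLIsotron *)

Section mean.
Context {R : realType} {m : nat}.
Implicit Types f g : 'I_m -> R.

Definition mean f : R := m%:R^-1 * \sum_i f i.

Lemma meanD f g : mean (fun i => f i + g i) = mean f + mean g.
Proof. by rewrite /mean big_split mulrDr. Qed.

Lemma meanZ c f : mean (fun i => c * f i) = c * mean f.
Proof. by rewrite /mean -mulr_sumr mulrCA. Qed.

Lemma meanB f g : mean (fun i => f i - g i) = mean f - mean g.
Proof. by rewrite /mean sumrB mulrBr. Qed.

Lemma eq_mean f g : f =1 g -> mean f = mean g.
Proof. by move=> fg; rewrite /mean (eq_bigr _ (fun i _ => fg i)). Qed.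

Lemma le_mean f g : (forall i, f i <= g i) -> mean f <= mean g.
Proof. by move=> fg; rewrite /mean ler_wpM2l ?invr_ge0// ler_sum. Qed.

Lemma mean_cst c : (0 < m)%N -> mean (fun=> c) = c.
Proof.
move=> m0; rewrite /mean sumr_const card_ord -[c *+ m]mulr_natl mulKf//.
by rewrite pnatr_eq0 -lt0n.
Qed.

Lemma ler_norm_mean f : `|mean f| <= mean (fun i => `|f i|).
Proof.
by rewrite /mean normrM ger0_norm ?invr_ge0// ler_wpM2l ?invr_ge0// ler_norm_sum.
Qed.

(* Integrated form of [2 b |f| <= f ^ 2 + b ^ 2]. *)
Lemma mean_norm_le f b : (0 < m)%N -> 0 < b ->
  mean (fun i => f i ^+ 2) <= b ^+ 2 -> mean (fun i => `|f i|) <= b.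
Proof.
move=> m0 b0 hf.
have : 2 * b * mean (fun i => `|f i|) <= mean (fun i => f i ^+ 2) + b ^+ 2.
  rewrite -meanZ -[b ^+ 2](mean_cst _ m0) -meanD; apply: le_mean => i.
  by have := sqr_ge0 (`|f i| - b); rewrite sqrrB real_normK ?num_real// -mulr_natl; lra.
move=> h; have {h} : 2 * b * mean (fun i => `|f i|) <= 2 * b * b by lra.
by rewrite ler_pM2l// mulr_gt0.
Qed.

End mean.

Lemma exchange_mean {R : realType} (m d : nat) (F : 'I_m -> 'I_d -> R) :
  \sum_k mean (fun i => F i k) = mean (fun i => \sum_k F i k).
Proof. by rewrite /mean -mulr_sumr exchange_big. Qed.

Section vectors.
Context {R : realType} {d : nat}.
Implicit Types x y w : vec R d.

(** Cauchy-Schwarz, read off from [\sum (B a - C b)^2 = B (A B - C^2)]. *)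
Lemma sum_mul_sqr_le (a b : 'I_d -> R) :
  (\sum_k a k * b k) ^+ 2 <= (\sum_k a k ^+ 2) * (\sum_k b k ^+ 2).
Proof.
set A := \sum_k a k ^+ 2; set B := \sum_k b k ^+ 2; set C := \sum_k _.
have B0 : 0 <= B by apply: sumr_ge0 => k _; exact: sqr_ge0.
have [BE|Bn0] := eqVneq B 0.
  have b0 k : b k = 0.
    apply/eqP; rewrite -sqrf_eq0; apply/eqP.
    have /psumr_eq0P/(_ k isT) := BE; apply => // j _; exact: sqr_ge0.
  by rewrite /C big1 ?expr0n/= ?BE ?mulr0// => k _; rewrite b0 mulr0.
have Bp : 0 < B by rewrite lt_neqAle eq_sym Bn0.
have : 0 <= \sum_k (B * a k - C * b k) ^+ 2 by apply: sumr_ge0 => k _; exact: sqr_ge0.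
have -> : \sum_k (B * a k - C * b k) ^+ 2 = B * (A * B - C ^+ 2).
  transitivity (\sum_k (B ^+ 2 * a k ^+ 2 - 2 * B * C * (a k * b k) + C ^+ 2 * b k ^+ 2)).
    by apply: eq_bigr => k _; ring.
  by rewrite big_split sumrB/= -!mulr_sumr -/A -/B -/C; ring.
by rewrite pmulr_rge0// subr_ge0.
Qed.

Lemma inner_ge0 x : 0 <= inner x x.
Proof. by apply: sumr_ge0 => k _; rewrite -expr2 sqr_ge0. Qed.

Lemma innerE x : inner x x = \sum_k tnth x k ^+ 2.
Proof. by apply: eq_bigr => k _; rewrite expr2. Qed.

Lemma eball_inner x : eball x -> inner x x <= 1.
Proof.
rewrite /eball/= /enorm => h; rewrite -[inner x x]sqr_sqrtr ?inner_ge0//.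
by rewrite exprn_ile1// sqrtr_ge0.
Qed.

Lemma inner_eball x : inner x x <= 1 -> eball x.
Proof. by move=> h; rewrite /eball/= /enorm -sqrtr1 ler_wsqrtr. Qed.

Lemma eball_coord x k : eball x -> `|tnth x k| <= 1.
Proof.
move=> /eball_inner h; rewrite -(@expr_le1 _ 2)// real_normK ?num_real//.
apply: le_trans h; rewrite innerE (bigD1 k)//= lerDl sumr_ge0// => j _.
exact: sqr_ge0.
Qed.

Lemma inner_le_enorm w x : eball x -> `|inner w x| <= enorm w.
Proof.
move=> /eball_inner h.
rewrite -(@ler_pXn2r _ 2) ?nnegrE ?sqrtr_ge0// real_normK ?num_real//.
rewrite /enorm sqr_sqrtr ?inner_ge0//.
apply: le_trans (sum_mul_sqr_le _ _) _; rewrite -!innerE.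
by rewrite ler_piMr ?inner_ge0.
Qed.

(** Grid cells control coordinates, so the l1 norm of the weight serves as Lipschitz constant
    throughout. *)
Lemma inner_sub_le w x x' (e : R) : 0 <= e ->
  (forall k, `|tnth x k - tnth x' k| <= e) ->
  `|inner w x - inner w x'| <= (\sum_k `|tnth w k|) * e.
Proof.
move=> e0 h; rewrite /inner -sumrB mulr_suml.
apply: le_trans (ler_norm_sum _ _ _) _; apply: ler_sum => k _.
by rewrite -mulrBr normrM ler_wpM2l.
Qed.

End vectors.

Section slisotron_step.
Context {R : realType} {d m : nat}.
Variables (S : m.-tuple (labeled R d)) (v : R -> R) (ws : vec R d).
Hypothesis m_gt0 : (0 < m)%N.
Hypothesis Sball : forall i, eball (tnth S i).1.
Hypothesis v_slope : slope01 v.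
Hypothesis v_01 : forall a, 0 <= v a <= 1.

Let x i := (tnth S i).1.
Let y i : R := (tnth S i).2%:R.
Let yb i := v (inner ws (x i)).

Let xball i : eball (x i). Proof. exact: Sball. Qed.

Lemma label01 i : 0 <= y i <= 1.
Proof. by rewrite /y; case: (tnth S i).2; rewrite ?lexx ler01. Qed.

Lemma LPAV_along_is_LPAV w :
  is_LPAV (fun i => inner w (x i)) y (LPAV_along S w).
Proof. by apply: is_LPAV_LPAV; exact: label01. Qed.

Lemma LPAV_along_slope01 w : slope01 (LPAV_along S w).
Proof. exact: is_LPAV_slope01 (LPAV_along_is_LPAV w). Qed.

Lemma LPAV_along_01 w a : 0 <= LPAV_along S w a <= 1.
Proof. exact: is_LPAV_bounds (LPAV_along_is_LPAV w) label01 a. Qed.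

Lemma slisotron_01 t a : 0 <= slisotron S t a <= 1.
Proof. exact: LPAV_along_01. Qed.

(** Residuals, and coordinates of points of the ball, lie in [-1, 1], so one update moves a
    coordinate by at most 1. *)
Lemma slisotron_weight_le t k : `|tnth (slisotron_weight S t) k| <= t%:R.
Proof.
elim: t => [|t IHt] /=; first by rewrite tnth_mktuple normr0.
rewrite tnth_mktuple; apply: le_trans (ler_normD _ _) _.
rewrite -natr1 lerD//; set w := slisotron_weight S t.
rewrite -[leLHS]/(`|mean (fun i => (y i - LPAV_along S w (inner w (x i))) * tnth (x i) k)|).
apply: le_trans (ler_norm_mean _) _; rewrite -[leRHS](mean_cst 1 m_gt0).
apply: le_mean => i; rewrite normrM mulr_ile1 ?(eball_coord _ (xball i))//.
have /andP[y0 y1] := label01 i.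
by have /andP[? ?] := LPAV_along_01 w (inner w (x i)); rewrite ler_norml; lra.
Qed.

(** The fit to the conditional means along [w]. It is not observable and serves only as an
    intermediary between the fit to the labels and the target link. *)
Definition clean_fit w := LPAV (fun i => inner w (x i)) yb.

Lemma clean_fit_is_LPAV w : is_LPAV (fun i => inner w (x i)) yb (clean_fit w).
Proof. by apply: is_LPAV_LPAV => i; exact: v_01. Qed.

Lemma clean_fit_slope01 w : slope01 (clean_fit w).
Proof. exact: is_LPAV_slope01 (clean_fit_is_LPAV w). Qed.

Lemma clean_fit_01 w a : 0 <= clean_fit w a <= 1.
Proof. by apply: is_LPAV_bounds (clean_fit_is_LPAV w) _ a => // i; exact: v_01. Qed.

Let dist2 w := \sum_k (tnth ws k - tnth w k) ^+ 2.

(** With g the update, E the error of [uh] and A that of [ut], the squared distance changes by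
    [- 2 <ws - w, g> + |g|^2]. Here [<ws - w, g>] is at least A minus two errors of size
    [(W + d T) beta], while [|g|^2 <= E + 2 d beta] and [E <= A + 2 beta], so up to these errors the
    decrease is at least [2 A - E >= E - 4 beta]. The premise [nu <= beta ^+ 2] pays for passing
    from the mean squared to the mean absolute distance of the two fits. *)
Lemma slisotron_descent t (W T nu beta : R) :
  let w := slisotron_weight S t in
  let uh i := LPAV_along S w (inner w (x i)) in
  let ut i := clean_fit w (inner w (x i)) in
  \sum_k `|tnth ws k| <= W -> (forall k, `|tnth w k| <= T) ->
  0 < beta <= 1 -> nu <= beta ^+ 2 ->
  (forall k, `|mean (fun i => (y i - yb i) * tnth (x i) k)| <= nu) ->
  mean (fun i => (y i - yb i) * (uh i - ut i)) <= nu ->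
  mean (fun i => (yb i - uh i) ^+ 2) <=
    dist2 w - dist2 (slisotron_weight S t.+1) +
    (4 + 4 * (W + d%:R * T) + 2 * d%:R) * beta.
Proof.
move=> w uh ut hW hT /andP[b0 b1] hnu h1 h2.
pose z i := inner w (x i); pose s i := inner ws (x i).
pose g k := mean (fun i => (y i - uh i) * tnth (x i) k).
pose E := mean (fun i => (yb i - uh i) ^+ 2).
pose A := mean (fun i => (yb i - ut i) ^+ 2).
pose B := mean (fun i => `|uh i - ut i|).
pose n k := mean (fun i => (y i - yb i) * tnth (x i) k).
have nub : nu <= beta by apply: le_trans hnu _; rewrite expr2 ler_piMl// ltW.
have W0 : 0 <= W by apply: le_trans hW; exact: sumr_ge0.
have dT0 : 0 <= d%:R * T.
  case: (posnP d) => [->|d0]; first by rewrite mul0r.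
  by rewrite mulr_ge0//; exact: le_trans (normr_ge0 _) (hT (Ordinal d0)).
have l1dist : \sum_k `|tnth ws k - tnth w k| <= W + d%:R * T.
  apply: le_trans (_ : \sum_k (`|tnth ws k| + `|tnth w k|) <= _).
    by apply: ler_sum => k _; exact: ler_normB.
  rewrite big_split/= lerD//; apply: le_trans (_ : \sum_(k < d) T <= _).
    exact: ler_sum.
  by rewrite sumr_const card_ord mulr_natl.
have hyb i : 0 <= yb i <= 1 by exact: v_01.
have huh i : 0 <= uh i <= 1 by exact: LPAV_along_01.
have hut i : 0 <= ut i <= 1 by exact: clean_fit_01.
have hB : B <= beta.
  apply: mean_norm_le => //; apply: le_trans hnu; apply: le_trans h2.
  rewrite /mean ler_wpM2l ?invr_ge0//.
  have := LPAV_fit_noise (is_LPAV_fit (LPAV_along_is_LPAV w)) (is_LPAV_fit (clean_fit_is_LPAV w)).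
  exact.
have hA : A <= mean (fun i => (yb i - ut i) * (s i - z i)).
  rewrite /A /mean ler_wpM2l ?invr_ge0//.
  exact: (LPAV_fit_noiseless v_slope (is_LPAV_fit (clean_fit_is_LPAV w))).
have sz i : s i - z i = \sum_k (tnth ws k - tnth w k) * tnth (x i) k.
  by rewrite /s /z /inner -sumrB; apply: eq_bigr => k _; rewrite mulrBl.
have szle i : `|s i - z i| <= W + d%:R * T.
  rewrite sz; apply: le_trans (ler_norm_sum _ _ _) _; apply: le_trans l1dist.
  by apply: ler_sum => k _; rewrite normrM ler_piMr//; exact: eball_coord.
have gsz : \sum_k (tnth ws k - tnth w k) * g k = mean (fun i => (y i - uh i) * (s i - z i)).
  under eq_bigr do rewrite -meanZ.
  rewrite exchange_mean; apply: eq_mean => i; rewrite sz mulr_sumr.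
  by apply: eq_bigr => k _; rewrite mulrCA.
have nsz : \sum_k (tnth ws k - tnth w k) * n k = mean (fun i => (y i - yb i) * (s i - z i)).
  under eq_bigr do rewrite -meanZ.
  rewrite exchange_mean; apply: eq_mean => i; rewrite sz mulr_sumr.
  by apply: eq_bigr => k _; rewrite mulrCA.
have hn : `|\sum_k (tnth ws k - tnth w k) * n k| <= (W + d%:R * T) * beta.
  apply: le_trans (ler_norm_sum _ _ _) _.
  apply: le_trans (_ : (\sum_k `|tnth ws k - tnth w k|) * beta <= _); last by rewrite ler_wpM2r// ltW.
  rewrite mulr_suml; apply: ler_sum => k _; rewrite normrM ler_wpM2l//.
  exact: le_trans (h1 k) nub.
have hBs : `|mean (fun i => (ut i - uh i) * (s i - z i))| <= (W + d%:R * T) * beta.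
  apply: le_trans (ler_norm_mean _) _.
  apply: le_trans (_ : (W + d%:R * T) * B <= _); last by rewrite ler_wpM2l// addr_ge0.
  rewrite -meanZ; apply: le_mean => i; rewrite normrM distrC (mulrC (W + _)) ler_wpM2l//.
have hsplit : mean (fun i => (y i - uh i) * (s i - z i)) =
    mean (fun i => (y i - yb i) * (s i - z i)) +
    mean (fun i => (yb i - ut i) * (s i - z i)) +
    mean (fun i => (ut i - uh i) * (s i - z i)).
  by rewrite -!meanD; apply: eq_mean => i; ring.
(* The difference of the squares is [(ut - uh) (2 yb - uh - ut)], whose second factor lies in
   [-2, 2]. *)
have hEA : E <= A + 2 * B.
  rewrite /E /A /B -meanZ -meanD; apply: le_mean => i.
  have /andP[? ?] := hyb i; have /andP[? ?] := huh i; have /andP[? ?] := hut i.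
  have [h|h] := leP 0 (uh i - ut i).
    by rewrite ger0_norm//; nra.
  by rewrite ltr0_norm//; nra.
(* Pairing g with itself, Young's inequality and [<g, x>^2 <= |g|^2] on the ball give
   [|g|^2 <= d beta + (E + |g|^2) / 2]. The resulting coefficient 1 of E matters, since the linear
   term supplies only 2 A. *)
have hg : \sum_k g k ^+ 2 <= 2 * d%:R * beta + E.
  have gle k : `|g k| <= 1.
    rewrite /g; apply: le_trans (ler_norm_mean _) _; rewrite -[leRHS](mean_cst 1 m_gt0).
    apply: le_mean => i; rewrite normrM mulr_ile1 ?(eball_coord _ (xball i))//.
    have /andP[? ?] := label01 i; have /andP[? ?] := huh i.
    by rewrite ler_norml; lra.
  pose q i := \sum_k g k * tnth (x i) k.
  have e1 : \sum_k g k ^+ 2 = \sum_k g k * n k + mean (fun i => (yb i - uh i) * q i).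
    have -> : mean (fun i => (yb i - uh i) * q i) = \sum_k g k * mean (fun i => (yb i - uh i) * tnth (x i) k).
      under [RHS]eq_bigr do rewrite -meanZ.
      rewrite exchange_mean; apply: eq_mean => i; rewrite /q mulr_sumr.
      by apply: eq_bigr => k _; rewrite mulrCA.
    rewrite -big_split/=; apply: eq_bigr => k _; rewrite -mulrDr expr2; congr (_ * _).
    by rewrite -meanD; apply: eq_mean => i; ring.
  have e2 : \sum_k g k * n k <= d%:R * beta.
    apply: le_trans (_ : \sum_(k < d) beta <= _); last by rewrite sumr_const card_ord mulr_natl.
    apply: ler_sum => k _; apply: le_trans (ler_norm _) _; rewrite normrM -[leRHS]mul1r.
    by apply: ler_pM => //; exact: le_trans (h1 k) nub.
  have e3 : 2 * mean (fun i => (yb i - uh i) * q i) <= E + \sum_k g k ^+ 2.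
    have -> : \sum_k g k ^+ 2 = mean (fun i : 'I_m => \sum_k g k ^+ 2) by rewrite mean_cst.
    rewrite -meanZ -meanD; apply: le_mean => i.
    have qi : q i ^+ 2 <= \sum_k g k ^+ 2.
      apply: le_trans (sum_mul_sqr_le _ _) _; rewrite -innerE ler_piMr//.
        by apply: sumr_ge0 => k _; exact: sqr_ge0.
      exact/eball_inner/xball.
    by have := sqr_ge0 (yb i - uh i - q i); nra.
  lra.
have hPhi : dist2 (slisotron_weight S t.+1) =
    dist2 w - 2 * \sum_k (tnth ws k - tnth w k) * g k + \sum_k g k ^+ 2.
  rewrite /dist2 mulr_sumr -sumrB -big_split/=; apply: eq_bigr => k _.
  rewrite tnth_mktuple -/w -[_^-1 * _]/(g k); ring.
rewrite -/E hPhi gsz hsplit -nsz.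
move: hn hBs; rewrite !ler_norml => /andP[? _] /andP[? _].
have := lexx ((W + d%:R * T) * beta).
have -> : (4 + 4 * (W + d%:R * T) + 2 * d%:R) * beta = 4 * beta + 4 * ((W + d%:R * T) * beta) + 2 * d%:R * beta by ring.
lra.
Qed.

(** The descent telescopes from the weight 0, so the errors of the first K iterates add up to at
    most [|ws|^2 + K xi], and one of them does not exceed the average. *)
Lemma slisotron_best_iterate (K : nat) (W nu beta : R) :
  (0 < K)%N ->
  \sum_k `|tnth ws k| <= W -> 0 < beta <= 1 -> nu <= beta ^+ 2 ->
  (forall k, `|mean (fun i => (y i - yb i) * tnth (x i) k)| <= nu) ->
  (forall t, (t < K)%N -> let w := slisotron_weight S t in
     mean (fun i => (y i - yb i) *
       (LPAV_along S w (inner w (x i)) - clean_fit w (inner w (x i)))) <= nu) ->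
  exists2 t, (t < K)%N & mean (fun i => (yb i - slisotron S t (x i)) ^+ 2) <=
    (\sum_k tnth ws k ^+ 2) / K%:R +
    (4 + 4 * (W + d%:R * K%:R) + 2 * d%:R) * beta.
Proof.
move=> K0 hW hb hnu h1 h2; set xi := (4 + 4 * (W + d%:R * K%:R) + 2 * d%:R) * beta.
pose E t := mean (fun i => (yb i - slisotron S t (x i)) ^+ 2).
have step t : (t < K)%N -> E t <= dist2 (slisotron_weight S t) - dist2 (slisotron_weight S t.+1) + xi.
  move=> tK; apply: (slisotron_descent hW _ hb hnu h1 (h2 _ tK)) => k.
  by apply: le_trans (slisotron_weight_le _ _) _; rewrite ler_nat ltnW.
have tele n : (n <= K)%N -> \sum_(t < n) E t <=
    dist2 (slisotron_weight S 0) - dist2 (slisotron_weight S n) + n%:R * xi.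
  elim: n => [|n IHn] nK; first by rewrite big_ord0 subrr mul0r addr0.
  rewrite big_ord_recr/=; have := IHn (ltnW nK); have := step _ nK.
  by rewrite -natr1 mulrDl mul1r; lra.
apply: contrapT => hno.
have {}hno t : (t < K)%N -> (\sum_k tnth ws k ^+ 2) / K%:R + xi < E t.
  by move=> tK; rewrite ltNge; apply/negP => h; apply: hno; exists t.
have := tele K (leqnn K).
have d0 : dist2 (slisotron_weight S 0) = \sum_k tnth ws k ^+ 2.
  by apply: eq_bigr => k _; rewrite tnth_mktuple subr0.
have dK : 0 <= dist2 (slisotron_weight S K) by apply: sumr_ge0 => k _; exact: sqr_ge0.
have : \sum_(t < K) ((\sum_k tnth ws k ^+ 2) / K%:R + xi) < \sum_(t < K) E t.
  apply: ltr_sum => [|t _]; last exact: hno.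
  by apply/hasP; exists (Ordinal K0); rewrite ?mem_index_enum.
rewrite sumr_const card_ord -[_ *+ K]mulr_natl mulrDr mulrCA divff ?pnatr_eq0 -?lt0n// mulr1.
lra.
Qed.

End slisotron_step.

(** * Measurability of the selected iterate *)

Section quantisation.
Context {R : realType}.

Definition quant (n : nat) (a : R) : R := (Num.floor (n.+1%:R * a))%:~R / n.+1%:R.

Lemma quant_le n a : `|a - quant n a| <= n.+1%:R^-1.
Proof.
have n0 : 0 < n.+1%:R :> R by rewrite ltr0n.
rewrite /quant; have /andP[h1 h2] := floor_itv (n.+1%:R * a).
have -> : a - (Num.floor (n.+1%:R * a))%:~R / n.+1%:R =
    (n.+1%:R * a - (Num.floor (n.+1%:R * a))%:~R) / n.+1%:R.
  by rewrite mulrBl mulrAC divff ?mul1r// gt_eqF.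
rewrite ger0_norm ?divr_ge0 ?subr_ge0//.
rewrite ler_pdivrMr// mulVf ?gt_eqF//; move: h2; rewrite intrD; lra.
Qed.

(** Labels are integers, hence exact at every resolution: quantising a whole sample perturbs the
    abscissae only, and the Hoelder estimate compares fits to equal responses. *)
Lemma quant_bool n (b : bool) : quant n b%:R = b%:R.
Proof.
rewrite /quant; case: b; last by rewrite mulr0 floor0 mul0r.
by rewrite mulr1 -[n.+1%:R]/(n.+1%:Z%:~R) intrKfloor divff// pnatr_eq0.
Qed.

(* A pointwise limit of functions of countably valued measurable maps. *)
Lemma measurable_fun_quant dT (T : measurableType dT) (J : finType)
    (g : T -> J -> R) (F : (J -> R) -> R) :
  (forall j, measurable_fun setT (g^~ j)) ->
  (forall t, (fun n => F (fun j => quant n (g t j))) @ \oo --> F (g t)) ->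
  measurable_fun setT (fun t => F (g t)).
Proof.
move=> mg cF.
apply: (@measurable_fun_cvg _ _ _ setT (fun n t => F (fun j => quant n (g t j)))) => [n|t _]; last exact: cF.
pose c t : {ffun J -> int} := [ffun j => Num.floor (n.+1%:R * g t j)].
pose F' (k : {ffun J -> int}) := F (fun j => (k j)%:~R / n.+1%:R).
move=> _ Y mY; rewrite setTI.
rewrite (_ : _ @^-1` Y = \bigcup_k [set t | c t = k /\ Y (F' k)]); last first.
  apply/seteqP; split=> [t /= Yt|t [k _ /= [ck Yk]]].
    exists (c t) => //=; split=> //; move: Yt; congr (Y (F _)).
    by apply/funext => j; rewrite ffunE.
  move: Yk; congr (Y (F _)); apply/funext => j.
  by rewrite -ck ffunE.
apply: countable_bigcupT_measurable; first exact: countableP.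
move=> k; have [Yk|nYk] := pselect (Y (F' k)); last first.
  by rewrite (_ : mkset _ = set0)//; apply/seteqP; split=> // t [].
rewrite (_ : mkset _ = \bigcap_(j in [set: J]) [set t | (k j)%:~R <= n.+1%:R * g t j < (k j + 1)%:~R]).
  apply: fin_bigcap_measurable => // j _.
  rewrite (_ : mkset _ = setT `&` (fun t => n.+1%:R * g t j) @^-1` `[(k j)%:~R, (k j + 1)%:~R[%classic).
    by apply: measurable_funM => //; exact: mg.
  by rewrite setTI; apply/seteqP; split=> t /=; rewrite in_itv.
apply/seteqP; split=> [t /= [ck _] j _ /=|t /= h].
  by rewrite -ck ffunE; exact: floor_itv.
split=> //; apply/ffunP => j; rewrite ffunE; exact/floor_def/h.
Qed.

End quantisation.

Section slisotron_measurable.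
Context {R : realType} {d m : nat}.
Implicit Types S : m.-tuple (labeled R d).

(** [LPAV] is a choice by [xget], so no formula yields its measurability. Its value at a sample
    abscissa depends on the abscissae with Hoelder exponent 1/2, so it is the limit of its values at
    quantised data. *)
Lemma measurable_LPAV dT (T : measurableType dT) (z : T -> 'I_m -> R)
    (y : T -> 'I_m -> bool) (i : 'I_m) :
  (forall j, measurable_fun setT (z^~ j)) ->
  (forall j, measurable_fun setT (fun t => (y t j)%:R : R)) ->
  measurable_fun setT (fun t => LPAV (z t) (fun j => (y t j)%:R) (z t i)).
Proof.
move=> mz my.
have m0 : (0 < m)%N by case: m i => [[]|].
pose g t (j : 'I_m + 'I_m) : R := match j with inl j => z t j | inr j => (y t j)%:R end.
pose F (h : 'I_m + 'I_m -> R) := LPAV (h \o inl) (h \o inr) (h (inl i)).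
apply: (@measurable_fun_quant _ _ _ _ g F) => [[j|j]|t]; [exact: mz|exact: my|].
have -> : (fun n => F (fun j => quant n (g t j))) =
    (fun n => LPAV (quant n \o z t) (fun j => (y t j)%:R) (quant n (z t i))).
  apply/funext => n; rewrite /F /=; congr (LPAV _ _ _); apply/funext => j /=.
  exact: quant_bool.
rewrite {}/F {}/g /= /comp.
have y01 j : 0 <= ((y t j)%:R : R) <= 1 by case: (y t j); rewrite ?lexx ler01.
set p := LPAV (z t) _ _.
have bound n : (p - LPAV (quant n \o z t) (fun j => (y t j)%:R) (quant n (z t i))) ^+ 2 <= 2 * m%:R / n.+1%:R.
  have h1 := is_LPAV_LPAV (z t) y01; have h2 := is_LPAV_LPAV (quant n \o z t) y01.
  have := LPAV_fit_holder (is_LPAV_slope01 m0 h1) (is_LPAV_slope01 m0 h2)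
    (is_LPAV_fit h1) (is_LPAV_fit h2) (fun=> erefl) (fun=> erefl) y01.
  rewrite (bigD1 i)//= => h.
  apply: le_trans (le_trans _ h) _; first by rewrite lerDl sumr_ge0// => j _; exact: sqr_ge0.
  rewrite -mulrA ler_wpM2l//; apply: le_trans (ler_sum _ (fun j _ => quant_le n (z t j))) _.
  by rewrite sumr_const card_ord mulr_natl.
apply/cvgrPdist_lt => e e0.
have := @near_infty_natSinv_lt R (PosNum (divr_gt0 (exprn_gt0 2 e0) (ltr0Sn R (2 * m)))).
apply: filterS => n /= hn.
rewrite -(@ltr_pXn2r _ 2) ?nnegrE ?(ltW e0)// real_normK ?num_real//.
apply: le_lt_trans (bound n) _.
move: hn; rewrite ltr_pdivlMr// mulrC => /(le_lt_trans _); apply.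
by rewrite ler_wpM2r// -natrM ler_nat.
Qed.

Lemma measurable_coord i k :
  measurable_fun setT (fun S => tnth (tnth S i).1 k).
Proof.
apply: (measurableT_comp (measurable_tnth k)).
apply: (measurableT_comp measurable_fst); exact: measurable_tnth.
Qed.

Lemma measurable_label i : measurable_fun setT (fun S => ((tnth S i).2%:R : R)).
Proof.
apply: (measurableT_comp (f := fun b : bool => b%:R : R)) => //.
apply: (measurableT_comp measurable_snd); exact: measurable_tnth.
Qed.

Lemma measurable_inner dT (T' : measurableType dT) (w x : T' -> vec R d) :
  (forall k, measurable_fun setT (fun t => tnth (w t) k)) ->
  (forall k, measurable_fun setT (fun t => tnth (x t) k)) ->
  measurable_fun setT (fun t => inner (w t) (x t)).
Proof.
move=> mw mx; apply: measurable_sum => k; apply: measurable_funM; [exact: mw|exact: mx].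
Qed.

Lemma measurable_LPAV_along (w : m.-tuple (labeled R d) -> vec R d) i :
  (forall k, measurable_fun setT (fun S => tnth (w S) k)) ->
  measurable_fun setT (fun S => LPAV_along S (w S) (inner (w S) (tnth S i).1)).
Proof.
move=> mw; apply: (@measurable_LPAV _ _ (fun S j => inner (w S) (tnth S j).1) (fun S j => (tnth S j).2)) => j.
  by apply: measurable_inner => // k; exact: measurable_coord.
exact: measurable_label.
Qed.

Lemma measurable_slisotron_weight t k :
  measurable_fun setT (fun S => tnth (slisotron_weight S t) k).
Proof.
elim: t k => [|t IHt] k /=.
  under eq_fun do rewrite tnth_mktuple; exact: measurable_cst.
under eq_fun do rewrite tnth_mktuple.
apply: measurable_funD; first exact: IHt.
apply: measurable_funM => //; apply: measurable_sum => i.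
apply: measurable_funM; last exact: measurable_coord.
apply: measurable_funB; first exact: measurable_label.
exact: measurable_LPAV_along.
Qed.

Definition empirical_error (t : nat) S : R :=
  mean (fun i => ((tnth S i).2%:R - slisotron S t (tnth S i).1) ^+ 2).

Lemma measurable_empirical_error t : measurable_fun setT (empirical_error t).
Proof.
apply: measurable_funM => //; apply: measurable_sum => i.
apply: measurable_funX; apply: measurable_funB; first exact: measurable_label.
apply: measurable_LPAV_along => k; exact: measurable_slisotron_weight.
Qed.

(** The strict comparison keeps the earliest minimiser. *)
Fixpoint best_iterate (n : nat) S : nat :=
  if n is n'.+1 then
    if empirical_error n S < empirical_error (best_iterate n' S) S then n
    else best_iterate n' S
  else 0.

Lemma best_iterate_le n S : (best_iterate n S <= n)%N.
Proof. by elim: n => //= n IHn; case: ifP => // _; exact: leqW. Qed.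

Lemma best_iterate_min n S t : (t <= n)%N ->
  empirical_error (best_iterate n S) S <= empirical_error t S.
Proof.
elim: n => [|n IHn]; first by rewrite leqn0 => /eqP ->.
rewrite leq_eqVlt => /predU1P[->|] /=; first by case: ltP => // /ltW.
rewrite ltnS => /IHn h; case: ltP => // /ltW /le_trans; exact.
Qed.

(** The two claims need a joint induction: the comparison that decides the next index involves the
    error at the index selected so far, which is itself random. *)
Lemma measurable_best_iterate_error n :
  measurable_fun setT (best_iterate n) /\
  measurable_fun setT (fun S => empirical_error (best_iterate n S) S).
Proof.
elim: n => [|n [IH1 IH2]] /=.
  by split; [exact: measurable_cst|exact: measurable_empirical_error].
have mb : measurable_fun setT (fun S => empirical_error n.+1 S < empirical_error (best_iterate n S) S).
  by apply: measurable_fun_ltr => //; exact: measurable_empirical_error.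
split; first exact: measurable_fun_ifT.
under eq_fun do rewrite (fun_if (empirical_error ^~ _)).
by apply: measurable_fun_ifT => //; exact: measurable_empirical_error.
Qed.

Lemma measurable_best_iterate n : measurable_fun setT (best_iterate n).
Proof. by have [] := measurable_best_iterate_error n. Qed.

End slisotron_measurable.

(** * Expectations of bounded functions and moments of samples *)

Section bounded_measurable.
Context {dT : measure_display} {T : measurableType dT} {R : realType}.
Implicit Types (f g : T -> R) (P : probability T R).

(** Boundedness is required everywhere, so membership does not refer to a measure and integrability
    holds under each of the laws that occur. *)
Definition bmeas f := measurable_fun setT f /\ exists M : R, forall x, `|f x| <= M.

Lemma bmeas_cst c : bmeas (fun=> c).
Proof. by split; [exact: measurable_cst|exists `|c|]. Qed.

Lemma bmeasD f g : bmeas f -> bmeas g -> bmeas (fun x => f x + g x).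
Proof.
move=> [mf [M hM]] [mg [N hN]]; split; first exact: measurable_funD.
by exists (M + N) => x; apply: le_trans (ler_normD _ _) _; rewrite lerD.
Qed.

Lemma bmeasM f g : bmeas f -> bmeas g -> bmeas (fun x => f x * g x).
Proof.
move=> [mf [M hM]] [mg [N hN]]; split; first exact: measurable_funM.
by exists (M * N) => x; rewrite normrM ler_pM.
Qed.

Lemma bmeasZ c f : bmeas f -> bmeas (fun x => c * f x).
Proof. by move=> bf; apply: bmeasM => //; exact: bmeas_cst. Qed.

Lemma bmeasB f g : bmeas f -> bmeas g -> bmeas (fun x => f x - g x).
Proof.
move=> bf bg; have := bmeasD bf (bmeasZ (-1) bg).
by under eq_fun do rewrite mulN1r.
Qed.

Lemma bmeas_norm f : bmeas f -> bmeas (fun x => `|f x|).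
Proof.
move=> [mf [M hM]]; split; first exact: measurableT_comp.
by exists M => x; rewrite normr_id.
Qed.

Lemma bmeasX f n : bmeas f -> bmeas (fun x => f x ^+ n).
Proof.
move=> [mf [M hM]]; split; first exact: measurable_funX.
by exists (M ^+ n) => x; rewrite normrX lerXn2r ?nnegrE//; exact: le_trans (hM x).
Qed.

Lemma bmeas_indic A : measurable A -> bmeas (\1_A : T -> R).
Proof.
move=> mA; split; first exact: measurable_indic.
by exists 1 => x; rewrite indicE; case: (_ \in _); rewrite ?normr1 ?normr0.
Qed.

Lemma bmeas_sum (I : Type) (r : seq I) (f : I -> T -> R) :
  (forall i, bmeas (f i)) -> bmeas (fun x => \sum_(i <- r) f i x).
Proof.
move=> bf; elim: r => [|i r IHr].
  by under eq_fun do rewrite big_nil; exact: bmeas_cst.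
by under eq_fun do rewrite big_cons; exact: bmeasD.
Qed.

Lemma bmeas_integrable P f : bmeas f -> P.-integrable setT (EFin \o f).
Proof.
move=> [mf [M hM]]; apply: measurable_bounded_integrable => //.
  by rewrite /= probability_setT ltry.
exists M; split; first exact: num_real.
by move=> N MN x _; exact: le_trans (hM x) (ltW MN).
Qed.

Lemma bmeas_comp d' (T' : measurableType d') (X : T' -> T) f :
  measurable_fun setT X -> bmeas f ->
  measurable_fun setT (f \o X) /\ exists M : R, forall x, `|f (X x)| <= M.
Proof.
move=> mX [mf [M hM]]; split; first exact: measurableT_comp.
by exists M.
Qed.

Section expectation.
Variable P : probability T R.
Local Notation "''E' f" := (\int[P]_x f x) (at level 10, f at level 8).

Lemma ExD f g : bmeas f -> bmeas g -> 'E (fun x => f x + g x) = 'E f + 'E g.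
Proof. by move=> bf bg; rewrite RintegralD//; exact: bmeas_integrable. Qed.

Lemma ExB f g : bmeas f -> bmeas g -> 'E (fun x => f x - g x) = 'E f - 'E g.
Proof. by move=> bf bg; rewrite RintegralB//; exact: bmeas_integrable. Qed.

Lemma ExZ c f : bmeas f -> 'E (fun x => c * f x) = c * 'E f.
Proof. by move=> bf; rewrite RintegralZl//; exact: bmeas_integrable. Qed.

Lemma Ex_cst c : 'E (fun=> c) = c.
Proof. by rewrite Rintegral_cst//= probability_setT mulr1. Qed.

Lemma Ex_le f g : bmeas f -> bmeas g -> (forall x, f x <= g x) -> 'E f <= 'E g.
Proof. by move=> bf bg fg; apply: le_Rintegral => //; exact: bmeas_integrable. Qed.

Lemma Ex_indic A : measurable A -> 'E (\1_A) = fine (P A).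
Proof. by move=> mA; rewrite /Rintegral integral_indic// setIT. Qed.

Lemma Ex_sum (I : Type) (r : seq I) (f : I -> T -> R) :
  (forall i, bmeas (f i)) ->
  'E (fun x => \sum_(i <- r) f i x) = \sum_(i <- r) 'E (f i).
Proof.
move=> bf; elim: r => [|i r IHr].
  by under eq_Rintegral do rewrite big_nil; rewrite Ex_cst big_nil.
under eq_Rintegral do rewrite big_cons; rewrite ExD//; last exact: bmeas_sum.
by rewrite big_cons IHr.
Qed.

Lemma Ex_norm_le f c : bmeas f -> (forall x, `|f x| <= c) -> `|'E f| <= c.
Proof.
move=> bf fc; rewrite ler_norml -[X in _ <= _ <= X](Ex_cst c) -[X in X <= _](Ex_cst (- c)).
apply/andP; split; apply: Ex_le => //; try exact: bmeas_cst;
  by move=> x; have := fc x; rewrite ler_norml => /andP[].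
Qed.

Lemma Ex_le_on (G : set T) f g : measurable G -> P G = 1%E ->
  bmeas f -> bmeas g -> (forall x, G x -> f x <= g x) -> 'E f <= 'E g.
Proof.
move=> mG PG bf bg fg.
have [[_ [M hM]] [_ [N hN]]] := (bf, bg).
have mGc : measurable (~` G) by exact: measurableC.
(* Outside [G], a null set, the two bounds give [f <= g + (M + N)]. *)
have : 'E f <= 'E (fun x => g x + (M + N) * \1_(~` G) x).
  apply: Ex_le => //; first by apply: bmeasD => //; exact/bmeasZ/bmeas_indic.
  move=> x; rewrite indicE; have [xG|nxG] := pselect (G x).
    by rewrite memNset ?mulr0 ?addr0; [exact: fg|move=> /(_ xG)].
  rewrite mem_set// mulr1; have := hM x; have := hN x; rewrite !ler_norml.
  by move=> /andP[? ?] /andP[? ?]; lra.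
rewrite ExD//; last exact/bmeasZ/bmeas_indic.
rewrite ExZ; last exact: bmeas_indic.
by rewrite Ex_indic// probability_setC// PG subee//= mulr0 addr0.
Qed.

Lemma markov_bounded f (a : R) : bmeas f -> (forall x, 0 <= f x) -> 0 < a ->
  (P [set x | a <= f x]%R <= ('E f / a)%:E)%E.
Proof.
move=> bf f0 a0; have [mf _] := bf.
have mA : measurable [set x | a <= f x].
  rewrite (_ : mkset _ = setT `&` f @^-1` `[a, +oo[%classic); first exact: mf.
  by rewrite setTI; apply/seteqP; split=> x /=; rewrite in_itv/= andbT.
rewrite -[leLHS]fineK ?fin_num_measure// lee_fin -Ex_indic// ler_pdivlMr// mulrC -ExZ; last exact: bmeas_indic.
apply: Ex_le => //; first exact/bmeasZ/bmeas_indic.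
move=> x; rewrite indicE; have [ax|nax] := pselect (a <= f x).
  by rewrite mem_set// mulr1.
by rewrite memNset// mulr0.
Qed.

End expectation.
End bounded_measurable.

Section fubini_bounded.
Context {d1 d2 : measure_display} {T1 : measurableType d1} {T2 : measurableType d2}.
Context {R : realType}.
Variables (P : probability T1 R) (Q : probability T2 R).
Implicit Types f : T1 * T2 -> R.

Lemma bmeas_pair1 f y : bmeas f -> bmeas (fun x => f (x, y)).
Proof.
by move=> [mf [M hM]]; split; [exact: measurable_fun_pair1|exists M].
Qed.

Lemma bmeas_pair2 f x : bmeas f -> bmeas (fun y => f (x, y)).
Proof.
by move=> [mf [M hM]]; split; [exact: measurable_fun_pair2|exists M].
Qed.

Lemma Ex_pair f : bmeas f ->
  \int[P]_x \int[Q]_y f (x, y) = \int[(P \x Q)%E]_z f z.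
Proof.
move=> bf; rewrite /Rintegral -(integral12_prod_meas1 (bmeas_integrable _ bf)).
congr fine; apply: eq_integral => x _; rewrite fineK//.
exact/integrable_fin_num/bmeas_integrable/bmeas_pair2.
Qed.

Lemma Ex_pair_swap f : bmeas f ->
  \int[Q]_y \int[P]_x f (x, y) = \int[(P \x Q)%E]_z f z.
Proof.
move=> bf; rewrite /Rintegral -(integral21_prod_meas1 (bmeas_integrable _ bf)).
congr fine; apply: eq_integral => x _; rewrite fineK//.
exact/integrable_fin_num/bmeas_integrable/bmeas_pair1.
Qed.

Lemma bmeas_Ex f : bmeas f -> bmeas (fun x => \int[Q]_y f (x, y)).
Proof.
move=> bf; have [mf [M hM]] := bf; split.
  apply: (measurableT_comp (fine_measurable measurableT)) => //.
  exact: (measurable_fubini_F (bmeas_integrable (P \x Q)%E bf)).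
by exists M => x; apply: Ex_norm_le => //; exact: bmeas_pair2.
Qed.

End fubini_bounded.

Section samples.
Context {dT : measure_display} {T : measurableType dT} {R : realType}.
Variable P : probability T R.

Lemma Ex_distribution d' (T' : measurableType d') (X : {mfun T >-> T'}) (f : T' -> R) :
  bmeas f -> \int[distribution P X]_y f y = \int[P]_x f (X x).
Proof.
move=> bf; rewrite /Rintegral integral_distribution//.
  by apply/measurable_EFinP; case: bf.
by apply: (bmeas_integrable _ (f := f \o X)); exact: bmeas_comp.
Qed.

Lemma tnth_tcons0 m (p : T * m.-tuple T) : tnth (tcons p) ord0 = p.1.
Proof. by []. Qed.

Lemma tnth_tconsS m (p : T * m.-tuple T) i :
  tnth (tcons p) (lift ord0 i) = tnth p.2 i.
Proof. by rewrite /tcons tnthS. Qed.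

Lemma bmeas_sum_sample m (f : T -> R) : bmeas f ->
  bmeas (fun S : m.-tuple T => \sum_i f (tnth S i)).
Proof.
move=> bf; apply: bmeas_sum => i.
exact: (bmeas_comp (measurable_tnth i) bf).
Qed.

End samples.

(** * First and second moments of i.i.d. sums *)

Section iid_moments.
Context {dT : measure_display} {T : measurableType dT} {R : realType}.
Variable P : probability T R.

Lemma Ex_iidS m (f : m.+1.-tuple T -> R) : bmeas f ->
  \int[iid P m.+1]_S f S = \int[P]_x \int[iid P m]_S f (tcons (x, S)).
Proof.
move=> bf; rewrite [LHS](@Ex_distribution _ _ _ (P \x iid P m)%E)//.
rewrite -(@Ex_pair _ _ _ _ _ P (iid P m) (f \o @tcons _ _ m))//.
exact: bmeas_comp (@measurable_tcons _ _ _) bf.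
Qed.

Lemma Ex_iid_sum m (f : T -> R) : bmeas f ->
  \int[iid P m]_S (\sum_i f (tnth S i)) = m%:R * \int[P]_x f x.
Proof.
move=> bf; elim: m => [|m IHm].
  under eq_Rintegral do rewrite big_ord0.
  by rewrite (Ex_cst (iid P 0)) mul0r.
rewrite Ex_iidS; last exact: bmeas_sum_sample.
under eq_Rintegral => x _.
  under eq_Rintegral => S _.
    rewrite big_ord_recl tnth_tcons0 /=.
    under eq_bigr do rewrite tnth_tconsS /=.
    over.
  rewrite (@ExD _ _ _ (iid P m) (fun=> f x))/=; [|exact: bmeas_cst|exact: bmeas_sum_sample].
  rewrite Ex_cst IHm.
  over.
rewrite /= ExD//; last exact: bmeas_cst.
by rewrite Ex_cst -natr1 mulrDl mul1r addrC.
Qed.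

(** Variances of independent centred terms add: once the first point is split off, the cross term
    vanishes because the remaining sum has mean 0. *)
Lemma Ex_iid_sum_sqr m (f : T -> R) : bmeas f -> \int[P]_x f x = 0 ->
  \int[iid P m]_S (\sum_i f (tnth S i)) ^+ 2 = m%:R * \int[P]_x f x ^+ 2.
Proof.
move=> bf f0; elim: m => [|m IHm].
  under eq_Rintegral do rewrite big_ord0 expr0n.
  by rewrite (Ex_cst (iid P 0)) mul0r.
rewrite Ex_iidS; last exact/bmeasX/bmeas_sum_sample.
have bs := @bmeas_sum_sample _ _ _ m f bf.
under eq_Rintegral => x _.
  under eq_Rintegral => S _.
    rewrite big_ord_recl tnth_tcons0 /=.
    under eq_bigr do rewrite tnth_tconsS /=.
    rewrite sqrrD -mulr_natl mulrA.
    over.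
  rewrite /= (@ExD _ _ _ (iid P m) (fun S => f x ^+ 2 + 2%:R * f x * \sum_i f (tnth S i))).
  - rewrite (@ExD _ _ _ (iid P m) (fun=> f x ^+ 2)).
    + rewrite Ex_cst ExZ// Ex_iid_sum// f0 !mulr0 addr0 IHm.
      over.
    + exact: bmeas_cst.
    + exact: bmeasZ.
  - by apply: bmeasD; [exact: bmeas_cst|exact: bmeasZ].
  - exact: bmeasX.
rewrite /= ExD//; [|exact: bmeasX|exact: bmeas_cst].
by rewrite Ex_cst -natr1 mulrDl mul1r addrC.
Qed.

End iid_moments.

(** * A uniform law of large numbers *)

Section cell_lln.
Context {dT : measure_display} {T : measurableType dT} {R : realType}.
Variables (P : probability T R) (I : finType) (c : T -> I) (G : set T).
Hypothesis mc : forall i, measurable (c @^-1` [set i]).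
Hypothesis mG : measurable G.
Hypothesis PG : P G = 1%E.

Let dev i x : R := \1_(c @^-1` [set i]) x - fine (P (c @^-1` [set i])).

Let bmeas_dev i : bmeas (dev i).
Proof. by apply: bmeasB; [exact: bmeas_indic|exact: bmeas_cst]. Qed.

Let p01 i : 0 <= fine (P (c @^-1` [set i])) <= 1.
Proof.
by rewrite fine_ge0//= -lee_fin fineK ?fin_num_measure//; exact: probability_le1.
Qed.

Let Ex_dev i : \int[P]_x dev i x = 0.
Proof.
rewrite ExB; [|exact: bmeas_indic|exact: bmeas_cst].
by rewrite Ex_cst Ex_indic// subrr.
Qed.

Let Ex_dev_sqr i : \int[P]_x dev i x ^+ 2 <= 1.
Proof.
rewrite -[leRHS](Ex_cst P); apply: Ex_le; [exact: bmeasX|exact: bmeas_cst|].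
move=> x; rewrite /dev indicE; have := p01 i.
by case: (_ \in _) => /= /andP[? ?]; nra.
Qed.

(* A function nearly constant on each cell is, up to the oscillation, a
   combination of indicators of cells. *)
Lemma uniform_lln m (eps : R) : (0 < m)%N -> 0 < eps <= 1 ->
  exists Bad : set (m.-tuple T), [/\ measurable Bad,
    (iid P m Bad <= (#|I|%:R / (m%:R * eps ^+ 2))%:E)%E &
    forall S, ~ Bad S -> (forall i, G (tnth S i)) /\
      forall (phi : T -> R) (om : R), bmeas phi -> (forall x, `|phi x| <= 1) -> 0 <= om ->
        (forall x x', G x -> G x' -> c x = c x' -> `|phi x - phi x'| <= om) ->
        `|mean (fun i => phi (tnth S i)) - \int[P]_x phi x| <= 2 * om + #|I|%:R * eps].
Proof.
move=> m0 /andP[e0 e1].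
have mR : 0 < m%:R :> R by rewrite ltr0n.
have mGc : measurable (~` G) by exact: measurableC.
(* One statistic, hence one Markov bound, for both requirements: squared deviations of all cell
   frequencies plus the number of points outside [G]. A value below [eps ^+ 2 <= 1] excludes a stray
   point as well as a deviation above [eps]. *)
pose g (S : m.-tuple T) : R := \sum_i (m%:R^-1 * \sum_j dev i (tnth S j)) ^+ 2 +
  \sum_j \1_(~` G) (tnth S j).
have b1 i : bmeas (fun S : m.-tuple T => (m%:R^-1 * \sum_j dev i (tnth S j)) ^+ 2).
  exact/bmeasX/bmeasZ/bmeas_sum_sample.
have b2 : bmeas (fun S : m.-tuple T => \sum_j (\1_(~` G) (tnth S j) : R)).
  exact/bmeas_sum_sample/bmeas_indic.
have bg : bmeas g by apply: bmeasD => //; exact: bmeas_sum.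
have ind0 x : 0 <= \1_(~` G) x :> R by rewrite indicE.
have g0 S : 0 <= g S.
  by rewrite addr_ge0// sumr_ge0// => i _; exact: sqr_ge0.
have Eg : \int[iid P m]_S g S <= #|I|%:R / m%:R.
  rewrite /g ExD//; last exact: bmeas_sum.
  rewrite Ex_iid_sum; last exact: bmeas_indic.
  rewrite Ex_indic// probability_setC// PG subee//= mulr0 addr0.
  rewrite Ex_sum//; apply: le_trans (_ : \sum_(i : I) m%:R^-1 <= _); last first.
    by rewrite sumr_const mulr_natl.
  apply: ler_sum => i _.
  under eq_Rintegral do rewrite exprMn.
  rewrite ExZ; last exact/bmeasX/bmeas_sum_sample.
  rewrite Ex_iid_sum_sqr// mulrA expr2 mulfVK ?gt_eqF//.
  by apply: ler_piMr; [rewrite invr_ge0|exact: Ex_dev_sqr].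
exists [set S | eps ^+ 2 <= g S]; split.
- rewrite (_ : mkset _ = setT `&` g @^-1` `[eps ^+ 2, +oo[%classic); first by apply: bg.1.
  by rewrite setTI; apply/seteqP; split=> x /=; rewrite in_itv/= andbT.
- apply: le_trans (markov_bounded _ bg g0 (exprn_gt0 2 e0)) _.
  rewrite lee_fin ler_pdivrMr ?exprn_gt0//; apply: le_trans Eg _.
  by rewrite invfM -!mulrA mulVf ?mulr1// expf_neq0 ?gt_eqF.
- move=> S /= /negP; rewrite -ltNge => gS.
  have s1 : 0 <= \sum_j \1_(~` G) (tnth S j) :> R by exact: sumr_ge0.
  have s2 : 0 <= \sum_i (m%:R^-1 * \sum_j dev i (tnth S j)) ^+ 2 :> R.
    by apply: sumr_ge0 => i _; exact: sqr_ge0.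
  have SG j : G (tnth S j).
    apply: contrapT => nG; move: gS; apply/negP; rewrite -leNgt /g.
    apply: ler_wpDl => //; rewrite (bigD1 j)//= indicE mem_set//.
    rewrite ler_wpDr//; first exact: sumr_ge0.
    by rewrite exprn_ile1// ltW.
  split=> // phi om bphi phi1 om0 hosc.
  have hdev i : `|mean (fun j => dev i (tnth S j))| <= eps.
    rewrite -(@ler_pXn2r _ 2) ?nnegrE ?(ltW e0)// real_normK ?num_real//.
    apply: le_trans (ltW gS); rewrite /g (bigD1 i)//= -addrA lerDl addr_ge0//.
    by apply: sumr_ge0 => k _; exact: sqr_ge0.
  (* [a i] is a value of [phi] on the part of the cell in [G], or 0 if there is none. Replacing
     [phi] by it costs [om] in the sample mean and [om] in the expectation. *)
  have [a aP] : exists a : I -> R, forall i, `|a i| <= 1 /\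
      forall x, G x -> c x = i -> `|phi x - a i| <= om.
    suff /choice[a aP] : forall i : I, exists b : R, `|b| <= 1 /\
        forall x, G x -> c x = i -> `|phi x - b| <= om by exists a.
    move=> i.
    have [[x [Gx cx]]|nx] := pselect (exists x, G x /\ c x = i).
      by exists (phi x); split=> // y Gy cy; apply: hosc => //; rewrite cy.
    exists 0; split; first by rewrite normr0.
    by move=> x Gx cx; exfalso; apply: nx; exists x.
  have aE x : a (c x) = \sum_i a i * \1_(c @^-1` [set i]) x.
    rewrite (bigD1 (c x))//= indicE mem_set// mulr1 big1 ?addr0// => i ic.
    by rewrite indicE memNset ?mulr0// => /= cx; rewrite cx eqxx in ic.
  have ba : bmeas (fun x => a (c x)).
    under eq_fun do rewrite aE.
    by apply: bmeas_sum => i; exact/bmeasZ/bmeas_indic.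
  have h1 : `|mean (fun j => phi (tnth S j)) - mean (fun j => a (c (tnth S j)))| <= om.
    rewrite -meanB; apply: le_trans (ler_norm_mean _) _; rewrite -[leRHS](mean_cst om m0).
    by apply: le_mean => j; apply: (aP _).2.
  have h2 : `|\int[P]_x phi x - \int[P]_x a (c x)| <= om.
    have d1 x : G x -> - om <= phi x - a (c x) <= om.
      by move=> Gx; have := (aP (c x)).2 x Gx erefl; rewrite ler_norml.
    rewrite -ExB// ler_norml -[X in _ <= _ <= X](Ex_cst P om) -[X in X <= _](Ex_cst P (- om)).
    by apply/andP; split; apply: (Ex_le_on mG PG); do ?[exact: bmeas_cst|exact: bmeasB] => x /d1 /andP[].
  have h3 : `|mean (fun j => a (c (tnth S j))) - \int[P]_x a (c x)| <= #|I|%:R * eps.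
    have -> : mean (fun j => a (c (tnth S j))) - \int[P]_x a (c x) =
        \sum_i a i * mean (fun j => dev i (tnth S j)).
      under [in X in _ - X]eq_Rintegral do rewrite aE.
      rewrite Ex_sum; last by move=> i; exact/bmeasZ/bmeas_indic.
      rewrite (eq_mean (fun j => aE (tnth S j))) /mean exchange_big mulr_sumr -sumrB/=.
      apply: eq_bigr => i _; rewrite ExZ; last exact: bmeas_indic.
      rewrite Ex_indic// -mulr_sumr mulrCA -mulrBr; congr (_ * _).
      by rewrite sumrB sumr_const card_ord mulrBr -[fine _ *+ m]mulr_natl mulKf// gt_eqF.
    apply: le_trans (ler_norm_sum _ _ _) _.
    apply: le_trans (_ : \sum_(i : I) eps <= _); last by rewrite sumr_const mulr_natl.
    apply: ler_sum => i _; rewrite normrM -[leRHS]mul1r; apply: ler_pM => //.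
    exact: (aP i).1.
  rewrite -[_ - _](subrKA (mean (fun j => a (c (tnth S j))))).
  move: h1 h2 h3; rewrite !ler_norml => /andP[? ?] /andP[? ?] /andP[? ?].
  by apply/andP; split; lra.
Qed.

End cell_lln.

(** * Grid cells of the ball *)

Section grid.
Context {R : realType} {d : nat}.
Implicit Types x : vec R d.

(** The label belongs to the cell because test functions contain residuals. On the ball the floor
    lies between [-(n+1)] and [n+1], which leaves [2 (n+1) + 1] values after the shift; elsewhere
    [absz] and [inord] merely keep the map total. *)
Definition grid_cell (n : nat) (z : labeled R d) : {ffun 'I_d -> 'I_(2 * n.+1).+1} * bool :=
  ([ffun k => inord (absz (Num.floor (n.+1%:R * tnth z.1 k) + n.+1%:Z)%R)], z.2).

Lemma measurable_grid_cell n i : measurable (grid_cell n @^-1` [set i]).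
Proof.
have mk k a : measurable [set z : labeled R d |
    inord (absz (Num.floor (n.+1%:R * tnth z.1 k) + n.+1%:Z)%R) = a :> 'I_(2 * n.+1).+1].
  have mcoord : measurable_fun setT (fun z : labeled R d => n.+1%:R * tnth z.1 k).
    apply: measurable_funM => //.
    exact: (measurableT_comp (measurable_tnth k) measurable_fst).
  rewrite (_ : mkset _ = \bigcup_(q : int) [set z | (inord (absz (q + n.+1%:Z)%R) = a :> 'I_(2 * n.+1).+1) /\
      Num.floor (n.+1%:R * tnth z.1 k) = q]); last first.
    apply/seteqP; split=> [z /= h|z [q _ /= [h fq]]]; last by rewrite fq.
    by exists (Num.floor (n.+1%:R * tnth z.1 k)).
  apply: countable_bigcupT_measurable; first exact: countableP.
  move=> q; have [h|nh] := pselect (inord (absz (q + n.+1%:Z)%R) = a :> 'I_(2 * n.+1).+1); last first.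
    by rewrite (_ : mkset _ = set0)//; apply/seteqP; split=> // z [].
  rewrite (_ : mkset _ = setT `&` (fun z : labeled R d => n.+1%:R * tnth z.1 k) @^-1` `[q%:~R, (q + 1)%:~R[%classic).
    exact: mcoord.
  rewrite setTI; apply/seteqP; split=> z /=; rewrite in_itv/=.
    by move=> [_ <-]; exact: floor_itv.
  by move=> hz; split=> //; exact: floor_def.
rewrite (_ : _ @^-1` _ = (\bigcap_(k in [set: 'I_d]) [set z : labeled R d |
    inord (absz (Num.floor (n.+1%:R * tnth z.1 k) + n.+1%:Z)%R) = i.1 k]) `&` has_label i.2).
  apply: measurableI; last exact: measurable_has_label.
  by apply: fin_bigcap_measurable.
apply/seteqP; split=> [z /= <-|z [/= h1 h2]].
  by split=> // k _ /=; rewrite ffunE.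
rewrite /grid_cell [RHS]surjective_pairing h2; congr pair.
by apply/ffunP => k; rewrite ffunE h1.
Qed.

Lemma grid_cell_label n z z' : grid_cell n z = grid_cell n z' -> z.2 = z'.2.
Proof. by case. Qed.

Lemma grid_cell_dist n z z' : eball z.1 -> eball z'.1 ->
  grid_cell n z = grid_cell n z' -> forall k, `|tnth z.1 k - tnth z'.1 k| <= n.+1%:R^-1.
Proof.
move=> bz bz' [/ffunP h _] k; have := h k; rewrite !ffunE => {}h.
have n0 : 0 < n.+1%:R :> R by rewrite ltr0n.
have range x : eball x -> 0 <= Num.floor (n.+1%:R * tnth x k) + n.+1%:Z <= (2 * n.+1)%:Z.
  move=> /(@eball_coord _ _ _ k); rewrite ler_norml => /andP[l u].
  have /andP[f1 f2] := floor_itv (n.+1%:R * tnth x k).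
  apply/andP; split.
    rewrite -lerBlDr sub0r floor_ge_int mulrNz -[n.+1%:~R]/(n.+1%:R).
    by rewrite -[leLHS]mulrN1 ler_wpM2l// ltW.
  rewrite -lerBrDr mulSn mul1n PoszD addrK -(@ler_int R); apply: le_trans f1 _.
  by rewrite -[leRHS]mulr1 ler_wpM2l// ltW.
have /andP[r1 r2] := range _ bz; have /andP[r1' r2'] := range _ bz'.
have : Num.floor (n.+1%:R * tnth z.1 k) = Num.floor (n.+1%:R * tnth z'.1 k).
  apply: (addIr n.+1%:Z); rewrite -(gez0_abs r1) -(gez0_abs r1'); congr Posz.
  have := congr1 val h; rewrite /= !inordK//.
    by rewrite ltnS -lez_nat gez0_abs.
  by rewrite ltnS -lez_nat gez0_abs.
move=> ef.
have /andP[f1 f2] := floor_itv (n.+1%:R * tnth z.1 k).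
have /andP[f1' f2'] := floor_itv (n.+1%:R * tnth z'.1 k).
rewrite -ef in f1' f2'.
rewrite -(@ler_pM2l _ n.+1%:R)// mulfV ?gt_eqF// -[X in X * _](gtr0_norm n0) -normrM mulrBr.
by rewrite ler_norml; move: f2 f2'; rewrite intrD; lra.
Qed.

End grid.

(** * Class-probability functions and label noise *)

Section measurability_on_vec.
Context {R : realType} {d : nat}.

Lemma measurable_inner_l (w : vec R d) : measurable_fun setT (inner w).
Proof.
apply: measurable_inner => k; first exact: measurable_cst.
exact: measurable_tnth.
Qed.

Lemma measurable_eball : measurable (@eball R d).
Proof.
have mi : measurable_fun setT (fun x : vec R d => inner x x).
  by apply: measurable_inner => k; exact: measurable_tnth.
rewrite (_ : eball = setT `&` (fun x : vec R d => inner x x) @^-1` `]-oo, 1]%classic).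
  exact: mi.
rewrite setTI; apply/seteqP; split=> x /=; rewrite in_itv/=; first exact: eball_inner.
exact: inner_eball.
Qed.

Definition in_ball : set (labeled R d) := eball `*` setT.

Lemma measurable_in_ball : measurable in_ball.
Proof. by apply: measurableX => //; exact: measurable_eball. Qed.

Lemma bmeas_fst (f : vec R d -> R) : bmeas f -> bmeas (fun z : labeled R d => f z.1).
Proof. exact: bmeas_comp measurable_fst. Qed.

Lemma bmeas_label : bmeas (fun z : labeled R d => z.2%:R : R).
Proof.
split; last by exists 1 => z; case: z.2; rewrite ?normr1 ?normr0.
exact: (measurableT_comp (f := fun b : bool => b%:R : R) _ measurable_snd).
Qed.

End measurability_on_vec.

Lemma Ex_eq_on {dT} {T : measurableType dT} {R : realType} (P : probability T R)
  (G : set T) (f g : T -> R) : measurable G -> P G = 1%E ->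
  bmeas f -> bmeas g -> (forall x, G x -> f x = g x) ->
  \int[P]_x f x = \int[P]_x g x.
Proof.
move=> mG PG bf bg fg; apply/eqP; rewrite eq_le.
by rewrite !(Ex_le_on mG PG)// => x /fg ->.
Qed.

Lemma bmeas01 {dT} {T : measurableType dT} {R : realType} (f : T -> R) :
  measurable_fun setT f -> (forall x, 0 <= f x <= 1) -> bmeas f.
Proof.
move=> mf f01; split=> //; exists 1 => x; have /andP[f0 f1] := f01 x.
by rewrite ger0_norm.
Qed.

(* Bounded functions are uniform limits of finite combinations of indicators
   of the level sets [j <= n f < j + 1]. *)
Lemma bmeas_functional0 {dT} {T : measurableType dT} {R : realType}
    (L : (T -> R) -> R) (C : R) :
  (forall f g, bmeas f -> bmeas g -> L (fun x => f x + g x) = L f + L g) ->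
  (forall c f, bmeas f -> L (fun x => c * f x) = c * L f) ->
  (forall f e, bmeas f -> (forall x, `|f x| <= e) -> `|L f| <= C * e) ->
  (forall A, measurable A -> L \1_A = 0) ->
  forall f, bmeas f -> L f = 0.
Proof.
move=> LD LZ Lb L1 f bf; have [mf [M hM]] := bf.
have Lsum (I : Type) (r : seq I) (F : I -> T -> R) : (forall i, bmeas (F i)) ->
    L (fun x => \sum_(i <- r) F i x) = \sum_(i <- r) L (F i).
  move=> bF; elim: r => [|i r IHr].
    have -> : (fun x => \sum_(i <- [::]) F i x) = (fun x => 0 * (fun=> 0) x).
      by apply/funext => x; rewrite big_nil mul0r.
    by rewrite big_nil (LZ 0 (fun=> 0)) ?mul0r//; exact: bmeas_cst.
  rewrite big_cons -IHr -LD//; last exact: bmeas_sum.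
  by congr L; apply/funext => x; rewrite big_cons.
have C0 : 0 <= C.
  rewrite -[C]mulr1; apply: le_trans (normr_ge0 _) (Lb (fun=> 0) 1 _ _).
    exact: bmeas_cst.
  by move=> x; rewrite normr0.
have key n : `|L f| <= C / n.+1%:R.
  have n0 : 0 < n.+1%:R :> R by rewrite ltr0n.
  (* Large enough that [n.+1%:R * f x + K%:R] lies strictly between 0 and 2 K, so that its integer
     part names the level set containing [x]. *)
  pose K := (Num.truncn (n.+1%:R * `|M|)).+2.
  have KM x : `|n.+1%:R * f x| + 1 < K%:R.
    rewrite normrM (gtr0_norm n0).
    have : n.+1%:R * `|f x| <= n.+1%:R * `|M|.
      by rewrite ler_wpM2l ?(ltW n0)//; apply: le_trans (hM x) (ler_norm _).
    have /andP[_] := truncn_itv (mulr_ge0 (ltW n0) (normr_ge0 M)).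
    by rewrite -[K%:R]natr1; lra.
  pose A (j : 'I_(K + K)) := [set x | j%:R - K%:R <= n.+1%:R * f x < j%:R - K%:R + 1].
  have mA j : measurable (A j).
    have mg : measurable_fun setT (fun x => n.+1%:R * f x) by exact: measurable_funM.
    rewrite (_ : A j = setT `&` (fun x => n.+1%:R * f x) @^-1` `[j%:R - K%:R, j%:R - K%:R + 1[%classic).
      exact: mg.
    by rewrite setTI; apply/seteqP; split=> x /=; rewrite in_itv.
  pose h x : R := \sum_(j < K + K) ((j%:R - K%:R) / n.+1%:R) * \1_(A j) x.
  have bh : bmeas h by apply: bmeas_sum => j; exact/bmeasZ/bmeas_indic.
  have Lh : L h = 0.
    rewrite Lsum => [|j]; last exact/bmeasZ/bmeas_indic.
    by rewrite big1// => j _; rewrite LZ ?L1 ?mulr0//; exact: bmeas_indic.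
  have fh x : `|f x - h x| <= n.+1%:R^-1.
    have := KM x; rewrite -ltrBrDr ltr_norml => /andP[k1 k2].
    have f0 : 0 <= n.+1%:R * f x + K%:R by lra.
    have /andP[t1 t2] := truncn_itv f0; set t := Num.truncn _ in t1 t2.
    have tn : (t < K + K)%N by rewrite -(ltr_nat R) natrD; lra.
    have -> : h x = (t%:R - K%:R) / n.+1%:R.
      rewrite /h (bigD1 (Ordinal tn))//= indicE mem_set ?mulr1; last first.
        by rewrite /A /=; rewrite -natr1 in t2; apply/andP; split; lra.
      rewrite big1 ?addr0// => j jt; rewrite indicE memNset ?mulr0// => /andP[j1 j2].
      move/negP: jt; apply; apply/eqP/val_inj => /=; apply/eqP.
      rewrite eqn_leq -[(j <= t)%N]ltnS -[(t <= j)%N]ltnS -!(ltr_nat R) -!natr1; rewrite -natr1 in t2.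
      by apply/andP; split; lra.
    rewrite -natr1 in t2.
    have -> : f x - (t%:R - K%:R) / n.+1%:R = (n.+1%:R * f x - (t%:R - K%:R)) / n.+1%:R.
      by rewrite [RHS]mulrBl [n.+1%:R * _]mulrC mulfK ?gt_eqF.
    rewrite normrM (gtr0_norm (x := n.+1%:R^-1)) ?invr_gt0//.
    rewrite ler_pdivrMr// mulVf ?gt_eqF// ler_norml; apply/andP; split; lra.
  have -> : L f = L (fun x => f x - h x).
    rewrite -[LHS]addr0 -(mulr0 (-1)) -Lh -LZ// -LD//; last exact: bmeasZ.
    by congr L; apply/funext => x; rewrite mulN1r.
  by apply: Lb => //; exact: bmeasB.
apply/eqP; rewrite -normr_le0; apply/ler_addgt0Pr => e e0; rewrite add0r.
have [N _ hN] := @near_infty_natSinv_lt R (PosNum (divr_gt0 e0 (ltr_pwDr ltr01 C0))).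
apply: le_trans (key N) _; have /= := hN N (leqnn N).
rewrite ltr_pdivlMr ?ltr_wpDl// => /ltW; apply: le_trans.
by rewrite mulrC ler_wpM2l ?invr_ge0// lerDl.
Qed.

Section class_probability.
Context {R : realType} {d : nat}.
Implicit Types (D : probability (labeled R d) R) (eta f : vec R d -> R).

(** The conditional expectation property in residual form. Here [eta] is within [0, 1] on the whole
    space, which makes it a bounded measurable function. *)
Definition class_prob D eta := [/\ measurable_fun setT eta,
  forall x, 0 <= eta x <= 1 &
  forall A, measurable A ->
    \int[D]_z ((z.2%:R - eta z.1) * \1_A z.1) = 0].

Lemma bmeas_residual D eta : class_prob D eta ->
  bmeas (fun z : labeled R d => z.2%:R - eta z.1).
Proof.
by move=> [me e01 _]; apply: bmeasB; [exact: bmeas_label|exact/bmeas_fst/bmeas01].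
Qed.

(** Orthogonality of the residual to functions of x: it kills the expected noise terms of the
    descent and the cross term of the bias-variance decomposition. *)
Lemma class_prob_int D eta f : class_prob D eta -> bmeas f ->
  \int[D]_z ((z.2%:R - eta z.1) * f z.1) = 0.
Proof.
move=> hD; have br := bmeas_residual hD; have [me e01 h0] := hD.
have brM g : bmeas g -> bmeas (fun z : labeled R d => (z.2%:R - eta z.1) * g z.1).
  by move=> bg; apply: bmeasM => //; exact: bmeas_fst.
apply: (@bmeas_functional0 _ _ _ (fun f => \int[D]_z ((z.2%:R - eta z.1) * f z.1)) 1) => //.
- move=> g h bg bh; rewrite -ExD; [|exact: brM|exact: brM].
  by apply: eq_Rintegral => z _; rewrite mulrDr.
- move=> c g bg; rewrite -ExZ; last exact: brM.
  by apply: eq_Rintegral => z _; rewrite mulrCA.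
- move=> g e bg ge; apply: Ex_norm_le; first exact: brM.
  move=> z; rewrite normrM; apply: ler_pM => //.
  by have /andP[? ?] := e01 z.1; case: z.2 => /=; rewrite ler_norml; lra.
Qed.

Lemma class_prob_label D eta f : class_prob D eta -> bmeas f ->
  \int[D]_z (z.2%:R * f z.1) = \int[D]_z (eta z.1 * f z.1).
Proof.
move=> hD bf; have [me e01 _] := hD.
have := class_prob_int hD bf; under eq_Rintegral do rewrite mulrBl.
rewrite ExB; first by move/eqP; rewrite subr_eq0 => /eqP.
  by apply: bmeasM; [exact: bmeas_label|exact: bmeas_fst].
by apply: bmeasM; apply: bmeas_fst => //; exact: bmeas01.
Qed.

Lemma Ex_label_indic D (A : set (vec R d)) : measurable A ->
  \int[D]_z (z.2%:R * \1_A z.1) = fine (D (A `*` [set true])).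
Proof.
move=> mA; rewrite -Ex_indic; last exact: measurableX.
apply: eq_Rintegral => -[x b] _ /=; rewrite !indicE.
case: b => /=; last by rewrite mul0r memNset// => -[].
by rewrite mul1r; congr (nat_of_bool _)%:R; apply/idP/idP => [/set_mem ?|/set_mem[? _]]; exact: mem_set.
Qed.

Lemma Ex_marginal D f : bmeas f -> \int[marginal D]_x f x = \int[D]_z f z.1.
Proof. by move=> bf; rewrite Ex_distribution. Qed.

Lemma is_class_probability_class_prob D eta eta' :
  D in_ball = 1%E -> is_class_probability D eta ->
  measurable_fun setT eta' -> (forall x, 0 <= eta' x <= 1) ->
  (forall x, eball x -> eta x = eta' x) -> class_prob D eta'.
Proof.
move=> DG [me e01 hA] me' e01' ee'; split=> // A mA.
have mB : measurable (A `&` eball) by apply: measurableI => //; exact: measurable_eball.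
have be : bmeas eta' by exact: bmeas01.
transitivity (\int[D]_z ((z.2%:R - eta' z.1) * \1_(A `&` eball) z.1)).
  apply: (Ex_eq_on measurable_in_ball DG).
  - apply: bmeasM; last exact/bmeas_fst/bmeas_indic.
    by apply: bmeasB; [exact: bmeas_label|exact: bmeas_fst].
  - apply: bmeasM; last exact/bmeas_fst/bmeas_indic.
    by apply: bmeasB; [exact: bmeas_label|exact: bmeas_fst].
  - move=> z [bz _]; congr (_ * _); rewrite !indicE; congr (nat_of_bool _)%:R.
    by apply/idP/idP => [/set_mem ?|/set_mem[? _]]; exact: mem_set.
under eq_Rintegral do rewrite mulrBl.
rewrite ExB; first last.
- by apply: bmeasM; apply: bmeas_fst => //; exact: bmeas_indic.
- by apply: bmeasM; [exact: bmeas_label|exact/bmeas_fst/bmeas_indic].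
rewrite Ex_label_indic// hA//; apply/eqP; rewrite subr_eq0; apply/eqP.
rewrite -(Ex_marginal D (f := fun x => eta' x * \1_(A `&` eball) x)); last first.
  by apply: bmeasM => //; exact: bmeas_indic.
transitivity (\int[marginal D]_(x in A `&` eball) eta' x).
  apply: eq_Rintegral => x /set_mem[_ bx]; exact: ee'.
rewrite Rintegral_mkcond; apply: eq_Rintegral => x _; rewrite patchE indicE.
by case: ifP; rewrite ?mulr1 ?mulr0.
Qed.

(** Both sides are bounded linear functionals of [f], so agreement on indicators suffices; there it
    is the definition of the normalised restriction. *)
Lemma Ex_class_conditional D y f : D (has_label y) != 0%E -> bmeas f ->
  \int[class_conditional D y]_x f x =
    (fine (D (has_label y)))^-1 * \int[D]_z ((z.2 == y)%:R * f z.1).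
Proof.
move=> Dy0 bf; have mL := @measurable_has_label R d y.
have fD : D (has_label y) \is a fin_num by exact: fin_num_measure.
have b1 : bmeas (fun z : labeled R d => (z.2 == y)%:R : R).
  split; last by exists 1 => z; case: (_ == _); rewrite ?normr1 ?normr0.
  exact: (measurableT_comp (f := fun b : bool => (b == y)%:R : R) _ measurable_snd).
have bM g : bmeas g -> bmeas (fun z : labeled R d => (z.2 == y)%:R * g z.1 : R).
  by move=> bg; apply: bmeasM => //; exact: bmeas_fst.
apply/eqP; rewrite -subr_eq0; apply/eqP.
set c := (fine (D (has_label y)))^-1.
apply: (@bmeas_functional0 _ _ _ (fun f => \int[class_conditional D y]_x f x -
  c * \int[D]_z ((z.2 == y)%:R * f z.1)) (1 + `|c|)) => //.
- move=> g h bg bh; rewrite ExD//.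
  have -> : \int[D]_z ((z.2 == y)%:R * (g z.1 + h z.1)) =
      \int[D]_z ((z.2 == y)%:R * g z.1 + (z.2 == y)%:R * h z.1).
    by apply: eq_Rintegral => z _; rewrite mulrDr.
  by rewrite ExD; [ring|exact: bM|exact: bM].
- move=> a g bg; rewrite ExZ//.
  have -> : \int[D]_z ((z.2 == y)%:R * (a * g z.1)) =
      \int[D]_z (a * ((z.2 == y)%:R * g z.1)).
    by apply: eq_Rintegral => z _; rewrite mulrCA.
  by rewrite ExZ; [ring|exact: bM].
- move=> g e bg ge; apply: le_trans (ler_normB _ _) _; rewrite mulrDl mul1r lerD//.
    exact: Ex_norm_le.
  rewrite normrM ler_wpM2l//; apply: Ex_norm_le; first exact: bM.
  by move=> z; rewrite normrM -[leRHS]mul1r; apply: ler_pM => //; case: (_ == _); rewrite ?normr1 ?normr0.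
- move=> A mA; rewrite Ex_indic//.
  have -> : \int[D]_z ((z.2 == y)%:R * \1_A z.1) = fine (D (A `*` [set y])).
    rewrite -Ex_indic; last exact: measurableX.
    apply: eq_Rintegral => -[x b] _ /=; rewrite !indicE.
    case: eqP => [->|by0] /=; last by rewrite mul0r memNset// => -[_ /=].
    by rewrite mul1r; congr (nat_of_bool _)%:R; apply/idP/idP => [/set_mem ?|/set_mem[? _]]; exact: mem_set.
  have -> : class_conditional D y A = (D (A `*` [set y]) * c%:E)%E.
    change (mnormalize (mrestr D mL) D (feature @^-1` A) = (D (A `*` [set y]) * c%:E)%E).
    have e : mrestr D mL setT = D (has_label y) by rewrite /mrestr setTI.
    have eoo : (D (has_label y) == +oo%E) = false.
      by apply/negbTE; rewrite lt_eqF// ltey_eq fD.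
    rewrite /mnormalize /= e (negbTE Dy0) eoo /= /mrestr.
    congr (D _ * _)%E; apply/seteqP; split=> -[x b]; exact.
  by rewrite fineM ?fin_num_measure//=; [rewrite mulrC subrr|exact: measurableX].
Qed.

(** * The law of the corrupted pair *)

Section noisy.
Variables (D Dbar : probability (labeled R d) R) (rm rp : vec R d -> R).
Hypothesis iln : is_ILN D rm rp Dbar.
Hypothesis mrm : measurable_fun setT rm.
Hypothesis mrp : measurable_fun setT rp.
Hypothesis rm01 : forall x, 0 <= rm x <= 1.
Hypothesis rp01 : forall x, 0 <= rp x <= 1.

Lemma ILN_marginal (A : set (vec R d)) : measurable A ->
  Dbar (A `*` setT) = D (A `*` setT).
Proof.
move=> mA; have mB : measurable (A `*` [set: bool]) by exact: measurableX.
rewrite iln//; rewrite -(setIT (A `*` setT)) -(integral_indic D measurableT mB).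
apply: eq_integral => -[x b] _ /=; congr EFin; rewrite setIT !indicE.
have -> : ((x, ~~ b) \in A `*` [set: bool]) = ((x, b) \in A `*` setT).
  by apply/idP/idP => /set_mem[/= ? _]; exact: mem_set.
by case: b => /=; rewrite -mulrDl subrK mul1r.
Qed.

(** Flipping labels does not move x, so an estimation error bounded under the corrupted law is
    bounded under the clean one. *)
Lemma Ex_ILN_fst f : bmeas f -> \int[Dbar]_z f z.1 = \int[D]_z f z.1.
Proof.
move=> bf; rewrite -!Ex_marginal// /Rintegral; congr fine.
apply: eq_measure_integral => A mA _.
have e : feature @^-1` A = A `*` [set: bool] by apply/seteqP; split=> z /=; [|case].
change (Dbar (feature @^-1` A) = D (feature @^-1` A)); rewrite e; exact: ILN_marginal.
Qed.

Lemma class_prob_ILN eta : class_prob D eta ->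
  class_prob Dbar (fun x => eta x * (1 - rp x) + (1 - eta x) * rm x).
Proof.
move=> hD; have [me e01 _] := hD.
set etab := fun x => _.
have be : bmeas eta by exact: bmeas01.
have brm : bmeas rm by exact: bmeas01.
have brp : bmeas rp by exact: bmeas01.
have bb : bmeas etab.
  by apply: bmeasD; apply: bmeasM => //; apply: bmeasB => //; exact: bmeas_cst.
split; first by case: bb.
  move=> x; rewrite /etab; have /andP[? ?] := e01 x; have /andP[? ?] := rm01 x.
  by have /andP[? ?] := rp01 x; apply/andP; split; nra.
move=> A mA; have b1 : bmeas (\1_A : vec R d -> R) by exact: bmeas_indic.
under eq_Rintegral do rewrite mulrBl.
rewrite ExB; first last.
- by apply: bmeasM; exact: bmeas_fst.
- by apply: bmeasM; [exact: bmeas_label|exact: bmeas_fst].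
rewrite (Ex_ILN_fst (f := fun x => etab x * \1_A x)); last exact: bmeasM.
rewrite Ex_label_indic// iln; last exact: measurableX.
apply/eqP; rewrite subr_eq0; apply/eqP.
have bf : bmeas (fun x => (1 - rp x - rm x) * \1_A x).
  by apply: bmeasM => //; do 2 (apply: bmeasB => //); exact: bmeas_cst.
have bg : bmeas (fun x => rm x * \1_A x) by exact: bmeasM.
(* The probability that the corrupted label is +1 is affine in the clean label, so conditioning on x
   simply replaces the label by [eta]. *)
transitivity (\int[D]_z (z.2%:R * ((1 - rp z.1 - rm z.1) * \1_A z.1) + rm z.1 * \1_A z.1)).
  apply: eq_Rintegral => -[x b] _ /=; rewrite !indicE.
  have -> : ((x, b) \in A `*` [set true]) = (x \in A) && b.
    apply/idP/idP => [/set_mem[/= ? ->]|/andP[/set_mem ? ->]]; last exact: mem_set.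
    by rewrite andbT; exact: mem_set.
  have -> : ((x, ~~ b) \in A `*` [set true]) = (x \in A) && ~~ b.
    apply/idP/idP => [/set_mem[/= ? ->]|/andP[/set_mem ? ->]]; last exact: mem_set.
    by rewrite andbT; exact: mem_set.
  by case: b; case: (x \in A) => /=; ring.
rewrite ExD; last 2 first.
- by apply: bmeasM; [exact: bmeas_label|exact: bmeas_fst bf].
- exact: bmeas_fst bg.
rewrite (class_prob_label hD bf) -ExD; last 2 first.
- by apply: bmeasM; [exact: bmeas_fst|exact: bmeas_fst bf].
- exact: bmeas_fst bg.
by apply: eq_Rintegral => z _; rewrite /etab; ring.
Qed.

End noisy.
End class_probability.

(** * Consistency of SLIsotron *)

Section sample_size.
Context {R : realType} {d : nat}.

(** The predecessor compensates the successor in [grid_cell]: cells have side [k.+1 ^ -8]. *)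
Definition mesh (k : nat) : nat := (k.+1 ^ 8).-1.

Definition cells (k : nat) : nat :=
  #|{: {ffun 'I_d -> 'I_(2 * (mesh k).+1).+1} * bool}|.

(** With [K = k.+1], N cells and [eps = K^-8 / N], the uniform law fails with probability at most
    [N / (m eps^2) = N^3 K^16 / m]; this size makes it at most [1 / K]. *)
Definition sample_size (k : nat) : nat := (k.+1 ^ 17 * cells k ^ 3)%N.

Lemma meshE k : (mesh k).+1 = (k.+1 ^ 8)%N.
Proof. by rewrite prednK// expn_gt0. Qed.

Lemma cells_gt0 k : (0 < cells k)%N.
Proof. by rewrite /cells; apply/card_gt0P; exists ([ffun=> ord0], true). Qed.

(** The event on which the whole analysis is deterministic. *)
Definition representative (D : probability (labeled R d) R) k m
    (S : m.-tuple (labeled R d)) :=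
  (forall i, in_ball (tnth S i)) /\
  forall (phi : labeled R d -> R) (om : R), bmeas phi -> (forall z, `|phi z| <= 1) ->
    0 <= om ->
    (forall z z', in_ball z -> in_ball z' ->
      grid_cell (mesh k) z = grid_cell (mesh k) z' -> `|phi z - phi z'| <= om) ->
    `|mean (fun i => phi (tnth S i)) - \int[D]_z phi z| <= 2 * om + k.+1%:R ^- 8.

Lemma representative_sample (D : probability (labeled R d) R) k m :
  D in_ball = 1%E -> (sample_size k <= m)%N ->
  exists Bad : set (m.-tuple (labeled R d)), [/\ measurable Bad,
    (iid D m Bad <= (k.+1%:R^-1)%:E)%E &
    forall S, ~ Bad S -> representative D k S].
Proof.
move=> DG km.
have N0 : 0 < (cells k)%:R :> R by rewrite ltr0n cells_gt0.
have k0 : 0 < k.+1%:R :> R by rewrite ltr0n.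
have m0 : (0 < m)%N.
  by apply: leq_trans km; rewrite muln_gt0 !expn_gt0 cells_gt0.
pose eps : R := k.+1%:R ^- 8 / (cells k)%:R.
have eps01 : 0 < eps <= 1.
  rewrite divr_gt0 ?invr_gt0 ?exprn_gt0//= ler_pdivrMr// mul1r.
  apply: le_trans (_ : 1 <= _); last by rewrite ler1n cells_gt0.
  by rewrite invf_le1 ?exprn_gt0// exprn_ege1// ler1n.
have [Bad [mB PB hB]] := uniform_lln (@measurable_grid_cell R d (mesh k)) measurable_in_ball DG m0 eps01.
exists Bad; split=> //.
  apply: le_trans PB _; rewrite -/(cells k) lee_fin.
  have e0 : 0 < m%:R * eps ^+ 2 by case/andP: eps01 => ? _; rewrite mulr_gt0 ?ltr0n ?exprn_gt0.
  rewrite ler_pdivrMr// mulrC.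
  have : (sample_size k)%:R <= m%:R :> R by rewrite ler_nat.
  rewrite /sample_size natrM !natrX => h.
  apply: le_trans (_ : k.+1%:R ^+ 17 * (cells k)%:R ^+ 3 * eps ^+ 2 / k.+1%:R <= _).
    rewrite /eps le_eqVlt; apply/orP; left; apply/eqP.
    by field; rewrite !gt_eqF.
  by rewrite ler_wpM2r ?invr_ge0 ?(ltW k0)// ler_wpM2r ?sqr_ge0.
move=> S nB; have [SG h] := hB _ nB; split=> // phi om b1 b2 b3 b4.
apply: le_trans (h _ _ b1 b2 b3 b4) _.
by rewrite -/(cells k) /eps mulrCA divff ?mulr1 ?gt_eqF.
Qed.

End sample_size.

Lemma dist01_le {R : realType} (a b : R) :
  0 <= a <= 1 -> 0 <= b <= 1 -> `|a - b| <= 1.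
Proof. by move=> /andP[? ?] /andP[? ?]; rewrite ler_norml; lra. Qed.

Lemma clip11_le {R : realType} (a : R) : `|Num.min 1 (Num.max (-1) a)| <= 1.
Proof.
have N11 : -1 <= 1 :> R by lra.
by rewrite ler_norml; case: (clip_spec a N11) => -[? ->]; lra.
Qed.

Lemma clip11_id {R : realType} (a : R) : `|a| <= 1 ->
  Num.min 1 (Num.max (-1) a) = a.
Proof.
have N11 : -1 <= 1 :> R by lra.
by rewrite ler_norml; case: (clip_spec a N11) => -[? ->] /andP[? ?] //; lra.
Qed.

(* [es] and [et] are the risks of the selected and of the good iterate in excess
   of [V], [a] and [b] their empirical errors, [me] the empirical excess of the
   good one. *)
Lemma selection_bound {R : realType} (es et V a b me nu : R) : a <= b ->
  - nu <= a - (V + es) -> b - (V + et) <= nu -> - nu <= me - et ->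
  es <= me + 3 * nu.
Proof. lra. Qed.

(** [WK] and [dK] stand for W K and d K, taken as atoms so that the goals are linear. The first four
    bounds serve the test functions noise times coordinate, noise times difference of fits, squared
    error against the label, and squared error against the regression function; the last serves the
    descent constant. *)
Lemma oscillation_budget {R : realType} (W WK d dK K : R) :
  0 <= W -> W <= WK -> d <= dK -> 1 <= K -> 0 <= dK ->
  let C := 2 * WK + 2 * dK + K in
  [/\ W + 1 <= C, W + dK + dK <= C, dK + dK <= C, 2 * (W + dK) <= C &
      4 + 4 * (W + dK) + 2 * d <= 4 * K + 4 * WK + 4 * dK + 2 * dK].
Proof. by move=> W0 WK0 dK1 K1 dK0 C; rewrite /C; split; lra. Qed.

Section consistency.
Context {R : realType} {d : nat}.
Variables (D : probability (labeled R d) R) (v : R -> R) (ws : vec R d).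
Hypothesis v_slope : slope01 v.
Hypothesis v_01 : forall a, 0 <= v a <= 1.
Hypothesis hD : class_prob D (v \o inner ws).

Let W := \sum_k `|tnth ws k|.
(** With [K = k.+1], oscillations are at most [C0 / K^7] for [C0 = 2 W + 2 d + 1]; the uniform law
    allows two of them plus [K^-8], hence [C1 = 2 C0 + 1]. [C4] adds the initial squared distance,
    the loss in the descent and three deviations in the selection. *)
Let C1 := 2 * (2 * W + 2 * d%:R + 1) + 1.
Let C4 := \sum_k tnth ws k ^+ 2 + (4 + 4 * W + 6 * d%:R) * C1 + 3 * C1.

Lemma bmeas_link (u : R -> R) (w : vec R d) : slope01 u ->
  (forall a, 0 <= u a <= 1) -> bmeas (fun x => u (inner w x)).
Proof.
move=> su u01; apply: bmeas01 => //.
have mu : measurable_fun setT u.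
  by apply: continuous_measurable_fun; exact: slope01_continuous.
exact: (measurableT_comp mu (measurable_inner_l w)).
Qed.

Lemma dist_prod_le (a a' b b' : R) : `|a| <= 1 -> `|b'| <= 1 ->
  `|a * b - a' * b'| <= `|a - a'| + `|b - b'|.
Proof.
move=> a1 b1; have -> : a * b - a' * b' = a * (b - b') + (a - a') * b' by ring.
apply: le_trans (ler_normD _ _) _; rewrite !normrM addrC lerD//.
  by rewrite ler_piMr.
by rewrite ler_piMl.
Qed.

Lemma grid_link_le k (u : R -> R) (w : vec R d) (V : R) z z' : slope01 u ->
  \sum_j `|tnth w j| <= V -> in_ball z -> in_ball z' ->
  grid_cell (mesh k) z = grid_cell (mesh k) z' ->
  `|u (inner w z.1) - u (inner w z'.1)| <= V * k.+1%:R ^- 8.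
Proof.
move=> su wV [bz _] [bz' _] zz'; apply: le_trans (slope01_lip su _ _) _.
have h j := grid_cell_dist bz bz' zz' j; rewrite meshE natrX in h.
apply: le_trans (inner_sub_le w _ h) _; first by rewrite invr_ge0 exprn_ge0.
by rewrite ler_wpM2r// invr_ge0 exprn_ge0.
Qed.

Lemma slisotron_consistent k m (S : m.-tuple (labeled R d)) : (0 < m)%N ->
  C1 <= k.+1%:R -> representative D k S ->
  \int[D]_z (slisotron S (best_iterate k S) z.1 - v (inner ws z.1)) ^+ 2 <=
    C4 / k.+1%:R.
Proof.
move=> m0 kC [SG rep].
have Sball i : eball (tnth S i).1 by have [] := SG i.
set K : R := k.+1%:R in kC rep *.
have W0 : 0 <= W by exact: sumr_ge0.
have d0 : 0 <= d%:R :> R by [].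
have C1ge : 1 <= C1 by rewrite /C1; lra.
have C1_ge0 : 0 <= C1 by exact: le_trans C1ge.
have Q0 : 0 <= 4 + 4 * W + 6 * d%:R by rewrite !addr_ge0 ?mulr_ge0.
have K1 : 1 <= K by exact: le_trans kC.
have K0 : 0 < K by exact: lt_le_trans K1.
have Kinv i j : (i <= j)%N -> K ^- j <= K ^- i.
  by move=> ij; rewrite lef_pV2 ?posrE ?exprn_gt0//; exact: ler_weXn2l.
pose C0 := 2 * W + 2 * d%:R + 1.
pose om := C0 / K ^+ 7.
have om0 : 0 <= om by rewrite divr_ge0 ?exprn_ge0 ?(ltW K0)// /C0; lra.
pose nu := C1 / K ^+ 7.
have nu0 : 0 <= nu by rewrite divr_ge0 ?exprn_ge0 ?(ltW K0)//; lra.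
have omE : 2 * om + K ^- 8 <= nu.
  have -> : nu = 2 * om + K ^- 7 by rewrite /nu /om /C1 -/C0 mulrDl mul1r -mulrA.
  rewrite lerD2l.
  exact: Kinv.
have osc V : V <= C0 * K -> V * K ^- 8 <= om.
  move=> hV; apply: le_trans (_ : C0 * K * K ^- 8 <= _).
    by rewrite ler_wpM2r// invr_ge0 exprn_ge0// ltW.
  rewrite /om le_eqVlt; apply/orP; left; apply/eqP; field.
  by rewrite gt_eqF.
pose w t := slisotron_weight S t.
have wT t : (t < k.+1)%N -> \sum_j `|tnth (w t) j| <= d%:R * K.
  move=> tk; apply: le_trans (_ : \sum_(j < d) K <= _); last by rewrite sumr_const card_ord mulr_natl.
  apply: ler_sum => j _; apply: le_trans (slisotron_weight_le m0 Sball _ _) _.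
  by rewrite ler_nat ltnW.
pose uh t (x : vec R d) := slisotron S t x.
pose ut t (x : vec R d) := clean_fit S v ws (w t) (inner (w t) x).
pose eta (x : vec R d) := v (inner ws x).
have beta' : bmeas eta by exact: bmeas_link.
have buh t : bmeas (uh t).
  by apply: bmeas_link; [exact: LPAV_along_slope01|exact: LPAV_along_01].
have but t : bmeas (ut t).
  by apply: bmeas_link; [exact: clean_fit_slope01|exact: clean_fit_01].
have uh01 t x : 0 <= uh t x <= 1 by exact: slisotron_01.
have ut01 t x : 0 <= ut t x <= 1 by exact: clean_fit_01.
have eta01 x : 0 <= eta x <= 1 by exact: v_01.
have osc_eta (z z' : labeled R d) : in_ball z -> in_ball z' -> grid_cell (mesh k) z = grid_cell (mesh k) z' ->
    `|eta z.1 - eta z'.1| <= W * K ^- 8 by exact: grid_link_le.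
have osc_uh t (z z' : labeled R d) : (t < k.+1)%N -> in_ball z -> in_ball z' -> grid_cell (mesh k) z = grid_cell (mesh k) z' ->
    `|uh t z.1 - uh t z'.1| <= d%:R * K * K ^- 8.
  by move=> /wT; apply: grid_link_le; exact: LPAV_along_slope01.
have osc_ut t (z z' : labeled R d) : (t < k.+1)%N -> in_ball z -> in_ball z' -> grid_cell (mesh k) z = grid_cell (mesh k) z' ->
    `|ut t z.1 - ut t z'.1| <= d%:R * K * K ^- 8.
  by move=> /wT; apply: grid_link_le; exact: clean_fit_slope01.
have bool01 (b : bool) : 0 <= (b%:R : R) <= 1 by case: b; rewrite ?lexx ler01.
have bres := bmeas_residual hD.
have resid (z : labeled R d) : `|z.2%:R - eta z.1| <= 1.
  exact: dist01_le.
have Kinv0 : 0 <= K ^- 8 by rewrite invr_ge0 exprn_ge0// ltW.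
have dK0 : 0 <= d%:R * K by rewrite mulr_ge0// ltW.
have C0K : C0 <= C0 * K by rewrite ler_peMr// /C0; lra.
have WK : W <= W * K by rewrite ler_peMr.
have dK : d%:R <= d%:R * K by rewrite ler_peMr.
have [ob1 ob2 ob3 ob4 ob5] := oscillation_budget W0 WK dK K1 dK0.
have cancel (a b c : R) : `|a - b - (a - c)| = `|b - c|.
  by rewrite -normrN; congr (`|_|); ring.
have C0KE : C0 * K = 2 * (W * K) + 2 * (d%:R * K) + K by rewrite /C0; ring.
have h1 j : `|mean (fun i => ((tnth S i).2%:R - eta (tnth S i).1) * tnth (tnth S i).1 j)| <= nu.
  (* Coordinates are bounded by 1 only on the ball, where clipping leaves them unchanged, while test
     functions must be bounded by 1 everywhere. *)
  pose clip (a : R) := Num.min 1 (Num.max (-1) a).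
  have clip1 a : `|clip a| <= 1 by exact: clip11_le.
  have clipE x : eball x -> clip (tnth x j) = tnth x j.
    by move=> /(@eball_coord _ _ _ j); exact: clip11_id.
  have bclip : bmeas (fun z : labeled R d => clip (tnth z.1 j)).
    split; last by exists 1 => z; exact: clip1.
    apply: measurable_minr => //; apply: measurable_maxr => //.
    exact: (measurableT_comp (measurable_tnth j) measurable_fst).
  have := rep (fun z => (z.2%:R - eta z.1) * clip (tnth z.1 j)) om (bmeasM bres bclip) _ om0 _.
  have -> : \int[D]_z ((z.2%:R - eta z.1) * clip (tnth z.1 j)) = 0.
    apply: (class_prob_int hD (f := fun x => clip (tnth x j))).
    split; last by exists 1 => x; exact: clip1.
    apply: measurable_minr => //; apply: measurable_maxr => //.
    exact: measurable_tnth.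
  rewrite subr0.
  rewrite (eq_mean (g := fun i => ((tnth S i).2%:R - eta (tnth S i).1) * tnth (tnth S i).1 j)); last first.
    by move=> i; rewrite clipE.
  move=> h; apply: le_trans omE; apply: h.
    by move=> z; rewrite normrM -[leRHS]mul1r ler_pM.
  move=> z z' bz bz' zz'.
  apply: le_trans (dist_prod_le _ _ _ _) _ => //.
  rewrite (grid_cell_label zz') cancel (clipE _ bz.1) (clipE _ bz'.1).
  have e1 := osc_eta _ _ bz bz' zz'.
  have e2 : `|tnth z.1 j - tnth z'.1 j| <= K ^- 8.
    by have := grid_cell_dist bz.1 bz'.1 zz' j; rewrite meshE natrX -/K.
  have o : (W + 1) * K ^- 8 <= om by apply: osc; rewrite C0KE.
  by rewrite mulrDl mul1r in o; exact: le_trans (lerD e1 e2) o.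
have h2 t : (t < k.+1)%N ->
    mean (fun i => ((tnth S i).2%:R - eta (tnth S i).1) * (uh t (tnth S i).1 - ut t (tnth S i).1)) <= nu.
  move=> tk.
  have bd : bmeas (fun x => uh t x - ut t x) by exact: bmeasB.
  have := rep (fun z => (z.2%:R - eta z.1) * (uh t z.1 - ut t z.1)) om (bmeasM bres (bmeas_fst bd)) _ om0 _.
  rewrite (class_prob_int hD bd) subr0 => h.
  apply: le_trans omE; apply: le_trans (ler_norm _) _; apply: h.
    move=> z; rewrite normrM -[leRHS]mul1r ler_pM//.
    exact: dist01_le.
  move=> z z' bz bz' zz'.
  apply: le_trans (dist_prod_le _ _ _ _) _ => //.
    exact: dist01_le.
  have o4 := osc_eta _ _ bz bz' zz'; have o3 := osc_uh _ _ _ tk bz bz' zz'.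
  have o2 := osc_ut _ _ _ tk bz bz' zz'.
  have o1 : (W + d%:R * K + d%:R * K) * K ^- 8 <= om by apply: osc; rewrite C0KE.
  rewrite !mulrDl in o1; rewrite (grid_cell_label zz') cancel.
  have o5 : `|uh t z.1 - ut t z.1 - (uh t z'.1 - ut t z'.1)| <=
      `|uh t z.1 - uh t z'.1| + `|ut t z.1 - ut t z'.1|.
    apply: le_trans (ler_normB _ _); rewrite le_eqVlt; apply/orP; left; apply/eqP.
    by congr (`|_|); ring.
  by apply: le_trans (lerD o4 (le_trans o5 (lerD o3 o2))) _; rewrite addrA.
(* [C1 / K^7 <= (C1 / K^3)^2] because [C1] and [K] are at least 1, and [beta <= 1] because
   [C1 <= K]. *)
pose beta := C1 / K ^+ 3.
have beta01 : 0 < beta <= 1.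
  rewrite divr_gt0 ?exprn_gt0//=; last by lra.
  rewrite ler_pdivrMr ?exprn_gt0// mul1r; apply: le_trans kC _.
  by rewrite -[leLHS]expr1 ler_weXn2l.
have nub : nu <= beta ^+ 2.
  rewrite /nu /beta expr_div_n -exprM; apply: le_trans (_ : C1 / K ^+ 6 <= _).
    by rewrite ler_wpM2l ?Kinv//; lra.
  by rewrite ler_wpM2r ?invr_ge0 ?exprn_ge0 ?(ltW K0)// expr2 ler_peMl//; lra.
have [t tk Et] := slisotron_best_iterate m0 Sball v_slope v_01 (ltn0Sn k) (lexx W) beta01 nub h1 h2.
set s := best_iterate k S.
have sk : (s < k.+1)%N by rewrite ltnS best_iterate_le.
have err r : (r < k.+1)%N ->
    `|empirical_error r S - \int[D]_z (z.2%:R - uh r z.1) ^+ 2| <= nu.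
  move=> rk.
  have bd : bmeas (fun z : labeled R d => z.2%:R - uh r z.1).
    by apply: bmeasB; [exact: bmeas_label|exact: bmeas_fst].
  apply: le_trans omE; apply: (rep (fun z => (z.2%:R - uh r z.1) ^+ 2)) => //.
  - exact: bmeasX.
  - move=> z; rewrite normrX exprn_ile1//.
    exact: dist01_le.
  - move=> z z' bz bz' zz'; rewrite !expr2.
    have b1 (z1 : labeled R d) : `|z1.2%:R - uh r z1.1| <= 1.
      exact: dist01_le.
    apply: le_trans (dist_prod_le _ _ _ _) _ => //.
    rewrite (grid_cell_label zz') cancel.
    have o := osc_uh _ _ _ rk bz bz' zz'.
    have o' : (d%:R * K + d%:R * K) * K ^- 8 <= om by apply: osc; rewrite C0KE.
    by rewrite mulrDl in o'; exact: le_trans (lerD o o) o'.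
have err2 r : (r < k.+1)%N ->
    `|mean (fun i => (eta (tnth S i).1 - uh r (tnth S i).1) ^+ 2) - \int[D]_z (eta z.1 - uh r z.1) ^+ 2| <= nu.
  move=> rk.
  have b1 x : `|eta x - uh r x| <= 1.
    exact: dist01_le.
  have bd : bmeas (fun z : labeled R d => eta z.1 - uh r z.1).
    by apply: bmeasB; exact: bmeas_fst.
  apply: le_trans omE; apply: (rep (fun z => (eta z.1 - uh r z.1) ^+ 2)) => //.
  - exact: bmeasX.
  - by move=> z; rewrite normrX exprn_ile1.
  - move=> z z' bz bz' zz'; rewrite !expr2.
    apply: le_trans (dist_prod_le _ _ _ _) _ => //.
    have o1 := osc_uh _ _ _ rk bz bz' zz'; have o2 := osc_eta _ _ bz bz' zz'.
    have o3 : `|eta z.1 - uh r z.1 - (eta z'.1 - uh r z'.1)| <= W * K ^- 8 + d%:R * K * K ^- 8.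
      have -> : eta z.1 - uh r z.1 - (eta z'.1 - uh r z'.1) = (eta z.1 - eta z'.1) - (uh r z.1 - uh r z'.1) by ring.
      by apply: le_trans (ler_normB _ _) _; exact: lerD.
    have o' : 2 * (W + d%:R * K) * K ^- 8 <= om by apply: osc; rewrite C0KE.
    apply: le_trans (lerD o3 o3) _; apply: le_trans o'.
    by rewrite le_eqVlt; apply/orP; left; apply/eqP; ring.
(* Bias-variance decomposition: the first summand does not depend on [r], so comparing risks against
   the labels compares distances to [eta]. *)
have bv r : \int[D]_z (z.2%:R - uh r z.1) ^+ 2 =
    \int[D]_z (z.2%:R - eta z.1) ^+ 2 + \int[D]_z (eta z.1 - uh r z.1) ^+ 2.
  have bd : bmeas (fun x => 2 * (eta x - uh r x)) by apply/bmeasZ/bmeasB.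
  have e0 : \int[D]_z ((z.2%:R - eta z.1) * (2 * (eta z.1 - uh r z.1))) = 0.
    exact: class_prob_int hD bd.
  have b1 : bmeas (fun z : labeled R d => (z.2%:R - eta z.1) ^+ 2) by exact: bmeasX.
  have b2 : bmeas (fun z : labeled R d => (eta z.1 - uh r z.1) ^+ 2).
    by apply/bmeasX/bmeasB; exact: bmeas_fst.
  have b3 : bmeas (fun z : labeled R d => (z.2%:R - eta z.1) * (2 * (eta z.1 - uh r z.1))).
    by apply: bmeasM => //; exact: bmeas_fst bd.
  rewrite -ExD// -[RHS]addr0 -e0 -ExD//; last exact: bmeasD.
  by apply: eq_Rintegral => z _; ring.
have -> : \int[D]_z (slisotron S s z.1 - v (inner ws z.1)) ^+ 2 = \int[D]_z (eta z.1 - uh s z.1) ^+ 2.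
  by apply: eq_Rintegral => z _; rewrite -sqrrN opprB.
have := best_iterate_min S (ltnSE tk); rewrite -/s => hmin.
have := err _ sk; have := err _ tk; have := err2 _ tk; rewrite (bv s) (bv t).
rewrite !ler_norml => /andP[h3 _] /andP[_ h4] /andP[h5 _].
have hE : mean (fun i => (eta (tnth S i).1 - uh t (tnth S i).1) ^+ 2) <=
    (\sum_j tnth ws j ^+ 2) / K + (4 + 4 * W + 6 * d%:R) * C1 / K.
  apply: le_trans Et _; rewrite lerD2l /beta -/K.
  apply: le_trans (_ : (4 + 4 * W + 6 * d%:R) * K * (C1 / K ^+ 3) <= _).
    rewrite ler_wpM2r//; first by case/andP: beta01 => /ltW.
    have -> : (4 + 4 * W + 6 * d%:R) * K = 4 * K + 4 * (W * K) + 4 * (d%:R * K) + 2 * (d%:R * K) by ring.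
    exact: ob5.
  have -> : (4 + 4 * W + 6 * d%:R) * K * (C1 / K ^+ 3) = (4 + 4 * W + 6 * d%:R) * C1 / K ^+ 2.
    by field; rewrite gt_eqF.
  by apply: ler_wpM2l; [exact: mulr_ge0|exact: (Kinv 1%N)].
have hnu : nu <= C1 / K.
  by apply: ler_wpM2l; [|exact: (Kinv 1%N)].
apply: le_trans (selection_bound hmin h5 h4 h3) _.
have -> : C4 / K = (\sum_j tnth ws j ^+ 2) / K + (4 + 4 * W + 6 * d%:R) * C1 / K + 3 * (C1 / K).
  by rewrite /C4; ring.
by apply: lerD hE _; rewrite ler_wpM2l.
Qed.

Lemma slisotron_eventually_close (th : R) : 0 < th ->
  exists k0, forall k m (S : m.-tuple (labeled R d)), (k0 <= k)%N -> (0 < m)%N ->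
    representative D k S ->
    \int[D]_z `|slisotron S (best_iterate k S) z.1 - v (inner ws z.1)| <= th.
Proof.
move=> th0.
have W0 : 0 <= W by exact: sumr_ge0.
have d0 : 0 <= d%:R :> R by [].
have C1ge : 1 <= C1 by rewrite /C1; lra.
have C4ge : 0 <= C4.
  rewrite /C4 !addr_ge0 ?mulr_ge0//; try lra.
  by apply: sumr_ge0 => k _; exact: sqr_ge0.
(* Large enough that [C1 <= k.+1] and [C4 / k.+1 <= th ^+ 2]. *)
exists (Num.truncn (C4 / th ^+ 2 + C1)) => k m S k0k m0 rep.
have kC : C4 / th ^+ 2 + C1 <= k.+1%:R.
  have q0 : 0 <= C4 / th ^+ 2 + C1 by rewrite addr_ge0 ?divr_ge0 ?sqr_ge0//; lra.
  have /andP[_ /ltW/le_trans] := truncn_itv q0; apply.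
  by rewrite ler_nat ltnS.
have q1 : 0 <= C4 / th ^+ 2 by rewrite divr_ge0 ?sqr_ge0.
have h := slisotron_consistent m0 (le_trans (_ : C1 <= _) kC) rep.
have {}h : \int[D]_z (slisotron S (best_iterate k S) z.1 - v (inner ws z.1)) ^+ 2 <= th ^+ 2.
  apply: le_trans (h _) _; first by rewrite lerDr.
  rewrite ler_pdivrMr ?ltr0n// mulrC -ler_pdivrMr ?exprn_gt0//.
  by apply: le_trans kC; rewrite lerDl; lra.
have Sball i : eball (tnth S i).1 by have [] := rep.1 i.
have bd : bmeas (fun z : labeled R d => slisotron S (best_iterate k S) z.1 - v (inner ws z.1)).
  have b1 : bmeas (slisotron S (best_iterate k S)).
    by apply: bmeas_link; [exact: LPAV_along_slope01|exact: LPAV_along_01].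
  have b2 : bmeas (fun x => v (inner ws x)) by exact: bmeas_link.
  exact: bmeasB (bmeas_fst b1) (bmeas_fst b2).
have bn := bmeas_norm bd; have b2 := bmeasX 2 bd.
have : 2 * th * \int[D]_z `|slisotron S (best_iterate k S) z.1 - v (inner ws z.1)| <= 2 * th * th.
  rewrite -ExZ//; apply: le_trans (_ : \int[D]_z ((slisotron S (best_iterate k S) z.1 - v (inner ws z.1)) ^+ 2 + th ^+ 2) <= _).
    apply: Ex_le; [exact: bmeasZ|by apply: bmeasD => //; exact: bmeas_cst|move=> z].
    set a := _ - _; have := sqr_ge0 (`|a| - th).
    by rewrite sqrrB real_normK ?num_real// -mulr_natl; lra.
  rewrite ExD//; last exact: bmeas_cst.
  by rewrite Ex_cst; apply: le_trans (lerD h (lexx _)) _; rewrite le_eqVlt; apply/orP; left; apply/eqP; ring.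
by rewrite ler_pM2l// mulr_gt0.
Qed.

End consistency.

(** * Noisy links and regret bounds *)

Section noise_link.
Context {R : realType} {d : nat}.
Variables (w : vec R d) (u fm fp : R -> R).
Let r := enorm w.
Let rate z := 1 - fp z - fm z.
Let ub z := u z * (1 - fp z) + (1 - u z) * fm z.
Hypothesis u01 : forall z, 0 <= u z <= 1.
Hypothesis u_mono : {homo u : z z' / z <= z'}.
Hypothesis cu : continuous u.
Hypothesis cfm : continuous fm.
Hypothesis cfp : continuous fp.

(** The point [(z / r^2) w] works; for [r = 0] only [z = 0] occurs and the quotient is 0. Through
    it, hypotheses about points of the ball become statements about every score in [[-r, r]],
    intermediate ones included. *)
Lemma inner_ball_onto z : - r <= z <= r -> exists2 x, eball x & inner w x = z.
Proof.
move=> zr.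
have r0 : 0 <= r by exact: sqrtr_ge0.
have rE : inner w w = r ^+ 2 by rewrite sqr_sqrtr ?inner_ge0.
exists [tuple z / r ^+ 2 * tnth w k | k < d].
  apply: inner_eball; rewrite innerE.
  under eq_bigr do rewrite tnth_mktuple exprMn.
  rewrite -mulr_sumr -innerE rE.
  have [->|rn0] := eqVneq r 0; first by rewrite expr0n mulr0 ler01.
  have -> : (z / r ^+ 2) ^+ 2 * r ^+ 2 = (z / r) ^+ 2 by field.
  have rp : 0 < r by rewrite lt_neqAle eq_sym rn0.
  rewrite -real_normK ?num_real// exprn_ile1// normrM normfV (gtr0_norm rp).
  by rewrite ler_pdivrMr// mul1r ler_norml.
rewrite /inner; under eq_bigr do rewrite tnth_mktuple mulrCA.
rewrite -mulr_sumr -[X in _ * X]/(inner w w) rE.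
have [r0E|rn0] := eqVneq r 0; last by rewrite divfK ?expf_neq0.
by move: zr; rewrite r0E expr0n /= mulr0 oppr0 => zr; apply/eqP; rewrite eq_le.
Qed.

Lemma inner_range x : eball x -> - r <= inner w x <= r.
Proof. by move=> bx; rewrite -ler_norml; exact: inner_le_enorm. Qed.

Hypothesis total_noise : forall x, eball x -> fp (inner w x) + fm (inner w x) < 1.
Hypothesis admissible : BCN_admissible fm fp (inner w) (fun x => u (inner w x)).

Lemma rate_lower_bound : exists2 c, 0 < c & forall z, - r <= z <= r -> c <= rate z.
Proof.
have r0 : 0 <= r by exact: sqrtr_ge0.
have [||c cI hc] := @EVT_min R rate (- r) r.
- by lra.
- apply: continuous_subspaceT => z.
  by apply: cvgB; [apply: cvgB; [exact: cvg_cst|exact: cfp]|exact: cfm].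
exists (rate c) => [|z zr]; last by apply: hc; rewrite in_itv.
have [x bx <-] : exists2 x, eball x & inner w x = c.
  by apply: inner_ball_onto; move: cI; rewrite in_itv.
by rewrite /rate; have := total_noise bx; lra.
Qed.

(** Write Df for the increment of f from [z] to [z']. The increment of [ub] is [rate z' * Du + (1 -
    u z) (Dfm - Dfp) + (1 - 2 u z) Dfp], and equally [rate z' * Du + u z (Dfm - Dfp) + (2 u z - 1)
    (- Dfm)]. Admissibility makes all terms nonnegative in the first form while [u <= 1/2] and in
    the second once [u >= 1/2]; an interval crossing 1/2 is split where [u] equals 1/2. *)
Lemma noisy_link_increasing c : (forall z, - r <= z <= r -> c <= rate z) ->
  forall z z', - r <= z -> z <= z' -> z' <= r ->
    c * (u z' - u z) <= ub z' - ub z.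
Proof.
move=> hc; have [_ hB hC] := admissible.
have side f z z' : f = fm \/ f = fp -> - r <= z -> z <= z' -> z' <= r ->
    (u z <= 2^-1 -> u z' <= 2^-1 -> f z <= f z') /\
    (2^-1 <= u z -> 2^-1 <= u z' -> f z' <= f z).
  move=> ff rz zz' zr'.
  have [x bx xz] : exists2 x, eball x & inner w x = z.
    by apply: inner_ball_onto; rewrite rz (le_trans zz').
  have [x' bx' xz'] : exists2 x, eball x & inner w x = z'.
    by apply: inner_ball_onto; rewrite zr' andbT (le_trans rz).
  by have := hB f ff x x' bx bx'; rewrite xz xz'; apply.
have low z z' : - r <= z -> z <= z' -> z' <= r -> u z' <= 2^-1 ->
    c * (u z' - u z) <= ub z' - ub z.
  move=> rz zz' zr' uz'; have uu := u_mono zz'.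
  have [h1 _] := side _ _ _ (or_introl erefl) rz zz' zr'.
  have [h2 _] := side _ _ _ (or_intror erefl) rz zz' zr'.
  have {}h1 : fm z <= fm z' by apply: h1 => //; exact: le_trans uz'.
  have {}h2 : fp z <= fp z' by apply: h2 => //; exact: le_trans uz'.
  have h3 := hC _ _ zz'.
  have h4 : c <= rate z' by apply: hc; rewrite zr' andbT (le_trans rz).
  have /andP[u0 _] := u01 z.
  have h5 : 0 <= (u z' - u z) * (rate z' - c) by rewrite mulr_ge0 ?subr_ge0.
  have h6 : 0 <= (1 - u z) * ((fm z' - fm z) - (fp z' - fp z)).
    by rewrite mulr_ge0//; lra.
  have h7 : 0 <= (1 - 2 * u z) * (fp z' - fp z) by rewrite mulr_ge0//; lra.
  have -> : ub z' - ub z = c * (u z' - u z) + ((u z' - u z) * (rate z' - c) +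
     (1 - u z) * ((fm z' - fm z) - (fp z' - fp z)) + (1 - 2 * u z) * (fp z' - fp z)).
    by rewrite /ub /rate; ring.
  by rewrite lerDl !addr_ge0.
have high z z' : - r <= z -> z <= z' -> z' <= r -> 2^-1 <= u z ->
    c * (u z' - u z) <= ub z' - ub z.
  move=> rz zz' zr' uz; have uu := u_mono zz'.
  have [_ h1] := side _ _ _ (or_introl erefl) rz zz' zr'.
  have [_ h2] := side _ _ _ (or_intror erefl) rz zz' zr'.
  have {}h1 : fm z' <= fm z by apply: h1 => //; exact: le_trans uu.
  have {}h2 : fp z' <= fp z by apply: h2 => //; exact: le_trans uu.
  have h3 := hC _ _ zz'.
  have h4 : c <= rate z' by apply: hc; rewrite zr' andbT (le_trans rz).
  have /andP[_ u1] := u01 z.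
  have h5 : 0 <= (u z' - u z) * (rate z' - c) by rewrite mulr_ge0 ?subr_ge0.
  have h6 : 0 <= u z * ((fp z - fp z') - (fm z - fm z')).
    by rewrite mulr_ge0//; [exact: le_trans uz|lra].
  have h7 : 0 <= (2 * u z - 1) * (fm z - fm z') by rewrite mulr_ge0//; lra.
  have -> : ub z' - ub z = c * (u z' - u z) + ((u z' - u z) * (rate z' - c) +
     u z * ((fp z - fp z') - (fm z - fm z')) + (2 * u z - 1) * (fm z - fm z')).
    by rewrite /ub /rate; ring.
  by rewrite lerDl !addr_ge0.
move=> z z' rz zz' zr'.
have [uz'|/ltW uz'] := leP (u z') 2^-1; first exact: low.
have [uz|/ltW uz] := leP 2^-1 (u z); first exact: high.
have [||t tI ut] := @IVT R u z z' 2^-1 zz'.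
- exact: continuous_subspaceT.
- have uu := u_mono zz'.
  by rewrite (min_idPl uu) (max_idPr uu) uz.
move: tI; rewrite in_itv/= => /andP[zt tz'].
have h1 := low z t rz zt (le_trans tz' zr').
have h2 := high t z' (le_trans rz zt) tz' zr'.
have : c * (u t - u z) <= ub t - ub z by apply: h1; rewrite ut.
have : c * (u z' - u t) <= ub z' - ub t by apply: h2; rewrite ut.
rewrite !mulrBr; lra.
Qed.

End noise_link.

(** * Regret in terms of the estimation error *)

Lemma half_le {R : realType} (a b e : R) : a + a - (b + b) <= 2 * e -> a - b <= e.
Proof. lra. Qed.

Section regrets.
Context {R : realType} {d : nat}.
Variables (D : probability (labeled R d) R) (eta etab h : vec R d -> R) (c : R).
Hypothesis DG : D in_ball = 1%E.
Hypothesis hD : class_prob D eta.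
Hypothesis c_gt0 : 0 < c.
Hypothesis bh : bmeas h.
Hypothesis bb : bmeas etab.

Let eta01 x : 0 <= eta x <= 1. Proof. by case: hD => _ /(_ x). Qed.
Let beta : bmeas eta. Proof. by apply: bmeas01 => //; case: hD. Qed.

Let err := \int[D]_z `|h z.1 - etab z.1|.

(** Comparison with every competitor also shows that the risks are bounded below, without which
    [inf] would carry no information. *)
Lemma inf_regret_le (F : (vec R d -> R) -> R) (s : vec R d -> R) (e : R) :
  measurable_fun setT s ->
  (forall t, measurable_fun setT t -> F s - F t <= e) ->
  0 <= F s - inf [set F t | t in [set t | measurable_fun setT t]] <= e.
Proof.
move=> ms hF; set I := [set _ | _ in _].
have Is : I (F s) by exists s.
have lbI : lbound I (F s - e) by move=> _ [t mt <-]; have := hF t mt; lra.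
have h1 : F s - e <= inf I by apply: lb_le_inf => //; exists (F s).
have h2 : inf I <= F s by apply: ge_inf => //; exists (F s - e).
by apply/andP; split; lra.
Qed.

Lemma loss01_bounds y v : 0 <= (loss01 y v : R) <= 1.
Proof.
rewrite /loss01; case: (ltgtP v 0) => [v0|v0|->] /=.
- by rewrite mulr0 addr0; case: (_ < 0)%R; rewrite ?lexx ler01.
- by rewrite mulr0 addr0; case: (_ < 0)%R; rewrite ?lexx ler01.
- by rewrite mulr0 ltxx /=; lra.
Qed.

Lemma measurable_loss01 dT (T : measurableType dT) (y v : T -> R) :
  measurable_fun setT y -> measurable_fun setT v ->
  measurable_fun setT (fun t => loss01 (y t) (v t)).
Proof.
move=> my mv.
have mb (b : T -> bool) : measurable_fun setT b -> measurable_fun setT (fun t => (b t)%:R : R).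
  by move=> mb; exact: (measurableT_comp (f := fun b : bool => b%:R : R) _ mb).
apply: measurable_funD; first by apply: mb; apply: measurable_fun_ltr => //; exact: measurable_funM.
by apply: measurable_funM => //; apply: mb; exact: measurable_fun_eqr.
Qed.

Lemma loss01_swap (v : R) : loss01 1 v + loss01 1 (- v) = 1.
Proof.
rewrite /loss01 !mul1r oppr_lt0 oppr_eq0.
by case: (ltgtP v 0) => _ /=; rewrite ?mulr0 ?mulr1 ?addr0 ?add0r//; lra.
Qed.

Lemma bmeas_loss dT (T : measurableType dT) (y v : T -> R) :
  measurable_fun setT y -> measurable_fun setT v ->
  bmeas (fun t => loss01 (y t) (v t)).
Proof.
by move=> my mv; apply: bmeas01; [exact: measurable_loss01|move=> t; exact: loss01_bounds].
Qed.

Section ranking.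
Hypothesis pi01 : 0 < base_rate D < 1.
Hypothesis link : forall x x', eball x -> eball x' -> eta x < eta x' ->
  c * (eta x' - eta x) <= etab x' - etab x.

Let pi := base_rate D.

Let pair_loss s x x' := eta x * (1 - eta x') * loss01 1 (s x - s x').

Let bmeas_pair_loss s : measurable_fun setT s ->
  bmeas (fun zz : labeled R d * labeled R d => pair_loss s zz.1.1 zz.2.1).
Proof.
move=> ms.
have m1 : measurable_fun setT (fun zz : labeled R d * labeled R d => zz.1.1).
  exact: (measurableT_comp measurable_fst measurable_fst).
have m2 : measurable_fun setT (fun zz : labeled R d * labeled R d => zz.2.1).
  exact: (measurableT_comp measurable_fst measurable_snd).
apply: bmeasM.
  apply: bmeasM; first exact: (bmeas_comp m1 beta).
  by apply: bmeasB; [exact: bmeas_cst|exact: (bmeas_comp m2 beta)].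
apply: bmeas_loss => //; apply: measurable_funB.
  exact: (measurableT_comp ms m1).
exact: (measurableT_comp ms m2).
Qed.

(** Bayes' rule: relative to two independent draws of x, a pair of one positive and one negative has
    density [eta x (1 - eta x') / (pi (1 - pi))]. *)
Lemma rank_riskE s : measurable_fun setT s ->
  rank_risk D s = (pi * (1 - pi))^-1 *
    \int[D]_z \int[D]_z' pair_loss s z.1 z'.1.
Proof.
move=> ms; have /andP[p0 p1] := pi01.
have fD y : D (has_label y) \is a fin_num.
  by apply: fin_num_measure; exact: measurable_has_label.
have DT : fine (D (has_label true)) = pi by [].
have DF : fine (D (has_label false)) = 1 - pi.
  have e : has_label false = ~` (has_label true : set (labeled R d)).
    apply/seteqP; split=> [[x b] hf ht|[x []] // nt]; last by exfalso; apply: nt.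
    by have := etrans (esym ht) hf.
  rewrite e probability_setC; last exact: measurable_has_label.
  by rewrite fineB//= fD.
have DT0 : D (has_label true) != 0%E.
  by apply/eqP => e; move: p0; rewrite /base_rate e ltxx.
have DF0 : D (has_label false) != 0%E.
  by apply/eqP => e; move: DF p1; rewrite e /= -/pi => e1; lra.
have bl x : bmeas (fun x' => loss01 1 (s x - s x')).
  by apply: bmeas_loss => //; apply: measurable_funB.
have inner_int x : \int[class_conditional D false]_x' loss01 1 (s x - s x') =
    (1 - pi)^-1 * \int[D]_z' ((1 - eta z'.1) * loss01 1 (s x - s z'.1)).
  rewrite Ex_class_conditional// DF; congr (_ * _).
  transitivity (\int[D]_z' (loss01 1 (s x - s z'.1) - z'.2%:R * loss01 1 (s x - s z'.1))).
    by apply: eq_Rintegral => z _; case: z.2 => /=; rewrite ?mul0r ?mul1r ?subrr ?subr0.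
  have b1 : bmeas (fun z' : labeled R d => loss01 1 (s x - s z'.1)) by exact: bmeas_fst (bl x).
  rewrite ExB//; last by apply: bmeasM => //; exact: bmeas_label.
  rewrite (class_prob_label hD (bl x)) -ExB//; last by apply: bmeasM => //; exact: bmeas_fst.
  by apply: eq_Rintegral => z _; rewrite mulrBl mul1r.
have bpl := bmeas_pair_loss ms.
have bF : bmeas (fun x => \int[D]_z' ((1 - eta z'.1) * loss01 1 (s x - s z'.1))).
  apply: (bmeas_Ex (marginal D) D
    (f := fun xz : vec R d * labeled R d => (1 - eta xz.2.1) * loss01 1 (s xz.1 - s xz.2.1))).
  have m2 : measurable_fun setT (fun zz : vec R d * labeled R d => zz.2.1).
    exact: (measurableT_comp measurable_fst measurable_snd).
  apply: bmeasM; first by apply: bmeasB; [exact: bmeas_cst|exact: (bmeas_comp m2 beta)].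
  apply: bmeas_loss => //; apply: measurable_funB.
    exact: (measurableT_comp ms measurable_fst).
  exact: (measurableT_comp ms m2).
rewrite /rank_risk.
under eq_Rintegral do rewrite inner_int.
rewrite Ex_class_conditional//; last exact: bmeasZ.
rewrite DT.
transitivity (pi^-1 * ((1 - pi)^-1 * \int[D]_z (eta z.1 * \int[D]_z' ((1 - eta z'.1) * loss01 1 (s z.1 - s z'.1))))).
  congr (_ * _); rewrite -ExZ; last by apply: bmeasM; [exact: bmeas_fst beta|exact: bmeas_fst bF].
  transitivity (\int[D]_z (z.2%:R * ((1 - pi)^-1 * \int[D]_z' ((1 - eta z'.1) * loss01 1 (s z.1 - s z'.1))))).
    by apply: eq_Rintegral => z _; rewrite eqb_id.
  rewrite (class_prob_label hD (bmeasZ (1 - pi)^-1 bF)).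
  by apply: eq_Rintegral => z _; rewrite mulrCA.
rewrite mulrA -invfM; congr (_ * _).
apply: eq_Rintegral => z _; rewrite -ExZ.
  by apply: eq_Rintegral => z' _; rewrite mulrA.
apply: bmeasM; first by apply: bmeasB; [exact: bmeas_cst|exact: bmeas_fst].
exact: bmeas_fst (bl z.1).
Qed.

(* Symmetrising in (x, x'), only mis-ranked pairs contribute, and on those the
   gap [eta x - eta x'] is at most the estimation error at x and x'. *)
Lemma pair_loss_le t x x' : eball x -> eball x' ->
  (pair_loss h x x' + pair_loss h x' x) - (pair_loss t x x' + pair_loss t x' x) <=
    c^-1 * (`|h x - etab x| + `|h x' - etab x'|).
Proof.
move=> bx bx'; rewrite /pair_loss.
have sh : loss01 1 (h x' - h x) = 1 - loss01 1 (h x - h x').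
  by have := loss01_swap (h x - h x'); rewrite opprB; lra.
have st : loss01 1 (t x' - t x) = 1 - loss01 1 (t x - t x').
  by have := loss01_swap (t x - t x'); rewrite opprB; lra.
rewrite sh st.
have -> : eta x * (1 - eta x') * loss01 1 (h x - h x') +
   eta x' * (1 - eta x) * (1 - loss01 1 (h x - h x')) -
   (eta x * (1 - eta x') * loss01 1 (t x - t x') +
    eta x' * (1 - eta x) * (1 - loss01 1 (t x - t x'))) =
   (eta x - eta x') * (loss01 1 (h x - h x') - loss01 1 (t x - t x')) by ring.
have /andP[q0 q1] := loss01_bounds 1 (t x - t x').
have /andP[l0 l1] := loss01_bounds 1 (h x - h x').
have e1 := ler_norm (h x - etab x); have e1' := ler_norm (etab x - h x).
have e2 := ler_norm (h x' - etab x'); have e2' := ler_norm (etab x' - h x').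
rewrite distrC in e1'; rewrite distrC in e2'.
have rhs0 : 0 <= c^-1 * (`|h x - etab x| + `|h x' - etab x'|).
  by rewrite mulr_ge0 ?invr_ge0 ?addr_ge0// ltW.
move: e1 e1' e2 e2' rhs0; set a := `|h x - _|; set b := `|h x' - _|.
move=> e1 e1' e2 e2' rhs0.
have [exx'|exx'|->] := ltgtP (eta x) (eta x'); last by rewrite subrr mul0r.
- have hl := link bx bx' exx'.
  have [hxx'|hxx'] := ltP (h x) (h x').
    have -> : loss01 1 (h x - h x') = 1.
      by rewrite /loss01 mul1r subr_lt0 hxx' subr_eq0 lt_eqF//= mulr0 addr0.
    apply: le_trans rhs0; rewrite nmulr_rle0 ?subr_lt0// subr_ge0//.
  (* Here [h] misorders or ties the pair, so [etab x' - etab x] is at most the sum of the two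
     errors. *)
  apply: le_trans (_ : eta x' - eta x <= _).
    have : 0 <= (eta x' - eta x) * (1 + (loss01 1 (h x - h x') - loss01 1 (t x - t x'))).
      by rewrite mulr_ge0//; lra.
    by rewrite mulrDr mulr1 -opprB mulNr; lra.
  by rewrite ler_pdivlMl//; lra.
- have hl := link bx' bx exx'.
  have [hxx'|hxx'] := ltP (h x') (h x).
    have -> : loss01 1 (h x - h x') = 0.
      rewrite /loss01 mul1r subr_lt0 (lt_gtF hxx') subr_eq0 gt_eqF//= mulr0 addr0//.
    apply: le_trans rhs0; rewrite pmulr_rle0 ?subr_gt0// sub0r oppr_le0//.
  apply: le_trans (_ : eta x - eta x' <= _).
    have : 0 <= (eta x - eta x') * (1 - (loss01 1 (h x - h x') - loss01 1 (t x - t x'))).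
      by rewrite mulr_ge0//; lra.
    by rewrite mulrBr mulr1; lra.
  by rewrite ler_pdivlMl//; lra.
Qed.

Lemma rank_regret_le :
  0 <= rank_regret D h <= (pi * (1 - pi))^-1 * (c^-1 * err).
Proof.
have mh : measurable_fun setT h by case: bh.
apply: inf_regret_le => // t mt.
have /andP[p0 p1] := pi01.
have k0 : 0 < (pi * (1 - pi))^-1 by rewrite invr_gt0 mulr_gt0// subr_gt0.
rewrite !rank_riskE// -mulrBr ler_pM2l//.
pose e (z : labeled R d) := `|h z.1 - etab z.1|.
have be : bmeas e by apply: bmeas_norm; apply: bmeasB; exact: bmeas_fst.
have swap s : measurable_fun setT s ->
    \int[D]_z \int[D]_z' pair_loss s z.1 z'.1 = \int[D]_z \int[D]_z' pair_loss s z'.1 z.1.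
  move=> ms; have b := bmeas_pair_loss ms.
  by rewrite (Ex_pair D D b) -(Ex_pair_swap D D b).
have bi s : measurable_fun setT s -> bmeas (fun z : labeled R d => \int[D]_z' pair_loss s z.1 z'.1).
  by move=> ms; exact: (bmeas_Ex D D (bmeas_pair_loss ms)).
have bsw s : measurable_fun setT s ->
    bmeas (fun zz : labeled R d * labeled R d => pair_loss s zz.2.1 zz.1.1).
  move=> ms; apply: (bmeas_comp (X := fun zz : labeled R d * labeled R d => (zz.2, zz.1)) _ (bmeas_pair_loss ms)).
  by apply: measurable_fun_pair; [exact: measurable_snd|exact: measurable_fst].
have bi' s : measurable_fun setT s -> bmeas (fun z : labeled R d => \int[D]_z' pair_loss s z'.1 z.1).
  by move=> ms; exact: (bmeas_Ex D D (bsw _ ms)).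
have bp s (z : labeled R d) : measurable_fun setT s -> bmeas (fun z' : labeled R d => pair_loss s z.1 z'.1).
  by move=> ms; exact: (bmeas_pair2 z (bmeas_pair_loss ms)).
have bp' s (z : labeled R d) : measurable_fun setT s -> bmeas (fun z' : labeled R d => pair_loss s z'.1 z.1).
  by move=> ms; exact: (bmeas_pair2 z (bsw _ ms)).
(* The claim is doubled: exchanging the two draws leaves the integrated loss unchanged, so the
   pointwise bound on the symmetrised loss can be integrated. *)
suff : \int[D]_z \int[D]_z' ((pair_loss h z.1 z'.1 + pair_loss h z'.1 z.1) -
    (pair_loss t z.1 z'.1 + pair_loss t z'.1 z.1)) <= 2 * (c^-1 * err).
  under eq_Rintegral => z _.
    rewrite (@ExB _ _ _ D (fun z' => _ + _) (fun z' => _ + _)); [|by apply: bmeasD; [exact: bp|exact: bp']|by apply: bmeasD; [exact: bp|exact: bp']].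
    rewrite !ExD; [|exact: bp|exact: bp'|exact: bp|exact: bp'].
    over.
  rewrite /= ExB; [|by apply: bmeasD; [exact: bi|exact: bi']|by apply: bmeasD; [exact: bi|exact: bi']].
  rewrite !ExD; [|exact: bi|exact: bi'|exact: bi|exact: bi'].
  by rewrite -!swap//; exact: half_le.
have bz (z : labeled R d) : bmeas (fun z' : labeled R d => c^-1 * (e z + e z')).
  by apply: bmeasZ; apply: bmeasD => //; exact: bmeas_cst.
apply: le_trans (_ : \int[D]_z \int[D]_z' (c^-1 * (e z + e z')) <= _); last first.
  under eq_Rintegral => z _.
    rewrite ExZ; last by apply: bmeasD => //; exact: bmeas_cst.
    rewrite (@ExD _ _ _ D (fun=> e z))//; last exact: bmeas_cst.
    rewrite Ex_cst.
    over.
  rewrite /= ExZ; last by apply: bmeasD => //; exact: bmeas_cst.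
  rewrite ExD//; last exact: bmeas_cst.
  by rewrite Ex_cst -/err; lra.
have bdiff (z : labeled R d) : bmeas (fun z' : labeled R d => (pair_loss h z.1 z'.1 + pair_loss h z'.1 z.1) -
    (pair_loss t z.1 z'.1 + pair_loss t z'.1 z.1)).
  by apply: bmeasB; apply: bmeasD; by [exact: bp|exact: bp'].
have bdiff2 : bmeas (fun z : labeled R d => \int[D]_z' ((pair_loss h z.1 z'.1 + pair_loss h z'.1 z.1) -
    (pair_loss t z.1 z'.1 + pair_loss t z'.1 z.1))).
  apply: (bmeas_Ex D D (f := fun zz : labeled R d * labeled R d => (pair_loss h zz.1.1 zz.2.1 + pair_loss h zz.2.1 zz.1.1) -
    (pair_loss t zz.1.1 zz.2.1 + pair_loss t zz.2.1 zz.1.1))).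
  by apply: bmeasB; apply: bmeasD; by [exact: bmeas_pair_loss|exact: bsw].
have be2 : bmeas (fun z : labeled R d => \int[D]_z' (c^-1 * (e z + e z'))).
  apply: (bmeas_Ex D D (f := fun zz : labeled R d * labeled R d => c^-1 * (e zz.1 + e zz.2))).
  apply: bmeasZ; apply: bmeasD.
    exact: bmeas_comp measurable_fst be.
  exact: bmeas_comp measurable_snd be.
apply: (Ex_le_on measurable_in_ball DG) => // z [bz1 _].
apply: (Ex_le_on measurable_in_ball DG) => // z' [bz'1 _].
exact: pair_loss_le.
Qed.

End ranking.

Section classification.
Hypothesis link : forall x, eball x ->
  [/\ 2^-1 < eta x -> c * (eta x - 2^-1) <= etab x - 2^-1 &
      eta x < 2^-1 -> c * (2^-1 - eta x) <= 2^-1 - etab x].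

Let cl x := Num.sg (2 * h x - 1).

Lemma measurable_sign_classifier : measurable_fun setT cl.
Proof.
have m1 : measurable_fun setT (fun x => 2 * h x - 1).
  by apply: measurable_funB => //; apply: measurable_funM => //; case: bh.
rewrite (_ : cl = fun x => if 2 * h x - 1 == 0 then 0 else if 2 * h x - 1 < 0 then -1 else 1).
  apply: measurable_fun_ifT => //; first exact: measurable_fun_eqr.
  by apply: measurable_fun_ifT => //; exact: measurable_fun_ltr.
by apply/funext => x; rewrite /cl /Num.sg; case: eqP => // _; case: ifP.
Qed.

Let point_loss s x := eta x * loss01 1 (s x) + (1 - eta x) * loss01 (-1) (s x).

Lemma risk01E s : measurable_fun setT s ->
  risk01 D s = \int[D]_z point_loss s z.1.
Proof.
move=> ms.
have b1 y : bmeas (fun x => loss01 y (s x)) by exact: bmeas_loss.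
have bd : bmeas (fun x => loss01 1 (s x) - loss01 (-1) (s x)) by exact: bmeasB.
transitivity (\int[D]_z (z.2%:R * (loss01 1 (s z.1) - loss01 (-1) (s z.1)) + loss01 (-1) (s z.1))).
  apply: eq_Rintegral => -[x b] _ /=; rewrite /label.
  by case: b; rewrite /= ?mul1r ?subrK ?mul0r ?add0r.
have f1 : bmeas (fun z : labeled R d => loss01 (-1) (s z.1)) by exact: bmeas_fst (b1 (-1)).
have f2 : bmeas (fun z : labeled R d => loss01 1 (s z.1) - loss01 (-1) (s z.1)) by exact: bmeas_fst bd.
rewrite ExD//; last by apply: bmeasM => //; exact: bmeas_label.
rewrite (class_prob_label hD bd) -ExD//; last by apply: bmeasM => //; exact: bmeas_fst.
by apply: eq_Rintegral => z _; rewrite /point_loss; ring.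
Qed.

Lemma loss01_neg (v : R) : loss01 (-1) v = 1 - loss01 1 v.
Proof.
have -> : loss01 (-1) v = loss01 1 (- v) by rewrite /loss01 mulN1r mul1r oppr_eq0.
by have := loss01_swap v; lra.
Qed.

(** The excess is [2 (eta x - 1/2)] times a difference of losses, and is positive only if [h x] is
    not strictly on the side of 1/2 where [eta x] lies. Then [c |eta x - 1/2| <= |etab x - 1/2| <=
    |h x - etab x|]. *)
Lemma point_loss_le t x : eball x ->
  point_loss cl x - point_loss t x <= 2 * (c^-1 * `|h x - etab x|).
Proof.
move=> bx; have [l1 l2] := link bx.
rewrite /point_loss !loss01_neg.
have -> : eta x * loss01 1 (cl x) + (1 - eta x) * (1 - loss01 1 (cl x)) -
  (eta x * loss01 1 (t x) + (1 - eta x) * (1 - loss01 1 (t x))) =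
  2 * ((eta x - 2^-1) * (loss01 1 (cl x) - loss01 1 (t x))) by field.
rewrite ler_pM2l//.
have /andP[q0 q1] := loss01_bounds 1 (t x).
have /andP[k0 k1] := loss01_bounds 1 (cl x).
have e1 := ler_norm (h x - etab x); have e1' := ler_norm (etab x - h x).
rewrite distrC in e1'.
have rhs0 : 0 <= c^-1 * `|h x - etab x|.
  by rewrite mulr_ge0 ?invr_ge0// ltW.
move: e1 e1' rhs0; set a := `|h x - _| => e1 e1' rhs0.
have clE : loss01 1 (cl x) = loss01 1 (2 * h x - 1).
  by rewrite /loss01 !mul1r /cl sgr_lt0 sgr_eq0.
have [ex|ex|->] := ltgtP (eta x) 2^-1; last by rewrite subrr mul0r.
- have hl := l2 ex.
  have [hx|hx] := ltP (h x) 2^-1.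
    have v0 : 2 * h x - 1 < 0 by lra.
    have e : loss01 1 (cl x) = 1.
      by rewrite clE /loss01 mul1r v0 lt_eqF//= mulr0 addr0.
    by apply: le_trans rhs0; rewrite nmulr_rle0 ?subr_lt0// e subr_ge0.
  apply: le_trans (_ : 2^-1 - eta x <= _).
    have : 0 <= (2^-1 - eta x) * (1 + (loss01 1 (cl x) - loss01 1 (t x))).
      by rewrite mulr_ge0//; lra.
    by rewrite mulrDr mulr1 -opprB mulNr; lra.
  by rewrite ler_pdivlMl//; lra.
- have hl := l1 ex.
  have [hx|hx] := ltP 2^-1 (h x).
    have v0 : 0 < 2 * h x - 1 by lra.
    have e : loss01 1 (cl x) = 0.
      by rewrite clE /loss01 mul1r (lt_gtF v0) gt_eqF//= mulr0 addr0.
    by apply: le_trans rhs0; rewrite pmulr_rle0 ?subr_gt0// e sub0r oppr_le0.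
  apply: le_trans (_ : eta x - 2^-1 <= _).
    have : 0 <= (eta x - 2^-1) * (1 - (loss01 1 (cl x) - loss01 1 (t x))).
      by rewrite mulr_ge0//; lra.
    by rewrite mulrBr mulr1; lra.
  by rewrite ler_pdivlMl//; lra.
Qed.

Lemma regret01_le : 0 <= regret01 D cl <= 2 * (c^-1 * err).
Proof.
have mc := measurable_sign_classifier.
apply: inf_regret_le => // t mt.
have be : bmeas (fun z : labeled R d => `|h z.1 - etab z.1|).
  by apply: bmeas_norm; apply: bmeasB; exact: bmeas_fst.
have bpl s : measurable_fun setT s -> bmeas (fun z : labeled R d => point_loss s z.1).
  move=> ms; apply: (bmeas_fst (f := point_loss s)).
  apply: bmeasD; apply: bmeasM => //; try exact: bmeas_loss.
  by apply: bmeasB => //; exact: bmeas_cst.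
rewrite !risk01E// -ExB; [|exact: bpl|exact: bpl].
rewrite /err -ExZ// -ExZ; last exact: bmeasZ.
apply: (Ex_le_on measurable_in_ball DG).
- by apply: bmeasB; exact: bpl.
- by do 2 apply: bmeasZ.
- by move=> z [bz _]; exact: point_loss_le.
Qed.

End classification.
End regrets.

(** * The iteration budget and the conclusion *)

Section iteration_budget.
Context {d : nat}.

(** Determined by d and m alone, so one rule serves all distributions; it is 0 when no [k]
    qualifies. *)
Definition budget (m : nat) : nat :=
  \max_(k < m.+1 | (@sample_size d k <= m)%N) k.

Lemma sample_size_budget m : (@sample_size d 0 <= m)%N ->
  (@sample_size d (budget m) <= m)%N.
Proof.
move=> m0; have : (0 < #|[pred k : 'I_m.+1 | (@sample_size d k <= m)%N]|)%N.
  by apply/card_gt0P; exists ord0.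
move=> /(eq_bigmax_cond (fun k : 'I_m.+1 => k : nat))[k km e].
by rewrite /budget (_ : \max_(_ < _ | _) _ = k :> nat).
Qed.

Lemma budget_ge k m : (k <= m)%N -> (@sample_size d k <= m)%N -> (k <= budget m)%N.
Proof.
move=> km kS; rewrite -ltnS in km.
exact: (leq_bigmax_cond (F := fun k : 'I_m.+1 => k : nat) (Ordinal km)).
Qed.

Lemma budget_infty : budget @ \oo --> \oo.
Proof.
apply/cvgnyPge => A; exists (maxn A (@sample_size d A)) => // m /=.
by rewrite geq_max => /andP[? ?]; exact: budget_ge.
Qed.

(** The exceedance set lies in the measurable set [Bad] of unrepresentative samples, of probability
    at most [1 / (budget m + 1)]; outer measures are monotone. *)
Lemma cvg0_of_good_events {R : realType} (D : probability (labeled R d) R)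
    (V : forall m, m.-tuple (labeled R d) -> R) : D in_ball = 1%E ->
  (forall eps : R, 0 < eps -> exists k0, forall m S, (k0 <= budget m)%N -> (0 < m)%N ->
    representative D (budget m) S -> `|V m S| <= eps) ->
  cvg0_in_probability D V.
Proof.
move=> DG hV eps e0; have [k0 hk] := hV _ e0.
have lim0 : (fun m => ((budget m).+1%:R^-1)%:E : \bar R) @ \oo --> 0%E.
  apply: cvg_EFin; first by apply: nearW.
  exact: cvg_comp budget_infty cvg_harmonic.
apply: (squeeze_cvge _ (cvg_cst 0%E) lim0).
have /cvgnyPge/(_ k0) := budget_infty; case=> N _ hN.
exists (maxn N (maxn 1 (@sample_size d 0))) => // m /=.
rewrite !geq_max => /and3P[Nm m0 mS].
have k0m := hN m Nm; rewrite mu_ext_ge0/=; last by move=> X; exact: measure_ge0.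
have [Bad [mB PB hB]] := representative_sample DG (sample_size_budget mS).
apply: le_trans PB; rewrite -(measurable_mu_extE _ mB); apply: le_mu_ext => S /= VS.
apply: contrapT => nB; move: VS; apply/negP; rewrite -leNgt.
exact: hk (hB _ nB).
Qed.

End iteration_budget.

(** * Reduction of the corrupted problem to a link of slope at most 1 *)

Section transfer.
Context {R : realType} {d : nat}.

Lemma class_prob_eq_on (D : probability (labeled R d) R) (e e' : vec R d -> R) :
  D in_ball = 1%E -> class_prob D e ->
  measurable_fun setT e' -> (forall x, 0 <= e' x <= 1) ->
  (forall x, eball x -> e x = e' x) -> class_prob D e'.
Proof.
move=> DG [me e01 hA] me' e'01 ee'; split=> // A mA; rewrite -(hA A mA).
have bA : bmeas (fun z : labeled R d => \1_A z.1 : R) by exact/bmeas_fst/bmeas_indic.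
apply: (Ex_eq_on measurable_in_ball DG).
- by apply: bmeasM => //; apply: bmeasB; [exact: bmeas_label|exact/bmeas_fst/bmeas01].
- by apply: bmeasM => //; apply: bmeasB; [exact: bmeas_label|exact/bmeas_fst/bmeas01].
- by move=> z [bz _]; rewrite ee'.
Qed.

Lemma lipschitzE (K : R) (f : R -> R) : K.-lipschitz f ->
  forall a b, `|f a - f b| <= K * `|a - b|.
Proof. by move=> lf a b; exact: (lf (a, b)). Qed.

Lemma lipschitz_cont (K : R) (f : R -> R) : K.-lipschitz f -> continuous f.
Proof.
move=> lf a; apply/cvgrPdist_le => /= e e0; near=> b.
apply: le_trans (lipschitzE lf _ _) _.
have K1 : 0 < `|K| + 1 by rewrite ltr_wpDl.
apply: le_trans (_ : (`|K| + 1) * `|a - b| <= _).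
  by rewrite ler_wpM2r//; apply: le_trans (ler_norm _) _; rewrite lerDl.
rewrite -ler_pdivlMl// mulrC; near: b.
by apply: cvgr_dist_le => //; rewrite divr_gt0.
Unshelve. all: by end_near.
Qed.

(* Rescaling the weight makes the link 1-Lipschitz; clipping the score to the
   range of [inner w] on the ball makes it monotone on the whole line. *)
Lemma rescale_link (g : R -> R) (r Lam : R) : 0 <= r -> 0 < Lam ->
  (forall z z', - r <= z -> z <= z' -> z' <= r -> 0 <= g z' - g z <= Lam * (z' - z)) ->
  slope01 (fun a => g (Num.min r (Num.max (- r) (a / Lam)))).
Proof.
move=> r0 L0 hg a b ab.
have rr : - r <= r by lra.
have abL : a / Lam <= b / Lam by rewrite ler_wpM2r// invr_ge0 ltW.
have LE : Lam * (b / Lam - a / Lam) = b - a by field; rewrite gt_eqF.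
set ca := Num.min _ (Num.max _ (a / Lam)); set cb := Num.min _ (Num.max _ (b / Lam)).
have [h1 h2 h3 h4] : [/\ - r <= ca, ca <= cb, cb <= r & cb - ca <= b / Lam - a / Lam].
  rewrite /ca /cb.
  by case: (clip_spec (a / Lam) rr) => -[? ->]; case: (clip_spec (b / Lam) rr) => -[? ->];
    split; lra.
have /andP[-> g1] := hg _ _ h1 h2 h3; apply: le_trans g1 _.
by rewrite -LE ler_pM2l.
Qed.

Lemma inner_scale (c : R) (w x : vec R d) :
  inner [tuple c * tnth w k | k < d] x = c * inner w x.
Proof.
rewrite /inner mulr_sumr; apply: eq_bigr => k _.
by rewrite tnth_mktuple mulrA.
Qed.

End transfer.

Theorem proposition10 (R : realType) (d : nat) :
  exists sel : forall m : nat, m.-tuple (labeled R d) -> nat,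
    (forall m : nat, measurable_fun setT (sel m)) /\
    let etahat := fun (m : nat) (S : m.-tuple (labeled R d)) =>
      slisotron S (sel m S) in
    (forall (m : nat) (S : m.-tuple (labeled R d)) (x : vec R d),
       (0 < m)%N -> eball x -> 0 <= etahat m S x <= 1) /\
    forall (D Dbar : probability (labeled R d) R) (eta : vec R d -> R)
           (L W : R) (u : R -> R) (w : vec R d) (fm fp : R -> R),
      D (eball `*` setT) = 1%E ->
      0 < base_rate D < 1 ->
      is_class_probability D eta ->
      0 <= L -> 0 <= W ->
      SIM_representation L W u w eta ->
      (exists K : R, K.-lipschitz fm) ->
      (exists K : R, K.-lipschitz fp) ->
      is_SIN D eta w fm fp Dbar ->
      cvg0_in_probability Dbar (fun m S => rank_regret D (etahat m S)) /\
      (fm = fp ->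
       cvg0_in_probability Dbar
         (fun m S => regret01 D (fun x => Num.sg (2 * etahat m S x - 1)))).
Proof.
exists (fun m S => best_iterate (@budget d m) S); split.
  by move=> m; exact: measurable_best_iterate.
move=> etahat; split.
  by move=> m S x m0 _; exact: slisotron_01.
move=> D Dbar eta L W u w fm fp DG pi01 hcp L0 _ [u01 u_mono u_lip _ etaE].
move=> [Km fm_lip] [Kp fp_lip] [fm01 fp01 tot [a1 a2 a3] iln].
have cu := lipschitz_cont u_lip.
have cfm := lipschitz_cont fm_lip.
have cfp := lipschitz_cont fp_lip.
have mlink (g : R -> R) : continuous g -> measurable_fun setT (fun x : vec R d => g (inner w x)).
  move=> cg; have mg : measurable_fun setT (g : R -> R) by exact: continuous_measurable_fun.
  exact: (measurableT_comp mg (measurable_inner_l w)).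
set r := enorm w.
have r0 : 0 <= r by exact: sqrtr_ge0.
pose e0 (x : vec R d) := u (inner w x).
have hD : class_prob D e0.
  apply: (is_class_probability_class_prob DG hcp _ _ etaE); first exact: (mlink u cu).
  by move=> x; exact: u01.
have adm : BCN_admissible fm fp (inner w) e0.
  split=> // [x x' bx bx'|f ff x x' bx bx']; rewrite /e0 -!etaE//.
    exact: a1.
  exact: a2.
have [c c0 hc] := rate_lower_bound cfm cfp tot.
have incr := noisy_link_increasing u01 u_mono cu adm hc.
pose ub z := u z * (1 - fp z) + (1 - u z) * fm z.
(* A Lipschitz constant of [ub]: each of its two products contributes L and one noise constant.
   Absolute values allow for [Km] and [Kp] of any sign, and the [+ 1] makes [Lam] positive. *)
pose Lam := 2 * L + `|Km| + `|Kp| + 1.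
have Lam0 : 0 < Lam by rewrite /Lam; have := normr_ge0 Km; have := normr_ge0 Kp; lra.
have ub_lip z z' : `|ub z - ub z'| <= Lam * `|z - z'|.
  have n1 (a : R) : 0 <= a <= 1 -> `|a| <= 1 by move=> /andP[? ?]; rewrite ler_norml; lra.
  have n2 (a : R) : 0 <= a <= 1 -> `|1 - a| <= 1 by move=> /andP[? ?]; rewrite ler_norml; lra.
  have Kn (K : R) (f : R -> R) : K.-lipschitz f -> `|f z - f z'| <= `|K| * `|z - z'|.
    move=> lf; apply: le_trans (lipschitzE lf _ _) _.
    by rewrite ler_wpM2r// ler_norm.
  have p1 : `|u z * (1 - fp z) - u z' * (1 - fp z')| <= L * `|z - z'| + `|Kp| * `|z - z'|.
    apply: le_trans (dist_prod_le _ _ _ _) _; [exact: n1|exact: n2|].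
    apply: lerD; first exact: lipschitzE u_lip _ _.
    by rewrite opprB addrC subrKA distrC; exact: Kn.
  have p2 : `|(1 - u z) * fm z - (1 - u z') * fm z'| <= L * `|z - z'| + `|Km| * `|z - z'|.
    apply: le_trans (dist_prod_le _ _ _ _) _; [exact: n2|exact: n1|].
    apply: lerD; last exact: Kn.
    by rewrite opprB addrC subrKA distrC; exact: lipschitzE u_lip _ _.
  have -> : ub z - ub z' = (u z * (1 - fp z) - u z' * (1 - fp z')) +
      ((1 - u z) * fm z - (1 - u z') * fm z') by rewrite /ub; ring.
  apply: le_trans (ler_normD _ _) _; apply: le_trans (lerD p1 p2) _.
  rewrite /Lam -subr_ge0; set t := `|z - z'|.
  have -> : (2 * L + `|Km| + `|Kp| + 1) * t - (L * t + `|Kp| * t + (L * t + `|Km| * t)) = t by ring.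
  exact: normr_ge0.
(* On the ball [v (inner ws x) = ub (inner w x)]: the factor [Lam] in [ws] undoes the division in
   [v], and the clipping is inactive there. *)
pose v a := ub (Num.min r (Num.max (- r) (a / Lam))).
pose ws : vec R d := [tuple Lam * tnth w k | k < d].
have v_slope : slope01 v.
  apply: rescale_link => // z z' rz zz' zr'; have := ub_lip z' z.
  have uu := u_mono _ _ zz'; have := incr _ _ rz zz' zr'; rewrite -/(ub z) -/(ub z') => h.
  have h0 : 0 <= c * (u z' - u z) by rewrite mulr_ge0 ?subr_ge0// ltW.
  rewrite (ger0_norm (x := z' - z)) ?subr_ge0// => hl.
  by apply/andP; split; [rewrite -subr_ge0; exact: le_trans h0 h|exact: le_trans (ler_norm _) hl].
have v_01 a : 0 <= v a <= 1.
  rewrite /v /ub; set z := Num.min _ _.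
  have /andP[? ?] := u01 z; have /andP[? ?] := fm01 z; have /andP[? ?] := fp01 z.
  by apply/andP; split; nra.
have rr : - r <= r by lra.
have vE x : eball x -> v (inner ws x) = ub (inner w x).
  move=> bx; rewrite /v inner_scale mulrC mulKf ?gt_eqF//.
  have /andP[? ?] : - r <= inner w x <= r by exact: inner_range.
  by case: (clip_spec (inner w x) rr) => -[? ->] //; congr ub; apply/eqP; rewrite eq_le; apply/andP; split; lra.
have DbarG : Dbar in_ball = 1%E by rewrite (ILN_marginal iln)//; exact: measurable_eball.
have hDb : class_prob Dbar (v \o inner ws).
  have h := class_prob_ILN iln (mlink fm cfm) (mlink fp cfp) (fun x => fm01 _) (fun x => fp01 _) hD.
  apply: (class_prob_eq_on DbarG h) => [||x bx].
  - by case: (bmeas_link ws v_slope v_01).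
  - by move=> x; exact: v_01.
  - by rewrite /= vE.
have close th : 0 < th -> exists k0, forall m (S : m.-tuple (labeled R d)),
    (k0 <= @budget d m)%N -> (0 < m)%N -> representative Dbar (@budget d m) S ->
    bmeas (etahat m S) /\ \int[D]_z `|etahat m S z.1 - v (inner ws z.1)| <= th.
  move=> th0; have [k0 hk] := slisotron_eventually_close v_slope v_01 hDb th0.
  exists k0 => m S km m0 rep.
  have Sball i : eball (tnth S i).1 by have [] := rep.1 i.
  have bh : bmeas (etahat m S).
    by apply: bmeas_link; [exact: LPAV_along_slope01|exact: LPAV_along_01].
  split=> //; rewrite -(Ex_ILN_fst iln (f := fun x => `|etahat m S x - v (inner ws x)|)).
    exact: hk.
  by apply: bmeas_norm; apply: bmeasB => //; exact: bmeas_link.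
have bv : bmeas (fun x => v (inner ws x)) by exact: bmeas_link.
split=> [|fmp]; apply: cvg0_of_good_events => // eps eps0.
- have /andP[p0 p1] := pi01.
  have k0 : 0 < base_rate D * (1 - base_rate D) by rewrite mulr_gt0// subr_gt0.
  (* The factor cancels the constant of the ranking regret bound. *)
  have [k1 hk] := close (eps * (c * (base_rate D * (1 - base_rate D)))) (mulr_gt0 eps0 (mulr_gt0 c0 k0)).
  exists k1 => m S km m0 rep; have [bh herr] := hk m S km m0 rep.
  have lk x x' : eball x -> eball x' -> e0 x < e0 x' ->
      c * (e0 x' - e0 x) <= v (inner ws x') - v (inner ws x).
    move=> bx bx' exx'; rewrite !vE//.
    have /andP[? ?] := inner_range w bx; have /andP[? ?] := inner_range w bx'.
    (* Since [u] is monotone, a strictly larger value of [u] forces a larger score. *)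
    apply: incr => //; rewrite leNgt; apply/negP => /ltW/u_mono.
    by rewrite leNgt => /negP; apply.
  have /andP[q0 q1] := rank_regret_le DG hD c0 bh bv pi01 lk.
  rewrite ger0_norm//; apply: le_trans q1 _.
  rewrite ler_pdivrMl// ler_pdivrMl//; apply: le_trans herr _.
  by rewrite le_eqVlt; apply/orP; left; apply/eqP; ring.
- have [k1 hk] := close (eps * (c / 2)) (mulr_gt0 eps0 (divr_gt0 c0 (ltr0Sn R 1))).
  exists k1 => m S km m0 rep; have [bh herr] := hk m S km m0 rep.
  have lk x : eball x -> [/\
      2^-1 < e0 x -> c * (e0 x - 2^-1) <= v (inner ws x) - 2^-1 &
      e0 x < 2^-1 -> c * (2^-1 - e0 x) <= 2^-1 - v (inner ws x)].
    move=> bx; rewrite !vE//; have hz := hc _ (inner_range w bx).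
    (* Equal noise functions keep 1/2 as the threshold: the deviation from 1/2 is only multiplied by
       [1 - fp - fm >= c]. *)
    have e : ub (inner w x) - 2^-1 = (1 - fp (inner w x) - fm (inner w x)) * (e0 x - 2^-1).
      by rewrite /ub /e0 fmp; field.
    split=> ex; first by rewrite e ler_wpM2r//; lra.
    have -> : 2^-1 - ub (inner w x) = (1 - fp (inner w x) - fm (inner w x)) * (2^-1 - e0 x).
      by rewrite -[LHS]opprB e -mulrN opprB.
    by rewrite ler_wpM2r//; lra.
  have /andP[q0 q1] := regret01_le DG hD c0 bh bv lk.
  rewrite ger0_norm//; apply: le_trans q1 _.
  apply: le_trans (_ : 2 * (c^-1 * (eps * (c / 2))) <= _).
    by rewrite !ler_wpM2l// invr_ge0 ltW.
  by rewrite le_eqVlt; apply/orP; left; apply/eqP; field; rewrite gt_eqF.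
Qed.
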